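(* Let $(L,A)$ be a Lie pair over $M$ with quotient $B=L/A$. Given a splitting $i\circ p+j\circ q=\mathrm{id}_L$ of the short exact sequence $0\to A\xrightarrow{i}L\xrightarrow{q}B\to0$ and a torsion-free $L$-connection $\nabla$ on $B$, there exists a unique $$X^\nabla\in\Gamma(L^\vee\otimes\hat S^{\geqslant2}(B^\vee)\otimes B)$$ (a 1-form valued in formal vertical vector fields on $B$) satisfying $h_\natural(X^\nabla)=0$ and such that the derivation $$Q=-\delta+d_L^\nabla+X^\nabla:\ \Gamma(\Lambda^\bullet L^\vee\otimes\hat S(B^\vee))\to\Gamma(\Lambda^{\bullet+1}L^\vee\otimes\hat S(B^\vee))$$ satisfies $Q^2=0$. As a consequence, $(L[1]\oplus B,Q)$ is a dg manifold.
   Context: $\Bbbk$ is $\mathbb R$ or $\mathbb C$, $M$ is a smooth manifold, $R=C^\infty(M,\Bbbk)$; Lie algebroids are over $\Bbbk$, with anchor $\rho$. A Lie pair $(L,A)$ is an inclusion $i:A\hookrightarrow L$ of Lie algebroids over $M$; $B=L/A$ has rank $r$, $q:L\to B$ is the projection. A splitting consists of bundle maps $p:L\to A$, $j:B\to L$ with $pi=\mathrm{id}_A$, $qj=\mathrm{id}_B$, $ip+jq=\mathrm{id}_L$; $p^\top:A^\vee\to L^\vee$, $q^\top:B^\vee\to L^\vee$ are the dual maps. An $L$-connection $\nabla$ on $B$ is torsion-free if $\nabla_{l_1}q(l_2)-\nabla_{l_2}q(l_1)-q([l_1,l_2])=0$ for all $l_1,l_2\in\Gamma(L)$ (it then automatically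 extends the Bott $A$-connection $\nabla^{\mathrm{Bott}}_aq(l)=q([i(a),l])$). $\hat S(B^\vee)$ is the completion of the symmetric algebra of $B^\vee$ with respect to the ideal generated by $B^\vee$, and $\hat S^{\ge n}(B^\vee)$ is its part of symmetric degree $\ge n$. The connection $\nabla$ induces a connection on $\hat S(B^\vee)$ by duality and the Leibniz rule, and $d_L^\nabla(\omega\otimes\sigma)=(d_L\omega)\otimes\sigma+\sum_m(\nu_m\wedge\omega)\otimes\nabla_{v_m}\sigma$, where $(v_m),(\nu_m)$ are dual local frames of $L,L^\vee$ and $d_L$ is the Chevalley–Eilenberg differential of $L$. The algebra of functions on the graded manifold $L[1]\oplus B$ is $\Gamma(\Lambda^\bullet L^\vee\otimes\hat S(B^\vee))$; a dg manifold is a graded manifold with a degree $+1$ derivation of its functions of square zero. For dual local frames $(\partial_k)_{k=1}^r$ of $B$, $(\chi_k)_{k=1}^r$ of $B^\vee$, and $J\in\mathbb N_0^r$, let $\chi^J=\chi_1^{J_1}\odot\cdots\odot\chi_r^{J_r}$, $|J|=\sum J_k$, $e_k$ the $k$-th unit multi-index. $\delta(\omega\otimes\chi^J)=\sum_{m=1}^r(q^\top(\chi_m)\wedge\omega)\otimes J_m\chi^{J-e_m}$. For $\omega\in p^\top(\Lambda^uA^\vee)\wedge q^\top(\Lambda^vB^\vee)$, $h(\omega\otimes\chi^J)=\frac1{v+|J|}\sum_{k=1}^r(\iota_{j(\partial_k)}\omega)\otimes\chi^{J+e_k}$ if $v\ge1$, and $0$ if $v=0$. $h_\natural=h\otimes\mathrm{id}_B$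 on $\Gamma(\Lambda^\bullet L^\vee\otimes\hat S(B^\vee)\otimes B)$. An element $\lambda\otimes\sigma\otimes b\in\Gamma(L^\vee\otimes\hat S(B^\vee)\otimes B)$ acts on $\Gamma(\Lambda^\bullet L^\vee\otimes\hat S(B^\vee))$ as the derivation $\omega\otimes s\mapsto(\lambda\wedge\omega)\otimes(\sigma\odot\iota_bs)$, where $\iota_b$ is the derivation of $\hat S(B^\vee)$ extending the pairing with $b$. *)

(* Defs.v *)
From HB Require Import structures.
From mathcomp Require Import all_boot all_order all_algebra.
From mathcomp Require Import all_classical all_reals all_analysis.
From mathcomp Require Import complex.

Set Implicit Arguments.
Unset Strict Implicit.
Unset Printing Implicit Defensive.

Import Order.TTheory GRing.Theory Num.Theory.
Import numFieldNormedType.Exports.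

Local Open Scope classical_set_scope.
Local Open Scope ring_scope.

Inductive ground_field := RealNumbers | ComplexNumbers.

Definition scalar (R : realType) (k : ground_field) : fieldType :=
  match k with
  | RealNumbers => R
  | ComplexNumbers => R[i]
  end.

Definition re (R : realType) (k : ground_field) : scalar R k -> R :=
  match k with
  | RealNumbers => id
  | ComplexNumbers => @complex.Re R
  end.

Definition im (R : realType) (k : ground_field) : scalar R k -> R :=
  match k with
  | RealNumbers => fun=> 0
  | ComplexNumbers => @complex.Im R
  end.

Section scalar_theory.
Context {R : realType} {k : ground_field}.
Implicit Types x y : scalar R k.

Lemma reD x y : re (x + y) = re x + re y.
Proof. by case: k x y => //= -[? ?] [? ?]. Qed.

Lemma imD x y : im (x + y) = im x + im y.
Proof. by case: k x y => [x y|[? ?] [? ?]] //=; rewrite addr0. Qed.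

Lemma reM x y : re (x * y) = re x * re y - im x * im y.
Proof. by case: k x y => [x y|[? ?] [? ?]] //=; rewrite mulr0 subr0. Qed.

Lemma imM x y : im (x * y) = re x * im y + im x * re y.
Proof.
case: k x y => [x y|[? ?] [? ?]] //=; first by rewrite mulr0 mul0r addr0.
Qed.

End scalar_theory.

Section euclidean.
Context {R : realType} {n : nat}.
Implicit Types (U : set 'rV[R]_n) (f g : 'rV[R]_n -> R).

(* [f] is of class [C^m] on the open set [U]: its iterated partial derivatives
   of order at most [m] exist and are continuous at every point of [U]. *)
Fixpoint Cn_on (m : nat) U f : Prop :=
  (forall x, U x -> {for x, continuous f}) /\
  match m with
  | 0%N => True
  | m'.+1 => forall i : 'I_n,
      (forall x, U x -> derivable f x (delta_mx 0 i)) /\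
      Cn_on m' U ('D_(delta_mx 0 i) f)
  end.

Definition Cinfty_on U f := forall m, Cn_on m U f.

Lemma Cn_on_eq m U f g : open U -> (forall x, U x -> f x = g x) ->
  Cn_on m U f -> Cn_on m U g.
Proof.
move=> Uo; elim: m f g => [|m IH] f g fg /= [fc fd].
all: have nfg x : U x -> \near x, f x = g x.
1,3: by move=> Ux; near=> y; apply: fg; near: y; exact: open_nbhs_nbhs.
all: have gc x : U x -> {for x, continuous g}.
1,3: move=> Ux; rewrite /prop_for /continuous_at -(fg x Ux).
1,2: by apply: cvg_trans (fc x Ux); exact: (near_eq_cvg (nfg x Ux)).
- by [].
split=> // i; have [fdi fCi] := fd i; split.
- by move=> x Ux; apply: near_eq_derivable (nfg x Ux) (fdi x Ux).
- apply: IH fCi => x Ux; exact: near_eq_derive (nfg x Ux).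
Unshelve. all: by end_near. Qed.

Lemma Cn_onW m U f : Cn_on m.+1 U f -> Cn_on m U f.
Proof.
elim: m f => [|m IH] f /= [fc fd]; first by split.
split=> // i; have [? h] := fd i; split=> //.
by apply: IH.
Qed.

Lemma Cn_on_cst m U (c : R) : open U -> Cn_on m U (fun=> c).
Proof.
move=> Uo; elim: m c => [|m IH] c /=.
all: split; first by move=> x _; exact: cst_continuous.
- by [].
move=> i; split; first by move=> x _; exact: derivable_cst.
by apply: (@Cn_on_eq _ _ (fun=> 0)) => // x _; rewrite derive_cst.
Qed.

Lemma Cn_onD m U f g : open U -> Cn_on m U f -> Cn_on m U g ->
  Cn_on m U (fun x => f x + g x).
Proof.
move=> Uo; elim: m f g => [|m IH] f g /= [fc fd] [gc gd].
all: split; first by move=> x Ux; exact: (cvgD (fc x Ux) (gc x Ux)).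
- by [].
move=> i; have [fdi fCi] := fd i; have [gdi gCi] := gd i; split.
  by move=> x Ux; apply: derivableD; [exact: fdi|exact: gdi].
apply: Cn_on_eq (IH _ _ fCi gCi) => // x Ux.
by rewrite deriveD //; [exact: fdi|exact: gdi].
Qed.

Lemma Cn_onM m U f g : open U -> Cn_on m U f -> Cn_on m U g ->
  Cn_on m U (fun x => f x * g x).
Proof.
move=> Uo; elim: m f g => [|m IH] f g fC gC.
  move: fC gC => /= [fc _] [gc _]; split=> // x Ux.
  by exact: (cvgM (fc x Ux) (gc x Ux)).
have [fm gm] := (Cn_onW fC, Cn_onW gC).
move: fC gC => /= [fc fd] [gc gd]; split.
  by move=> x Ux; exact: (cvgM (fc x Ux) (gc x Ux)).
move=> i; have [fdi fCi] := fd i; have [gdi gCi] := gd i; split.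
  by move=> x Ux; apply: derivableM; [exact: fdi|exact: gdi].
apply: Cn_on_eq (Cn_onD Uo (IH _ _ fm gCi) (IH _ _ gm fCi)) => // x Ux.
by rewrite deriveM //; [exact: fdi|exact: gdi].
Qed.

Lemma Cinfty_on_eq U f g : open U -> (forall x, U x -> f x = g x) ->
  Cinfty_on U f -> Cinfty_on U g.
Proof. by move=> Uo fg fC m; exact: Cn_on_eq (fC m). Qed.

Lemma Cinfty_on_cst U (c : R) : open U -> Cinfty_on U (fun=> c).
Proof. by move=> Uo m; exact: Cn_on_cst. Qed.

Lemma Cinfty_onD U f g : open U -> Cinfty_on U f -> Cinfty_on U g ->
  Cinfty_on U (fun x => f x + g x).
Proof. by move=> Uo fC gC m; exact: Cn_onD. Qed.

Lemma Cinfty_onM U f g : open U -> Cinfty_on U f -> Cinfty_on U g ->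
  Cinfty_on U (fun x => f x * g x).
Proof. by move=> Uo fC gC m; exact: Cn_onM. Qed.

End euclidean.

(* [mfd_dom a] is the domain of the chart [a]; [chart a] and [chart_inv a] are
   only meaningful on [mfd_dom a] and on [chart a @` mfd_dom a]. *)
Record smooth_manifold (R : realType) := SmoothManifold {
  mfd_carrier :> topologicalType ;
  mfd_dim : nat ;
  mfd_hausdorff : hausdorff_space mfd_carrier ;
  mfd_second_countable : @second_countable mfd_carrier ;
  mfd_atlas : Type ;
  mfd_dom : mfd_atlas -> set mfd_carrier ;
  chart : mfd_atlas -> mfd_carrier -> 'rV[R]_mfd_dim ;
  chart_inv : mfd_atlas -> 'rV[R]_mfd_dim -> mfd_carrier ;
  mfd_dom_open : forall a, open (mfd_dom a) ;
  mfd_dom_cover : forall x, exists a, mfd_dom a x ;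
  chart_image_open : forall a, open (chart a @` mfd_dom a) ;
  chartK : forall a x, mfd_dom a x -> chart_inv a (chart a x) = x ;
  chart_continuous : forall a x, mfd_dom a x -> {for x, continuous (chart a)} ;
  chart_inv_continuous : forall a x, mfd_dom a x ->
    {for chart a x, continuous (chart_inv a)} ;
  chart_transition : forall a b (c : 'I_mfd_dim),
    Cinfty_on (chart a @` (mfd_dom a `&` mfd_dom b))
              (fun y => chart b (chart_inv a y) 0 c)
}.

Section smooth_functions.
Context {R : realType} (M : smooth_manifold R) (k : ground_field).
Local Notation K := (scalar R k).

Lemma chart_open (U : set M) a : open U ->
  open (chart a @` (U `&` mfd_dom a)).
Proof.
move=> Uo; rewrite openE => y [x [Ux ax] xy]; rewrite -{y}xy /interior.
have nU : nbhs (chart a x) (chart_inv a @^-1` U).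
  apply: (chart_inv_continuous ax); rewrite chartK //.
  exact: open_nbhs_nbhs.
have nI : nbhs (chart a x) (chart a @` mfd_dom a).
  by apply: open_nbhs_nbhs; split; [exact: chart_image_open|exists x].
apply: filterS (filterI nU nI) => _ [] /[swap] -[z az <-] /=.
by rewrite chartK // => Uz; exists z.
Qed.

Definition smooth_on (U : set M) (f : M -> K) :=
  forall a, let V := chart a @` (U `&` mfd_dom a) in
    Cinfty_on V (fun y => re (f (chart_inv a y))) /\
    Cinfty_on V (fun y => im (f (chart_inv a y))).

Lemma smooth_on_cst U (c : K) : open U -> smooth_on U (fun=> c).
Proof. by move=> Uo a; split; apply: Cinfty_on_cst; exact: chart_open. Qed.

Lemma smooth_onD U f g : open U -> smooth_on U f -> smooth_on U g ->
  smooth_on U (fun x => f x + g x).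
Proof.
move=> Uo fs gs a; have Vo := @chart_open U a Uo.
have [[fr fi] [gr gi]] := (fs a, gs a); split.
- by apply: Cinfty_on_eq (Cinfty_onD Vo fr gr) => // y _; rewrite reD.
- by apply: Cinfty_on_eq (Cinfty_onD Vo fi gi) => // y _; rewrite imD.
Qed.

Lemma smooth_onM U f g : open U -> smooth_on U f -> smooth_on U g ->
  smooth_on U (fun x => f x * g x).
Proof.
move=> Uo fs gs a; have Vo := @chart_open U a Uo.
have [[fr fi] [gr gi]] := (fs a, gs a); split.
- apply: Cinfty_on_eq (Cinfty_onD Vo (Cinfty_onM Vo fr gr)
    (Cinfty_onM Vo (Cinfty_on_cst (-1) Vo) (Cinfty_onM Vo fi gi))) => // y _.
  by rewrite reM mulN1r.
- apply: Cinfty_on_eq (Cinfty_onD Vo (Cinfty_onM Vo fr gi)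
    (Cinfty_onM Vo fi gr)) => // y _.
  by rewrite imM.
Qed.

Lemma smooth_onN U f : open U -> smooth_on U f -> smooth_on U (fun x => - f x).
Proof.
move=> Uo fs; rewrite (_ : (fun x => - f x) = (fun x => -1 * f x)).
  by apply: smooth_onM => //; exact: smooth_on_cst.
by apply/funext => x; rewrite mulN1r.
Qed.

End smooth_functions.

Section smoothfun.
Context {R : realType} (M : smooth_manifold R) (k : ground_field).
Local Notation K := (scalar R k).

Definition smoothfun_pred : {pred M -> K} :=
  mem [set f : M -> K | smooth_on [set: M] f].

Record smoothfun := Smoothfun {
  smoothfun_val :> M -> K ;
  smoothfunP : smoothfun_val \in smoothfun_pred
}.

HB.instance Definition _ := [isSub for smoothfun_val].
HB.instance Definition _ := [Choice of smoothfun by <:].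

Lemma smoothfun_subring : subring_closed smoothfun_pred.
Proof.
split=> [|f g|f g]; rewrite !inE /=.
- by apply: smooth_on_cst; exact: openT.
- move=> fs gs; apply: smooth_onD => //; first exact: openT.
  by apply: smooth_onN => //; exact: openT.
- by move=> fs gs; apply: smooth_onM => //; exact: openT.
Qed.

HB.instance Definition _ :=
  GRing.SubChoice_isSubComPzRing.Build (M -> K) smoothfun_pred smoothfun
    smoothfun_subring.

Lemma smoothfun_smooth (f : smoothfun) : smooth_on [set: M] f.
Proof. by case: f => f /=; rewrite inE. Qed.

Definition mk_smoothfun (f : M -> K) (fs : smooth_on [set: M] f) : smoothfun :=
  Smoothfun (mem_set fs : f \in smoothfun_pred).

Definition smooth_cst (c : K) : smoothfun :=
  mk_smoothfun (smooth_on_cst c openT).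

(* For [K = C], these are the complexified tangent vectors. *)
Definition tangent_vector (x : M) (D : smoothfun -> K) :=
  (forall c f g, D (smooth_cst c * f + g) = c * D f + D g) /\
  (forall f g, D (f * g) = D f * g x + f x * D g).

End smoothfun.

Record vbundle (R : realType) (M : smooth_manifold R) (k : ground_field) :=
  VBundle {
  vb_fiber :> M -> lmodType (scalar R k) ;
  vb_rank : nat ;
  vb_index : Type ;
  vb_dom : vb_index -> set M ;
  triv : vb_index -> forall x, {linear vb_fiber x -> 'rV[scalar R k]_vb_rank} ;
  triv_inv : vb_index -> forall x, 'rV[scalar R k]_vb_rank -> vb_fiber x ;
  vb_dom_open : forall a, open (vb_dom a) ;
  vb_dom_cover : forall x, exists a, vb_dom a x ;
  trivK : forall a x, vb_dom a x -> cancel (triv a x) (triv_inv a x) ;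
  triv_invK : forall a x, vb_dom a x -> cancel (triv_inv a x) (triv a x) ;
  triv_transition : forall a b v (c : 'I_vb_rank),
    smooth_on (vb_dom a `&` vb_dom b)
      (fun x => triv b x (triv_inv a x v) 0 c)
}.

Section sections.
Context {R : realType} {M : smooth_manifold R} {k : ground_field}.
Local Notation K := (scalar R k).
Local Notation C := (smoothfun M k).

Definition smooth_section (E : vbundle M k) (U : set M) (s : forall x, E x) :=
  forall a (c : 'I_(vb_rank E)),
    smooth_on (U `&` vb_dom a) (fun x => triv a x (s x) 0 c).

Record section (E : vbundle M k) := Section {
  sec_val :> forall x, E x ;
  sec_smooth : smooth_section [set: M] sec_val
}.

Lemma section_eq (E : vbundle M k) (s t : section E) :
  (forall x, s x = t x) -> s = t.
Proof.
case: s t => [s sP] [t tP] /= st.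
have e : s = t by apply/functional_extensionality_dep.
by subst t; congr Section; exact: Prop_irrelevance.
Qed.

Section section_module.
Variable E : vbundle M k.

HB.instance Definition _ := gen_eqMixin (section E).
HB.instance Definition _ := gen_choiceMixin (section E).

Let trivI_open (a : vb_index E) : open ([set: M] `&` vb_dom a).
Proof. by apply: openI; [exact: openT|exact: vb_dom_open]. Qed.

Lemma sec_smoothD (s t : section E) :
  smooth_section [set: M] (fun x => s x + t x).
Proof.
move=> a c; rewrite (_ : (fun x => _) =
    (fun x => triv a x (s x) 0 c + triv a x (t x) 0 c)).
  by apply: smooth_onD; [exact: trivI_open|exact: sec_smooth..].
by apply/funext => x; rewrite linearD mxE.
Qed.

Lemma smooth_onW (U V : set M) (f : M -> K) : V `<=` U ->
  smooth_on U f -> smooth_on V f.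
Proof.
move=> VU fs a; have [fr fi] := fs a.
have sub : chart a @` (V `&` mfd_dom a) `<=` chart a @` (U `&` mfd_dom a).
  by move=> _ [x [/VU Ux ax] <-]; exists x.
have W (g : 'rV[R]_(mfd_dim M) -> R) (A B : set 'rV[R]_(mfd_dim M)) m :
    A `<=` B -> Cn_on m B g -> Cn_on m A g.
  move=> AB; elim: m g => [|m IH] g /= [gc gd].
    by split=> // x /AB; exact: gc.
  split=> [x /AB|i]; first exact: gc.
  have [h1 h2] := gd i; split; last exact: IH.
  by move=> x /AB; exact: h1.
by split=> m; [exact: W sub (fr m)|exact: W sub (fi m)].
Qed.

Lemma sec_smoothZ (f : C) (s : section E) :
  smooth_section [set: M] (fun x => (f : M -> K) x *: s x).
Proof.
move=> a c; rewrite (_ : (fun x => _) =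
    (fun x => (f : M -> K) x * triv a x (s x) 0 c)).
  apply: smooth_onM; [exact: trivI_open| |exact: sec_smooth].
  by apply: smooth_onW (smoothfun_smooth f).
by apply/funext => x; rewrite linearZ mxE.
Qed.

Lemma sec_smooth0 : smooth_section [set: M] (fun x => 0 : E x).
Proof.
move=> a c; rewrite (_ : (fun x => _) = (fun=> 0)).
  by apply: smooth_on_cst; exact: trivI_open.
by apply/funext => x; rewrite linear0 mxE.
Qed.

Lemma sec_smoothN (s : section E) :
  smooth_section [set: M] (fun x => - s x).
Proof.
move=> a c; rewrite (_ : (fun x => _) = (fun x => - triv a x (s x) 0 c)).
  by apply: smooth_onN; [exact: trivI_open|exact: sec_smooth].
by apply/funext => x; rewrite linearN mxE.
Qed.

Definition sec_add s t := Section (sec_smoothD s t).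
Definition sec_opp s := Section (sec_smoothN s).
Definition sec_zero := Section sec_smooth0.
Definition sec_scale f s := Section (sec_smoothZ f s).

Let addA : associative sec_add.
Proof. by move=> s t u; apply: section_eq => x /=; rewrite addrA. Qed.
Let addC : commutative sec_add.
Proof. by move=> s t; apply: section_eq => x /=; rewrite addrC. Qed.
Let add0 : left_id sec_zero sec_add.
Proof. by move=> s; apply: section_eq => x /=; rewrite add0r. Qed.
Let addN : left_inverse sec_zero sec_opp sec_add.
Proof. by move=> s; apply: section_eq => x /=; rewrite addNr. Qed.

HB.instance Definition _ :=
  GRing.isZmodule.Build (section E) addA addC add0 addN.

Let scaleA f g s : sec_scale f (sec_scale g s) = sec_scale (f * g) s.
Proof. by apply: section_eq => x /=; rewrite scalerA. Qed.
Let scale1 : left_id 1 sec_scale.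
Proof. by move=> s; apply: section_eq => x /=; rewrite scale1r. Qed.
Let scaleDr : right_distributive sec_scale +%R.
Proof. by move=> f s t; apply: section_eq => x /=; rewrite scalerDr. Qed.
Let scaleDl s : {morph sec_scale^~ s : f g / f + g}.
Proof. by move=> f g; apply: section_eq => x /=; rewrite scalerDl. Qed.

HB.instance Definition _ := GRing.Zmodule_isLmodule.Build C (section E)
  scaleA scale1 scaleDr scaleDl.

End section_module.

(* Smoothness is tested on local sections, over arbitrary open sets. *)
Record bundle_map (E F : vbundle M k) := BundleMap {
  bm_fiber :> forall x, {linear E x -> F x} ;
  bm_smooth : forall (U : set M) (s : forall x, E x), open U ->
    smooth_section U s -> smooth_section U (fun x => bm_fiber x (s x))
}.

Definition bm_sec (E F : vbundle M k) (phi : bundle_map E F) (s : section E) :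
  section F := Section (bm_smooth phi openT (sec_smooth s)).

End sections.

Section lie_pairs.
Context {R : realType} {M : smooth_manifold R} {k : ground_field}.
Local Notation K := (scalar R k).
Local Notation C := (smoothfun M k).

(* [anchor v f] is the derivative at [x] of the function [f] along the image of
   [v : L x] under the anchor [L x -> T_x M], complexified for [K = C]. *)
Record anchored_bundle := AnchoredBundle {
  ab_bundle :> vbundle M k ;
  anchor : forall x, ab_bundle x -> C -> K ;
  anchor_linear : forall x c (v w : ab_bundle x) f,
    anchor (c *: v + w) f = c * anchor v f + anchor w f ;
  anchor_tangent : forall x (v : ab_bundle x), tangent_vector x (anchor v) ;
  anchor_smooth : forall (U : set M) (s : forall x, ab_bundle x) (f : C),
    open U -> smooth_section U s -> smooth_on U (fun x => anchor (s x) f)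
}.

Definition rho (L : anchored_bundle) (l : section L) (f : C) : C :=
  mk_smoothfun (anchor_smooth f openT (sec_smooth l)).

Record lie_algebroid := LieAlgebroid {
  la_anchored :> anchored_bundle ;
  la_bracket : section la_anchored -> section la_anchored ->
    section la_anchored ;
  la_bracket_linear : forall (c : K) l l' m,
    la_bracket (smooth_cst M c *: l + l') m =
    smooth_cst M c *: la_bracket l m + la_bracket l' m ;
  la_bracket_antisym : forall l m, la_bracket l m = - la_bracket m l ;
  la_jacobi : forall l m n,
    la_bracket l (la_bracket m n) + la_bracket m (la_bracket n l)
    + la_bracket n (la_bracket l m) = 0 ;
  la_leibniz : forall l (f : C) m,
    la_bracket l (f *: m) = f *: la_bracket l m + rho l f *: m ;
  la_rho_bracket : forall l m f,
    rho (la_bracket l m) f = rho l (rho m f) - rho m (rho l f)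
}.

Record lie_pair (A L : lie_algebroid) (B : vbundle M k) := LiePair {
  lp_i : bundle_map A L ;
  lp_q : bundle_map L B ;
  lp_i_inj : forall x, injective (lp_i x) ;
  lp_q_surj : forall x b, exists l, lp_q x l = b ;
  lp_exact : forall x l, lp_q x l = 0 <-> exists a, lp_i x a = l ;
  lp_i_anchor : forall x (a : A x) f,
    anchor (lp_i x a) f = anchor a f ;
  lp_i_bracket : forall a a' : section A,
    bm_sec lp_i (la_bracket a a') =
    la_bracket (bm_sec lp_i a) (bm_sec lp_i a')
}.

Record splitting (A L : lie_algebroid) (B : vbundle M k)
    (P : lie_pair A L B) := Splitting {
  sp_p : bundle_map L A ;
  sp_j : bundle_map B L ;
  sp_pi : forall x a, sp_p x (lp_i P x a) = a ;
  sp_qj : forall x b, lp_q P x (sp_j x b) = b ;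
  sp_ipjq : forall x l, lp_i P x (sp_p x l) + sp_j x (lp_q P x l) = l
}.

Record connection (L : lie_algebroid) (B : vbundle M k) := Connection {
  cn_nabla :> section L -> section B -> section B ;
  cn_linear : forall (f : C) l l' b,
    cn_nabla (f *: l + l') b = f *: cn_nabla l b + cn_nabla l' b ;
  cn_additive : forall l b b',
    cn_nabla l (b + b') = cn_nabla l b + cn_nabla l b' ;
  cn_leibniz : forall l (f : C) b,
    cn_nabla l (f *: b) = f *: cn_nabla l b + rho l f *: b
}.

Definition torsion_free (A L : lie_algebroid) (B : vbundle M k)
    (P : lie_pair A L B) (nabla : connection L B) :=
  forall l1 l2 : section L,
    nabla l1 (bm_sec (lp_q P) l2) - nabla l2 (bm_sec (lp_q P) l1)
    - bm_sec (lp_q P) (la_bracket l1 l2) = 0.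

End lie_pairs.

Arguments anchored_bundle {R} M k.
Arguments lie_algebroid {R} M k.

(* Sections of [Lambda^k L^* (x) S^n(B^* ) (x) V], for [V] trivial or [V = B], are
   encoded as [C^oo(M)]-multilinear maps [F : Gamma(L)^k x Gamma(B)^n -> V],
   alternating in the first and symmetric in the last arguments; such a map is
   applied to lists, [F ls bs] with [size ls = k] and [size bs = n].  One
   function [F] on lists carries the components of all bidegrees [(k, n)], so
   that the completion of the symmetric algebra is the product over [n].

   The identification is normalised by
     (nu_1 ^ ... ^ nu_k) (l_1, ..., l_k) = det (nu_i (l_j)),
     (chi_1 . ... . chi_n) (b_1, ..., b_n) = perm (chi_i (b_j)),
   so that contraction is insertion in the first place and the products are
   sums over shuffles. *)
Definition cochain (R : realType) (M : smooth_manifold R) (k : ground_field)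
    (L B : vbundle M k) (V : lmodType (smoothfun M k)) :=
  seq (section L) -> seq (section B) -> V.

Definition rem_at (T : Type) (i : nat) (s : seq T) := take i s ++ drop i.+1 s.

(* Sign of the shuffle listing first the positions where [m] is true. *)
Fixpoint shuffle_odd (m : bitseq) : bool :=
  if m is b :: m' then (~~ b && odd (count id m')) (+) shuffle_odd m'
  else false.

Section cochains.
Context {R : realType} {M : smooth_manifold R} {k : ground_field}.
Local Notation K := (scalar R k).
Local Notation C := (smoothfun M k).

Section linear_operations.
Context {L B : vbundle M k} {V : lmodType C}.
Implicit Types F : cochain L B V.

Record is_form F : Prop := IsForm {
  form_multilinear_L : forall s1 s2 bs (f : C) l l',
    F (s1 ++ (f *: l + l') :: s2) bs =
    f *: F (s1 ++ l :: s2) bs + F (s1 ++ l' :: s2) bs ;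
  form_multilinear_B : forall ls s1 s2 (f : C) b b',
    F ls (s1 ++ (f *: b + b') :: s2) =
    f *: F ls (s1 ++ b :: s2) + F ls (s1 ++ b' :: s2) ;
  form_alternating : forall s1 s2 s3 bs l,
    F (s1 ++ l :: s2 ++ l :: s3) bs = 0 ;
  form_symmetric : forall ls bs bs', perm_eq bs bs' -> F ls bs = F ls bs'
}.

Definition L_degree (d : nat) F := forall ls bs, size ls != d -> F ls bs = 0.

Definition S_degree_ge (d : nat) F :=
  forall ls bs, (size bs < d)%N -> F ls bs = 0.

(* [iota_l] on [Lambda L^*], and [iota_b] on the symmetric algebra *)
Definition iotaL (l : section L) F : cochain L B V := fun ls bs => F (l :: ls) bs.

Definition iotaB (b : section B) F : cochain L B V := fun ls bs => F ls (b :: bs).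

End linear_operations.

Section products.
Context {L B : vbundle M k}.

(* [(omega (x) s) (eta (x) t) = (omega ^ eta) (x) (s . t)] *)
Definition form_mul (F G : cochain L B C^o) : cochain L B C^o := fun ls bs =>
  \sum_(m : (size ls).-tuple bool) \sum_(n : (size bs).-tuple bool)
    (-1) ^+ shuffle_odd m *
    (F (mask m ls) (mask n bs) *
     G (mask (map negb m) ls) (mask (map negb n) bs)).

(* A 1-form [X] valued in formal vertical vector fields acts by
   [(lambda (x) sigma (x) b) (omega (x) s) = (lambda ^ omega) (x) (sigma . iota_b s)];
   see [vertical_act_decomposable]. *)
Definition vertical_act (X : cochain L B (section B)) (F : cochain L B C^o) :
    cochain L B C^o := fun ls bs =>
  \sum_(i < size ls) (-1) ^+ i * \sum_(m : (size bs).-tuple bool)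
    F (rem_at i ls) (X [:: nth 0 ls i] (mask m bs) :: mask (map negb m) bs).

End products.

(* [d_L^nabla], in the frame-free form of the Chevalley-Eilenberg formula; see
   [d_nabla_decomposable]. *)
Section differential.
Context {L : lie_algebroid M k} {B : vbundle M k}.

Definition d_L (omega : seq (section L) -> C) (ls : seq (section L)) : C :=
  \sum_(i < size ls)
    (-1) ^+ i * rho (nth 0 ls i) (omega (rem_at i ls))
  + \sum_(j < size ls) \sum_(i < j)
      (-1) ^+ (i + j) *
      omega (la_bracket (nth 0 ls i) (nth 0 ls j) :: rem_at i (rem_at j ls)).

(* Connection induced by [nabla] on the symmetric algebra of the dual of [B] *)
Definition nabla_dual (nabla : connection L B) (l : section L)
    (sigma : seq (section B) -> C) (bs : seq (section B)) : C :=
  rho l (sigma bs)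
  - \sum_(t < size bs) sigma (set_nth 0 bs t (nabla l (nth 0 bs t))).

Definition d_nabla (nabla : connection L B) (F : cochain L B C^o) :
    cochain L B C^o := fun ls bs =>
  \sum_(i < size ls)
    (-1) ^+ i * nabla_dual nabla (nth 0 ls i) (F (rem_at i ls)) bs
  + \sum_(j < size ls) \sum_(i < j)
      (-1) ^+ (i + j) *
      F (la_bracket (nth 0 ls i) (nth 0 ls j) :: rem_at i (rem_at j ls)) bs.

End differential.

Section lie_pair_operators.
Context {A L : lie_algebroid M k} {B : vbundle M k} (P : lie_pair A L B).

(* See [delta_frame]. *)
Definition delta (F : cochain L B C^o) : cochain L B C^o := fun ls bs =>
  \sum_(i < size ls)
    (-1) ^+ i * F (rem_at i ls) (bm_sec (lp_q P) (nth 0 ls i) :: bs).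

Section homotopy.
Context (S : splitting P) {V : lmodType C}.

Definition proj_A (l : section L) := bm_sec (lp_i P) (bm_sec (sp_p S) l).
Definition proj_B (l : section L) := bm_sec (sp_j S) (bm_sec (lp_q P) l).

(* Component of [F] in [p^T (Lambda^u A^* ) ^ q^T (Lambda^v B^* )], [u + v = k]:
   expand [F (l_1, ..., l_k)] along [l = proj_A l + proj_B l]. *)
Definition B_weight (v : nat) (F : cochain L B V) : cochain L B V :=
  fun ls bs => \sum_(m : (size ls).-tuple bool | count id m == v)
    F [seq (if bl.1 then proj_B bl.2 else proj_A bl.2) | bl <- zip m ls] bs.

(* [h] for [V = C^o] and [h (x) id_B] for [V = section B]; the argument [bs]
   corresponds to [|J| + 1 = size bs].  See [homotopy_frame]. *)
Definition homotopy (F : cochain L B V) : cochain L B V := fun ls bs =>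
  \sum_(1 <= v < (size ls).+2)
    smooth_cst M ((v + (size bs).-1)%:R^-1 : K) *:
    \sum_(i < size bs)
      B_weight v F (bm_sec (sp_j S) (nth 0 bs i) :: ls) (rem_at i bs).

End homotopy.

Definition Q_nabla (nabla : connection L B) (X : cochain L B (section B))
    (F : cochain L B C^o) : cochain L B C^o := fun ls bs =>
  - delta F ls bs + d_nabla nabla F ls bs + vertical_act X F ls bs.

End lie_pair_operators.

(* [D] makes [L[1] (+) B] a dg manifold. *)
Record dg_manifold (L B : vbundle M k)
    (D : cochain L B C^o -> cochain L B C^o) : Prop := DgManifold {
  dg_form : forall F, is_form F -> is_form (D F) ;
  dg_linear : forall (c : K) F G, is_form F -> is_form G -> forall ls bs,
    D (fun ls bs => smooth_cst M c *: F ls bs + G ls bs) ls bs =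
    smooth_cst M c *: D F ls bs + D G ls bs ;
  dg_degree : forall d F, is_form F -> L_degree d F -> L_degree d.+1 (D F) ;
  dg_derivation : forall d F G, is_form F -> is_form G -> L_degree d F ->
    forall ls bs, D (form_mul F G) ls bs =
      form_mul (D F) G ls bs + (-1) ^+ d * form_mul F (D G) ls bs ;
  dg_square : forall F, is_form F -> forall ls bs, D (D F) ls bs = 0
}.

(* The identity characterising dual frames of [E]; the lemmas below compare the
   definitions with the formulas in frames wherever frames exist, that is,
   over trivialising open sets. *)
Definition dual_frames (E : vbundle M k) (r : nat)
    (e : 'I_r -> section E) (eps : 'I_r -> section E -> C) :=
  forall s, s = \sum_(m < r) eps m s *: e m.

Section local_formulas.
Context {L B : vbundle M k} {V : lmodType C}.

(* [lambda ^ F] and [chi . F], for 1-forms [lambda] on [L] and [chi] on [B] *)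
Definition wedge1 (lambda : section L -> C) (F : cochain L B V) :
    cochain L B V := fun ls bs =>
  \sum_(i < size ls) (-1) ^+ i *: (lambda (nth 0 ls i) *: F (rem_at i ls) bs).

Definition sym1 (chi : section B -> C) (F : cochain L B V) :
    cochain L B V := fun ls bs =>
  \sum_(i < size bs) chi (nth 0 bs i) *: F ls (rem_at i bs).

Definition tens (omega : seq (section L) -> C) (sigma : seq (section B) -> C) :
  cochain L B C^o := fun ls bs => omega ls * sigma bs.

Definition sym_mul (sigma tau : seq (section B) -> C) (bs : seq (section B)) :=
  \sum_(m : (size bs).-tuple bool)
    sigma (mask m bs) * tau (mask (map negb m) bs).

End local_formulas.

Lemma addr_idem0 (V : zmodType) (x : V) : x = x + x -> x = 0.
Proof. by move=> e; apply: (addrI x); rewrite addr0 -e. Qed.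

Lemma form_sumB (L B : vbundle M k) (V : lmodType C) (F : cochain L B V)
    (r : nat) (c : 'I_r -> C) (e : 'I_r -> section B) ls s1 s2 : is_form F ->
  F ls (s1 ++ \sum_m c m *: e m :: s2) = \sum_m c m *: F ls (s1 ++ e m :: s2).
Proof.
move=> Ff; have F0 : F ls (s1 ++ 0 :: s2) = 0.
  have := form_multilinear_B Ff ls s1 s2 1 0 0.
  by rewrite !scale1r addr0 => /addr_idem0.
apply: (big_rec2 (fun y x => F ls (s1 ++ y :: s2) = x)) => [//|m x y _ <-].
by rewrite form_multilinear_B.
Qed.

Lemma delta_frame (A L : lie_algebroid M k) (B : vbundle M k)
    (P : lie_pair A L B) (r : nat) (e : 'I_r -> section B)
    (chi : 'I_r -> section B -> C) (F : cochain L B C^o) ls bs :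
  dual_frames e chi -> is_form F ->
  delta P F ls bs =
  \sum_m wedge1 (chi m \o bm_sec (lp_q P)) (iotaB (e m) F) ls bs.
Proof.
move=> fr Ff; rewrite exchange_big /=; apply: eq_bigr => i _.
rewrite [bm_sec _ _ in LHS]fr (form_sumB _ _ _ [::]) // -scaler_sumr.
by congr (_ * _).
Qed.

Lemma B_weight_form (A L : lie_algebroid M k) (B : vbundle M k)
    (P : lie_pair A L B) (S : splitting P) (V : lmodType C) (v : nat)
    (F : cochain L B V) l l' ls bs (f : C) : is_form F ->
  B_weight S v F (f *: l + l' :: ls) bs =
  f *: B_weight S v F (l :: ls) bs + B_weight S v F (l' :: ls) bs.
Proof.
move=> Ff; rewrite /B_weight /= scaler_sumr -big_split /=; apply: eq_bigr => m _.
case: m => -[|b m] //= _.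
rewrite -(form_multilinear_L Ff [::]) /=; congr (F (_ :: _) _).
by case: b; apply: section_eq => x /=; rewrite !linearP.
Qed.

Lemma homotopy_frame (A L : lie_algebroid M k) (B : vbundle M k)
    (P : lie_pair A L B) (S : splitting P) (V : lmodType C) (r : nat)
    (e : 'I_r -> section B) (chi : 'I_r -> section B -> C)
    (F : cochain L B V) ls bs :
  dual_frames e chi -> is_form F ->
  homotopy S F ls bs =
  \sum_(1 <= v < (size ls).+2)
    smooth_cst M ((v + (size bs).-1)%:R^-1 : K) *:
    \sum_m sym1 (chi m) (iotaL (bm_sec (sp_j S) (e m)) (B_weight S v F)) ls bs.
Proof.
move=> fr Ff; apply: eq_bigr => v _; congr (_ *: _).
rewrite exchange_big /=; apply: eq_bigr => i _.
set b := nth _ _ _; rewrite [b in LHS]fr; rewrite /iotaL.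
set W := B_weight S v F; have W0 : W (0 :: ls) (rem_at i bs) = 0.
  have := B_weight_form S v 0 0 ls (rem_at i bs) 1 Ff.
  by rewrite !scale1r addr0 => /addr_idem0.
have -> : bm_sec (sp_j S) (\sum_m chi m b *: e m) =
    \sum_m chi m b *: bm_sec (sp_j S) (e m).
  elim/big_rec2: _ => [|m x y _ <-]; apply: section_eq => x' /=.
    by rewrite linear0.
  by rewrite linearP.
elim/big_rec2: _ => [//|m x y _ <-].
exact: B_weight_form.
Qed.

Lemma rhoM (L : lie_algebroid M k) (l : section L) (f g : C) :
  rho l (f * g) = rho l f * g + f * rho l g.
Proof.
by apply/val_inj/funext => x /=; have [_ ->] := anchor_tangent (l x).
Qed.

Lemma rhoDl (L : lie_algebroid M k) (f : C) (l l' : section L) g :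
  rho (f *: l + l') g = f * rho l g + rho l' g.
Proof. by apply/val_inj/funext => x /=; rewrite anchor_linear. Qed.

Section nabla_dual_theory.
Context {L : lie_algebroid M k} {B : vbundle M k} (nabla : connection L B).
Variable sigma : seq (section B) -> C.
Hypothesis sigma_lin : forall s1 s2 (f : C) b b',
  sigma (s1 ++ (f *: b + b') :: s2) =
  f * sigma (s1 ++ b :: s2) + sigma (s1 ++ b' :: s2).

Lemma nabla_dualDl (f : C) l l' bs :
  nabla_dual nabla (f *: l + l') sigma bs =
  f * nabla_dual nabla l sigma bs + nabla_dual nabla l' sigma bs.
Proof.
rewrite /nabla_dual rhoDl mulrBr addrACA -opprD mulr_sumr -big_split /=.
congr (_ - _); apply: eq_bigr => t _; rewrite cn_linear.
have E b : set_nth 0 bs t b = take t bs ++ b :: drop t.+1 bs.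
  by rewrite set_nthE ltn_ord.
by rewrite !E sigma_lin.
Qed.

Lemma nabla_dual_sum (r : nat) (c : 'I_r -> C) (e : 'I_r -> section L) bs :
  nabla_dual nabla (\sum_m c m *: e m) sigma bs =
  \sum_m c m * nabla_dual nabla (e m) sigma bs.
Proof.
have N0 : nabla_dual nabla 0 sigma bs = 0.
  have := nabla_dualDl 1 0 0 bs.
  by rewrite scale1r mul1r addr0 => /addr_idem0.
by elim/big_rec2: _ => [//|m x y _ <-]; rewrite nabla_dualDl.
Qed.

Lemma d_nabla_decomposable (r : nat) (v : 'I_r -> section L)
    (nu : 'I_r -> section L -> C) (omega : seq (section L) -> C) ls bs :
  dual_frames v nu ->
  d_nabla nabla (tens omega sigma) ls bs =
  tens (d_L omega) sigma ls bs +
  \sum_m wedge1 (nu m) (tens omega (nabla_dual nabla (v m) sigma)) ls bs.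
Proof.
move=> fr; rewrite /tens /d_L /wedge1 exchange_big /=.
rewrite mulrDl addrAC; congr (_ + _); last first.
  rewrite mulr_suml; apply: eq_bigr => j _.
  by rewrite mulr_suml; apply: eq_bigr => i _; rewrite mulrA.
rewrite mulr_suml -big_split /=; apply: eq_bigr => i _.
set l := nth _ _ _; set o := omega _.
rewrite -[\sum_(m < r) _]mulr_sumr -mulrA -mulrDr; congr (_ * _).
transitivity (rho l o * sigma bs + o * nabla_dual nabla l sigma bs).
  rewrite /nabla_dual rhoM mulrBr mulr_sumr addrA; congr (_ + _ - _).
congr (_ + _); rewrite [l in LHS]fr nabla_dual_sum mulr_sumr.
by apply: eq_bigr => m _; rewrite /GRing.scale /= mulrCA.
Qed.

End nabla_dual_theory.

Lemma vertical_act_decomposable (L B : vbundle M k) (lambda : section L -> C)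
    (sigma : seq (section B) -> C) (b : section B)
    (X : cochain L B (section B)) (omega : seq (section L) -> C)
    (s : seq (section B) -> C) ls bs :
  (forall l bs, X [:: l] bs = (lambda l * sigma bs) *: b) ->
  is_form (tens omega s) ->
  vertical_act X (tens omega s) ls bs =
  wedge1 lambda (tens omega (sym_mul sigma (fun bs => s (b :: bs)))) ls bs.
Proof.
move=> XE Ff; apply: eq_bigr => i _; congr (_ * _).
rewrite /tens /sym_mul; set l := nth _ _ _; set ls' := rem_at _ _.
rewrite mulr_sumr [RHS]mulr_sumr; apply: eq_bigr => m _; rewrite XE.
have := @form_sumB _ _ _ _ 1 (fun=> lambda l * sigma (mask m bs)) (fun=> b) ls'
  [::] (mask (map negb m) bs) Ff.
rewrite !big_ord1 /= /tens => ->; rewrite /GRing.scale /= -mulrA.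
by congr (_ * _); rewrite mulrCA.
Qed.

End cochains.

(* Main.v *)
Require Import Defs.
From HB Require Import structures.
From mathcomp Require Import all_boot all_order all_algebra.
From mathcomp Require Import all_classical all_reals all_analysis.
From mathcomp Require Import complex ring.

Set Implicit Arguments.
Unset Strict Implicit.
Unset Printing Implicit Defensive.

Import Order.TTheory GRing.Theory Num.Theory.
Import numFieldNormedType.Exports.
Local Open Scope ring_scope.

(** The operator [- delta] is the action of the constant vertical vector field
    [- q], so [Q] is the Chevalley-Eilenberg differential of the "connection"
    [D_l = nabla_l + (X_l - q l)] on [S(B^* )], and [Q^2 = 0] amounts to [D]
    being flat.  The curvature of [D] is again the action of a vertical vector
    field [kappa l m].  Since sections of [B^*] separate the sections of [B]
    (bump functions), [kappa] is determined by its action; hence [Q^2 = 0] if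
    and only if [kappa = 0], and [kappa] satisfies a Bianchi identity.

    By torsion-freeness [kappa = c(X) - delta X], where [c(X)] collects the
    curvature of [nabla], [d_nabla X] and [[X, X] / 2].  On cochains of positive
    symmetric degree [h delta + delta h = id], so a solution with [h X = 0] is a
    fixed point of [X |-> h (c(X))], a contraction for the filtration by
    symmetric degree.  Conversely, for the fixed point [h X = 0] and
    [h kappa = 0], hence [kappa = h (delta kappa)]; by the Bianchi identity
    [delta kappa] vanishes in each symmetric degree up to which [kappa] does,
    while [h] raises that degree, so [kappa = 0].

    Alternating and symmetric forms are handled through the contractions [iL]
    and [iS]: an identity of operators is proved by contracting both sides and
    inducting on the number of arguments. *)

(** * Bump functions and dual sections *)

(** All arguments use global sections, without local frames; the topology of [M] enters only through
    bump functions, which supply enough functionals on sections. Operators are defined on arbitrary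
    functions of lists, and being a form is a predicate, so tensoriality in the direction of
    differentiation is available only on forms. The factor [v + |J|] in the homotopy is the
    eigenvalue of the unweighted operator [h delta + delta h]. Both [h] and [delta] exchange one
    unit between [v] and [|J|] and so preserve the sum; the weights are therefore constants in every
    computation, and the identities for [h] reduce to those of the Koszul complex. The bound 2 on
    the symmetric degree reproduces itself: for such an [X] the component of degree 0 of [c(X)]
    vanishes, and so [h (c(X))] vanishes below degree 2. *)

Section flat_functions.
Local Open Scope classical_set_scope.
Context {R : realType}.
Implicit Types t : R.

(** The powers of [t^-1] make the family closed, up to linear combinations, under differentiation,
    so that smoothness of all members follows by a single induction on the order. *)
Definition flat (k : nat) t : R :=
  if 0 < t then t^-1 ^+ k * expR (- t^-1) else 0.

Lemma flat_gt0 k t : 0 < t -> 0 < flat k t.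
Proof. by move=> t0; rewrite /flat t0 mulr_gt0 ?expR_gt0 ?exprn_gt0 ?invr_gt0. Qed.

Lemma flat_le0 k t : t <= 0 -> flat k t = 0.
Proof. by rewrite /flat leNgt => /negbTE ->. Qed.

(** Comes from the term of order [k + 2] in the series of [expR t^-1]. The remaining factor [t ^+ 2]
    makes the difference quotient at [0] tend to [0]. *)
Lemma flat_bound k t : `|flat k t| <= (k.+2)`!%:R * t ^+ 2.
Proof.
have [t0|t0] := ltrP 0 t; last first.
  by rewrite flat_le0 // normr0 mulr_ge0 ?sqr_ge0 ?ler0n.
rewrite ger0_norm ?(ltW (flat_gt0 _ _)) // /flat t0.
have s0 : 0 < t^-1 by rewrite invr_gt0.
rewrite expRN ler_pdivrMr ?expR_gt0 //.
have := expR_ge1Dxn k.+1 (ltW s0); set F := (_)`!%:R => Fe.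
have F0 : 0 < F by rewrite ltr0n fact_gt0.
have h : t^-1 ^+ k.+2 <= F * expR t^-1.
  rewrite -ler_pdivrMl //; apply: le_trans Fe.
  by rewrite mulrC lerDr ler01.
rewrite mulrAC -ler_pdivrMr ?exprn_gt0 //.
by apply: le_trans h; rewrite -exprVn -exprD addn2.
Qed.

Lemma is_derive_flat k t :
  is_derive t 1 (flat k) (flat k.+2 t - k%:R * flat k.+1 t).
Proof.
have [t0|t0|->] := ltrgtP t 0.
- rewrite !flat_le0 ?ltW // mulr0 subr0.
  have e : \forall x \near t, (cst 0 : R -> R) x = flat k x.
    near=> x; rewrite flat_le0 //; apply: ltW; near: x; exact: lt_nbhsl.
  have d0 : derivable (cst 0 : R -> R) t 1 by exact: derivable_cst.
  apply: DeriveDef; first exact: near_eq_derivable e d0.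
  by rewrite -(near_eq_derive _ e) derive_cst.
- pose f (x : R) := x^-1 ^+ k * expR (- x^-1).
  have e : \forall x \near t, f x = flat k x.
    near=> x; rewrite /flat /f ifT //; near: x; exact: lt_nbhsr.
  have tn0 : t != 0 by rewrite gt_eqF.
  have df : is_derive t 1 f (flat k.+2 t - k%:R * flat k.+1 t).
    have dV : is_derive t 1 (fun x : R => x^-1) (- t ^- 2 *: (1 : R)).
      exact: is_deriveV.
    have dVN : is_derive t 1 (fun x : R => - x^-1) (- (- t ^- 2 *: (1 : R))).
      exact: is_deriveN.
    have dE := @is_derive1_comp _ expR (fun x => - x^-1) _ _ _
      (is_derive_expR (- t^-1)) dVN.
    have dX : is_derive t 1 (fun x : R => x^-1 ^+ k)
        (k%:R * t^-1 ^+ k.-1 * - t ^- 2).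
      have := is_deriveX k dV; rewrite exprfctE => dX.
      by apply: is_derive_eq dX _; rewrite /GRing.scale /= mulr1.
    have := is_deriveM dX dE; rewrite mulrfctE => dM.
    apply: is_derive_eq dM _.
    rewrite /GRing.scale /= /flat t0 -exprVn.
    by case: (k) => [|j]; rewrite ?exprS; ring.
  apply: DeriveDef; first by apply: near_eq_derivable e _; case: df.
  by rewrite -(near_eq_derive _ e) (@derive_val _ _ _ _ _ _ _ df).
- rewrite !flat_le0 // mulr0 subr0.
  have c : h^-1 *: ((flat k \o shift 0) (h *: (1:R)) - flat k 0) @[h --> 0^'] --> (0:R).
    apply/cvgr0Pnorm_le => e e0.
    (* Within this radius the quadratic bound of [flat_bound] is at most [e] times [|h|]. *)
    pose a : R := e / (k.+2)`!%:R.
    have F0 : 0 < (k.+2)`!%:R :> R by rewrite ltr0n fact_gt0.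
    have a0 : 0 < a by rewrite divr_gt0.
    near=> h => /=; rewrite addr0 [h *: 1]mulr1 [flat k 0]flat_le0 // subr0.
    have h0 : h != 0 by near: h; exact: nbhs_dnbhs_neq.
    have ha : `|h| <= a.
      by near: h; exact: dnbhs0_le.
    rewrite normrZ normfV ler_pdivrMl ?normr_gt0 //.
    apply: le_trans (flat_bound k h) _.
    rewrite -[h ^+ 2]ger0_norm ?sqr_ge0 // normrX expr2 mulrCA.
    rewrite ler_pM2l ?normr_gt0 //.
    by move: ha; rewrite /a ler_pdivlMr // mulrC.
  apply: DeriveDef; first by apply/cvg_ex; exists 0.
  exact/cvg_lim.
Unshelve. all: by end_near. Qed.

Lemma continuous_flat k : continuous (flat k).
Proof.
move=> t; apply/differentiable_continuous/derivable1_diffP.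
by have [] := is_derive_flat k t.
Qed.

(** Reduces directional derivatives to one real variable, where the chain rule for [flat k]
    applies. *)
Lemma derive_line (n : nat) (f : 'rV[R]_n -> R) x v :
  'D_v f x = 'D_1 (fun h : R => f (h *: v + x)) 0.
Proof.
apply: (congr1 (fun g : R -> R => lim (g @ 0^'))); apply/funext => h /=.
by rewrite addr0 scale0r add0r [h *: 1]mulr1.
Qed.

Lemma is_derive_flat_comp k (n : nat) (u : 'rV[R]_n -> R) x v :
  derivable u x v ->
  derivable (flat k \o u) x v /\
  'D_v (flat k \o u) x =
    (flat k.+2 (u x) - k%:R * flat k.+1 (u x)) * 'D_v u x.
Proof.
move=> /derivable1P du; set g := fun h : R => u (h *: v + x) in du.
have dg : is_derive (0 : R) (1 : R) g ('D_1 g 0) by exact/derivableP.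
have := @is_derive1_comp _ (flat k) g _ _ _ (is_derive_flat k (g 0)) dg.
rewrite /g scale0r add0r => dfg; split.
  by apply/derivable1P; case: dfg.
by rewrite derive_line (derive_line u); case: dfg => _ <-.
Qed.

Lemma Cinfty_on_flat k (n : nat) U (u : 'rV[R]_n -> R) : open U ->
  Cinfty_on U u -> Cinfty_on U (flat k \o u).
Proof.
move=> Uo uC m; elim: m k => [|m IH] k.
all: have cont x : U x -> {for x, continuous (flat k \o u)}.
1,3: move=> Ux; apply: continuous_comp; [exact: (uC 0%N).1|exact: continuous_flat].
  by split.
split=> // i; have du := ((uC 1%N).2 i).1.
split=> [x Ux|]; first exact: (is_derive_flat_comp k (du x Ux)).1.
have dC : Cn_on m U ('D_(delta_mx 0 i) u) by exact: ((uC m.+1).2 i).2.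
apply: Cn_on_eq (Cn_onM Uo (Cn_onD Uo (IH k.+2)
  (Cn_onM Uo (Cn_on_cst m (- k%:R) Uo) (IH k.+1))) dC) => // x Ux.
by rewrite (is_derive_flat_comp k (du x Ux)).2 /= mulNr.
Qed.

End flat_functions.

Section Cn_on_sets.
Local Open Scope classical_set_scope.
Context {R : realType} {n : nat}.
Implicit Types (U V : set 'rV[R]_n) (f : 'rV[R]_n -> R).

Lemma Cn_on_sub m U V f : U `<=` V -> Cn_on m V f -> Cn_on m U f.
Proof.
move=> UV; elim: m f => [|m IH] f /= [fc fd].
all: split=> [x /UV|]; first exact: fc.
  by [].
by move=> i; have [h1 h2] := fd i; split; [move=> x /UV; exact: h1|exact: IH].
Qed.

Lemma Cn_onU m U V f : Cn_on m U f -> Cn_on m V f -> Cn_on m (U `|` V) f.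
Proof.
elim: m f => [|m IH] f /= [fc fd] [gc gd].
all: split=> [x []|]; [exact: fc|exact: gc|].
  by [].
move=> i; have [h1 h2] := fd i; have [h3 h4] := gd i.
by split; [move=> x []; [exact: h1|exact: h3]|exact: IH].
Qed.

Lemma Cinfty_on_sum (I : Type) (r : seq I) U (f : I -> 'rV[R]_n -> R) :
  open U -> (forall i, Cinfty_on U (f i)) ->
  Cinfty_on U (fun x => \sum_(i <- r) f i x).
Proof.
move=> Uo fC; elim: r => [|i r IH].
  by apply: Cinfty_on_eq (Cinfty_on_cst 0 Uo) => // x _; rewrite big_nil.
by apply: Cinfty_on_eq (Cinfty_onD Uo (fC i) IH) => // x _; rewrite big_cons.
Qed.

End Cn_on_sets.

Section smooth_on_sets.
Local Open Scope classical_set_scope.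
Context {R : realType} {M : smooth_manifold R} {k : ground_field}.
Local Notation K := (Defs.scalar R k).
Implicit Types (U V : set M) (f g : M -> K).

Lemma smooth_onU U V f : smooth_on U f -> smooth_on V f -> smooth_on (U `|` V) f.
Proof.
move=> fU fV a; rewrite setIUl image_setU.
have [[h1 h2] [h3 h4]] := (fU a, fV a).
by split=> m; apply: Cn_onU.
Qed.

Lemma smooth_on_eq U f g : open U -> (forall x, U x -> f x = g x) ->
  smooth_on U f -> smooth_on U g.
Proof.
move=> Uo fg fs a; have Vo := @chart_open _ _ U a Uo; have [h1 h2] := fs a.
by split; [apply: Cinfty_on_eq Vo _ h1|apply: Cinfty_on_eq Vo _ h2];
  move=> _ [x [Ux ax] <-]; rewrite chartK // fg.
Qed.

Definition of_real : R -> K :=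
  match k with
  | RealNumbers => id
  | ComplexNumbers => @real_complex R
  end.

Lemma re_of_real x : re (of_real x) = x.
Proof. by rewrite /of_real; case: (k). Qed.

Lemma im_of_real x : im (of_real x) = 0.
Proof. by rewrite /of_real; case: (k). Qed.

Lemma of_real_eq0 x : of_real x = 0 -> x = 0.
Proof. by move/(congr1 (@re R k)); rewrite re_of_real; case: (k). Qed.

(** The support is enclosed in a closed set [Z], so that [M] is covered by two open sets, a chart
    domain and the complement of [Z], on each of which smoothness of the extension by zero is
    clear. *)
Lemma bump_function U (x : M) : open U -> U x ->
  exists (phi : smoothfun M k) (Z : set M),
    [/\ closed Z, Z `<=` U, forall y, ~ Z y -> phi y = 0 & phi x != 0].
Proof.
move=> Uo Ux; have [a ax] := mfd_dom_cover x.
pose x0 := chart a x; pose W := U `&` mfd_dom a.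
have Wo : open W by apply: openI => //; exact: mfd_dom_open.
have : nbhs x0 (chart a @` W).
  by apply: open_nbhs_nbhs; split; [exact: chart_open|exists x].
move=> /nbhs_ballP[r /= r0 rW].
(* A closed cube is compact as a product of segments; half the radius keeps it inside the open ball
   of the maximum norm. *)
pose I i := [set t : R | `|t - x0 0 i| <= r / 2].
pose Kc := [set y : 'rV[R]_(mfd_dim M) | forall i, I i (y ord0 i)].
have r20 : 0 < r / 2 by rewrite divr_gt0.
have Kcompact : compact Kc.
  apply: rV_compact => i.
  have -> : I i = `[x0 0 i - r / 2, x0 0 i + r / 2]%classic.
    by apply/seteqP; split=> t; rewrite /I /= in_itv /= ler_distl.
  exact: segment_compact.
have KW : Kc `<=` chart a @` W.
  move=> y Ky; apply: rW; split=> // i j; rewrite ord1; have := Ky j.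
  rewrite /I /= distrC => h; apply: le_lt_trans h _.
  by rewrite ltr_pdivrMr // mulr_natr mulr2n ltrDl.
pose Z := chart_inv a @` Kc.
(* The Hausdorff property of [M] enters here: it makes the compact set [Z] closed. *)
have Zcl : closed Z.
  apply: compact_closed (@mfd_hausdorff R M) _.
  apply: continuous_compact Kcompact.
  apply: continuous_in_subspaceT => y /set_mem /KW [z [_ az] <-].
  exact: chart_inv_continuous.
have ZW : Z `<=` W.
  by move=> _ [y /KW [z [Uz az] <-] <-]; rewrite chartK.
pose u z : R := (r / 2) ^+ 2 - \sum_i (chart a z 0 i - x0 0 i) ^+ 2.
(* The case distinction guards against the arbitrary values of [chart a] outside [mfd_dom a]. *)
pose phi0 z : R := if `[< mfd_dom a z >] then flat 0 (u z) else 0.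
have phi0Z z : ~ Z z -> phi0 z = 0.
  move=> nZ; rewrite /phi0; case: asboolP => // az; apply: flat_le0.
  rewrite leNgt; apply/negP => u0; apply: nZ; exists (chart a z); last first.
    by rewrite chartK.
  (* Positivity of [u z] bounds the whole sum of squares, hence each coordinate difference, by
     [r / 2]. *)
  move=> i; rewrite /I /= ltW // -ltr_sqr ?nnegrE ?(ltW r20) //.
  rewrite real_normK ?num_real //.
  move: u0; rewrite subr_gt0; apply: le_lt_trans.
  rewrite (bigD1 i) //= lerDl sumr_ge0 // => j _; exact: sqr_ge0.
have phis : smooth_on [set: M] (of_real \o phi0).
  have -> : [set: M] = W `|` ~` Z.
    by apply/seteqP; split=> // y _; case: (pselect (Z y)) => [/ZW|]; [left|right].
  apply: smooth_onU; last first.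
    have nZo : open (~` Z) by exact: closed_openC.
    apply: smooth_on_eq (smooth_on_cst (of_real 0) nZo) => // y nZ.
    by rewrite /= phi0Z.
  move=> b; set V := chart b @` _; have Vo : open V by exact: chart_open.
  have uC : Cinfty_on V (fun y => u (chart_inv b y)).
    have tC i : Cinfty_on V (fun y => chart a (chart_inv b y) 0 i - x0 0 i).
      apply: Cinfty_onD Vo _ (Cinfty_on_cst _ Vo) => m.
      apply: Cn_on_sub (chart_transition b a i m).
      by move=> _ [z [[_ az] bz] <-]; exists z.
    have sC : Cinfty_on V (fun y => -1 * \sum_i
        ((chart a (chart_inv b y) 0 i - x0 0 i) *
         (chart a (chart_inv b y) 0 i - x0 0 i))).
      apply: Cinfty_onM (Cinfty_on_cst _ Vo) _ => //.
      by apply: Cinfty_on_sum => // i; exact: Cinfty_onM.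
    apply: Cinfty_on_eq (Cinfty_onD Vo (Cinfty_on_cst ((r / 2) ^+ 2) Vo) sC) => //.
    by move=> y _; rewrite mulN1r.
  split.
    apply: Cinfty_on_eq (Cinfty_on_flat 0 Vo uC) => // _ [z [[_ az] bz] <-] /=.
    by rewrite re_of_real /phi0 chartK // asboolT.
  apply: Cinfty_on_eq (Cinfty_on_cst 0 Vo) => // y _ /=.
  by rewrite im_of_real.
exists (mk_smoothfun phis), Z; split=> //.
- by move=> y /ZW[].
- by move=> y nZ /=; rewrite phi0Z // /of_real; case: (k).
- apply/negP => /eqP /of_real_eq0; apply/eqP; rewrite gt_eqF // /phi0 asboolT //.
  apply: flat_gt0; rewrite /u big1 ?subr0 ?exprn_gt0 // => i _.
  by rewrite subrr expr0n.
Qed.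

End smooth_on_sets.

Section dual_sections.
Local Open Scope classical_set_scope.
Context {R : realType} {M : smooth_manifold R} {k : ground_field}.
Local Notation C := (smoothfun M k).

(** A coordinate of a local trivialisation, multiplied by a bump function and extended by zero, is a
    global functional; it detects that coordinate of [s x] because the bump function does not vanish
    at [x]. *)
Lemma section_separated (E : vbundle M k) (s : section E) :
  (forall beta : section E -> C,
     (forall (f : C) t t', beta (f *: t + t') = f * beta t + beta t') ->
     beta s = 0) ->
  s = 0.
Proof.
move=> s0; apply: section_eq => x.
have [a ax] := vb_dom_cover E x.
have [phi [Z [Zc ZU phiZ phix]]] := @bump_function _ _ k _ x (vb_dom_open a) ax.
apply: (can_inj (trivK ax)); rewrite linear0; apply/matrixP => i c.
rewrite ord1 mxE {i}.
have bs (t : section E) :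
    smooth_on [set: M] (fun y => phi y * triv a y (t y) 0 c).
  have -> : [set: M] = vb_dom a `|` ~` Z.
    by apply/seteqP; split=> // y _; case: (pselect (Z y)) => [/ZU|]; [left|right].
  apply: smooth_onU.
    have ao := vb_dom_open a; apply: smooth_onM => //.
      exact: smooth_onW (smoothfun_smooth phi).
    by apply: smooth_onW (sec_smooth t a c) => y; split.
  have nZo : open (~` Z) by exact: closed_openC.
  apply: smooth_on_eq (smooth_on_cst 0 nZo) => // y nZ.
  by rewrite phiZ // mul0r.
have lin (f : C) (t t' : section E) : mk_smoothfun (bs (f *: t + t')) =
    f * mk_smoothfun (bs t) + mk_smoothfun (bs t').
  apply/val_inj/funext => y /=; rewrite linearP !mxE mulrDr.
  by congr (_ + _); rewrite mulrCA.
have /(congr1 (fun f : C => f x)) /= := s0 _ lin.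
by move/eqP; rewrite mulf_eq0 (negbTE phix) /= => /eqP.
Qed.

End dual_sections.

(** * A decision procedure for identities in abelian groups *)

Inductive zexpr := ZVar of nat | ZZero | ZAdd of zexpr & zexpr | ZOpp of zexpr.

Fixpoint zeval (V : zmodType) (env : seq V) e : V :=
  match e with
  | ZVar n => env`_n
  | ZZero => 0
  | ZAdd a b => zeval env a + zeval env b
  | ZOpp a => - zeval env a
  end.

Fixpoint zcoef e (n : nat) : int :=
  match e with
  | ZVar m => (m == n)%:Z
  | ZZero => 0
  | ZAdd a b => zcoef a n + zcoef b n
  | ZOpp a => - zcoef a n
  end.

Lemma zevalE (V : zmodType) (env : seq V) e :
  zeval env e = \sum_(i < size env) env`_i *~ zcoef e i.
Proof.
elim: e => /= [m||a -> b ->|a ->].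
- have [mn|nm] := ltnP m (size env); last first.
    rewrite nth_default // big1 // => i _.
    by rewrite gtn_eqF ?mulr0z // (leq_trans _ nm).
  rewrite (bigD1 (Ordinal mn)) //= eqxx mulr1z big1 ?addr0 // => i.
  by rewrite -val_eqE /= eq_sym => /negbTE ->; rewrite mulr0z.
- by rewrite big1 // => i _; rewrite mulr0z.
- by rewrite -big_split /=; apply: eq_bigr => i _; rewrite mulrzDr.
- by rewrite -sumrN; apply: eq_bigr => i _; rewrite mulrNz.
Qed.

(** Variables with index at least [size env] evaluate to [0], so only finitely many coefficients
    have to be compared. *)
Lemma zeval_eq (V : zmodType) (env : seq V) a b :
  all (fun n => zcoef a n == zcoef b n) (iota 0 (size env)) ->
  zeval env a = zeval env b.
Proof.
move=> /allP ab; rewrite !zevalE; apply: eq_bigr => i _.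
by rewrite (eqP (ab i _)) // mem_iota ltn_ord.
Qed.

(** Atoms are identified by [unify], that is, up to conversion: [iS b s bs] and [s (b :: bs)] count
    as the same atom. *)
Ltac zmod_index x env :=
  lazymatch env with
  | ?y :: ?env' =>
    match constr:(tt) with
    | _ => let _ := match constr:(tt) with _ => unify x y end in constr:(O)
    | _ => let n := zmod_index x env' in constr:(S n)
    end
  end.

Ltac zmod_mem x env :=
  lazymatch env with
  | nil => constr:(false)
  | ?y :: ?env' =>
    match constr:(tt) with
    | _ => let _ := match constr:(tt) with _ => unify x y end in constr:(true)
    | _ => zmod_mem x env'
    end
  end.

Ltac zmod_atoms env t :=
  lazymatch t with
  | @GRing.add _ ?a ?b => let env' := zmod_atoms env a in zmod_atoms env' b
  | @GRing.opp _ ?a => zmod_atoms env a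
  | @GRing.zero _ => env
  | _ => let b := zmod_mem t env in
         lazymatch b with true => env | false => constr:(t :: env) end
  end.

Ltac zmod_reify env t :=
  lazymatch t with
  | @GRing.add _ ?a ?b =>
    let x := zmod_reify env a in let y := zmod_reify env b in constr:(ZAdd x y)
  | @GRing.opp _ ?a => let x := zmod_reify env a in constr:(ZOpp x)
  | @GRing.zero _ => constr:(ZZero)
  | _ => let n := zmod_index t env in constr:(ZVar n)
  end.

Ltac zmod :=
  lazymatch goal with
  | |- @eq ?T ?a ?b =>
    let env := zmod_atoms (@nil T) a in
    let env := zmod_atoms env b in
    let x := zmod_reify env a in
    let y := zmod_reify env b in
    refine (@zeval_eq _ env x y _); vm_compute; exact: erefl
  end.

Lemma addfE (T : Type) (V : nmodType) (f g : T -> V) x : (f + g) x = f x + g x.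
Proof. by []. Qed.

Lemma oppfE (T : Type) (V : zmodType) (f : T -> V) x : (- f) x = - f x.
Proof. by []. Qed.

(** * Sums over the splittings of a list into two complementary sublists *)

Lemma big_tuple0 (V : nmodType) (f : bitseq -> V) :
  \sum_(m : 0.-tuple bool) f m = f [::].
Proof.
by rewrite (big_pred1 [tuple]) //= => m; rewrite [m]tuple0; apply/esym/eqP/val_inj.
Qed.

Lemma big_tuple_cons (V : nmodType) n (P : pred bitseq) (f : bitseq -> V) :
  \sum_(m : n.+1.-tuple bool | P m) f m =
  \sum_(m : n.-tuple bool | P (true :: m)) f (true :: m) +
  \sum_(m : n.-tuple bool | P (false :: m)) f (false :: m).
Proof.
pose g (p : bool * n.-tuple bool) := cons_tuple p.1 p.2.
rewrite (reindex g) /=; last first.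
  exists (fun m : n.+1.-tuple bool => (thead m, behead_tuple m)).
    by move=> [b m] _; rewrite /g /= theadE; congr pair; apply/val_inj.
  by move=> m _; apply/val_inj; case/tupleP: m.
rewrite -(pair_big_dep predT (fun b m => P (b :: tval m))
  (fun b (m : n.-tuple bool) => f (b :: m))) /= big_bool.
by [].
Qed.

Section masksum.
Context {T : Type} {V : nmodType}.
Implicit Types (g : seq T -> seq T -> V) (s t : seq T).

Definition masksum s g : V :=
  \sum_(m : (size s).-tuple bool) g (mask m s) (mask (map negb m) s).

Lemma masksum0 g : masksum [::] g = g [::] [::].
Proof.
by rewrite /masksum
  (big_tuple0 (fun m => g (mask m [::]) (mask (map negb m) [::]))).
Qed.

(** The head goes to one side or the other. This recursion becomes the Leibniz rule for the
    contraction of products and of actions of vector fields. *)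
Lemma masksum_cons x s g : masksum (x :: s) g =
  masksum s (fun s1 s2 => g (x :: s1) s2) + masksum s (fun s1 s2 => g s1 (x :: s2)).
Proof.
exact: (big_tuple_cons (size s) xpredT
  (fun m => g (mask m (x :: s)) (mask (map negb m) (x :: s)))).
Qed.

Lemma eq_masksum s g g' :
  (forall s1 s2, (size s1 + size s2)%N = size s -> g s1 s2 = g' s1 s2) ->
  masksum s g = masksum s g'.
Proof.
elim: s g g' => [|x s IH] g g' e; first by rewrite !masksum0 e.
rewrite !masksum_cons; congr (_ + _); apply: IH => s1 s2 /= h; apply: e => /=.
  by rewrite addSn h.
by rewrite addnS h.
Qed.

Lemma masksumD s g g' :
  masksum s (fun s1 s2 => g s1 s2 + g' s1 s2) = masksum s g + masksum s g'.
Proof. exact: big_split. Qed.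

Lemma masksum_eq0 s g : 
  (forall s1 s2, (size s1 + size s2)%N = size s -> g s1 s2 = 0) ->
  masksum s g = 0.
Proof.
by move=> e; rewrite (eq_masksum (g' := fun _ _ => 0)) // /masksum big1.
Qed.

End masksum.

(** * Symmetric forms and vertical vector fields *)

Section symmetric_forms.
Context {R : realType} {M : smooth_manifold R} {k : ground_field}.
Local Notation C := (smoothfun M k).
Context {B : vbundle M k}.
Local Notation sB := (seq (section B)).

Section values.
Context {V : lmodType C}.
Implicit Types (s t u : sB -> V) (b c : section B) (f : C).

Record sform s : Prop := SForm {
  sform_lin : forall bs1 bs2 f b c,
    s (bs1 ++ (f *: b + c) :: bs2) =
    f *: s (bs1 ++ b :: bs2) + s (bs1 ++ c :: bs2) ;
  sform_sym : forall bs bs', perm_eq bs bs' -> s bs = s bs' }.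

Definition iS b s : sB -> V := fun bs => s (b :: bs).

(* [sform] restricted to lists of length at most [n], in a form suited to
   induction on [n] through the contractions. *)
Fixpoint sform_upto n s : Prop :=
  if n is n'.+1 then
    [/\ forall f b c bs, s (f *: b + c :: bs) = f *: s (b :: bs) + s (c :: bs),
        forall b c bs, s (b :: c :: bs) = s (c :: b :: bs) &
        forall b, sform_upto n' (iS b s)]
  else True.

(** Conditions at the head of the list suffice: contractions carry them to every later position, and
    exchanges of neighbours generate all permutations. *)
Lemma sformP s : (forall n, sform_upto n s) -> sform s.
Proof.
have iSn t b : (forall n, sform_upto n t) -> forall n, sform_upto n (iS b t).
  by move=> h n; have [_ _] := h n.+1; exact.
move=> h; split.
  move=> s1; elim: s1 s h => [|x s1 IH] s h s2 f b c /=.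
    by have [l _ _] := h 1%N; apply: l.
  exact: (IH (iS x s) (iSn _ _ h)).
have front (s1 : sB) : forall s x (s2 : sB), (forall n, sform_upto n s) ->
    s (s1 ++ x :: s2) = s (x :: s1 ++ s2).
  elim: s1 => [//|y s1 IH] t x s2 ht /=.
  have [_ sw _] := ht 1%N.
  by rewrite sw; apply: (IH (iS y t)); apply: iSn.
move=> bs; elim: bs s h => [|x bs IH] s h bs'.
  by rewrite perm_sym => /perm_nilP ->.
move=> p; have xb : x \in bs' by rewrite -(perm_mem p) mem_head.
case/splitPr: xb p => s1 s2 p; rewrite front //.
apply: (IH (iS x s)); first exact: iSn.
rewrite -(perm_cons x); apply: perm_trans p _.
by rewrite -[x :: s1 ++ s2]/([:: x] ++ s1 ++ s2) -[x :: s2]cat1s perm_catCA.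
Qed.

Section sform_theory.
Variable s : sB -> V.
Hypothesis sf : sform s.

Lemma sform_swap b c bs : s (b :: c :: bs) = s (c :: b :: bs).
Proof. by apply: (sform_sym sf); rewrite -cat1s -[c :: bs]cat1s perm_catCA. Qed.

Lemma sform_head f b c bs : s (f *: b + c :: bs) = f *: s (b :: bs) + s (c :: bs).
Proof. exact: (sform_lin sf [::]). Qed.

Lemma sformD b c bs : s (b + c :: bs) = s (b :: bs) + s (c :: bs).
Proof. by have := sform_head 1 b c bs; rewrite !scale1r. Qed.

Lemma sform0 bs : s (0 :: bs) = 0.
Proof. by apply: addr_idem0; rewrite -sformD addr0. Qed.

Lemma sformZ f b bs : s (f *: b :: bs) = f *: s (b :: bs).
Proof. by have := sform_head f b 0 bs; rewrite addr0 sform0 addr0. Qed.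

Lemma sformN b bs : s (- b :: bs) = - s (b :: bs).
Proof. by apply: (addIr (s (b :: bs))); rewrite -sformD !addNr sform0. Qed.

Lemma sform_iS b : sform (iS b s).
Proof.
split=> [s1 s2 f c d|bs bs' p]; first exact: (sform_lin sf (b :: s1)).
by apply: (sform_sym sf); rewrite perm_cons.
Qed.

End sform_theory.

Lemma sform_uptoP s n : sform s -> sform_upto n s.
Proof.
elim: n s => [//|n IH] s sf; split.
- by move=> f b c bs; exact: sform_head.
- by move=> b c bs; exact: sform_swap.
- by move=> b; apply/IH/sform_iS.
Qed.

Lemma sform_uptoD n s t : sform_upto n s -> sform_upto n t -> sform_upto n (s + t).
Proof.
elim: n s t => [//|n IH] s t [l1 w1 i1] [l2 w2 i2]; split.
- by move=> f b c bs; rewrite !addfE l1 l2 scalerDr; zmod.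
- by move=> b c bs; rewrite !addfE w1 w2.
- by move=> b; apply: (IH (iS b s) (iS b t)); [exact: i1|exact: i2].
Qed.

Lemma sform_uptoZ n f s : sform_upto n s -> sform_upto n (f *: s).
Proof.
elim: n s => [//|n IH] s [l1 w1 i1]; split.
- move=> g b c bs; rewrite -![(f *: s) _]/(f *: s _) l1 scalerDr !scalerA.
  by rewrite [f * g]mulrC.
- by move=> b c bs; rewrite -![(f *: s) _]/(f *: s _) w1.
- by move=> b; apply: (IH (iS b s)); exact: i1.
Qed.

Lemma sform_uptoN n s : sform_upto n s -> sform_upto n (- s).
Proof. by rewrite -scaleN1r; exact: sform_uptoZ. Qed.

Lemma sform_D s t : sform s -> sform t -> sform (s + t).
Proof. by move=> sf tf; apply: sformP => n; apply: sform_uptoD; exact: sform_uptoP. Qed.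

Lemma sform_Z f s : sform s -> sform (f *: s).
Proof. by move=> sf; apply: sformP => n; apply: sform_uptoZ; exact: sform_uptoP. Qed.

Lemma sform_N s : sform s -> sform (- s).
Proof. by move=> sf; apply: sformP => n; apply: sform_uptoN; exact: sform_uptoP. Qed.

Lemma sform_0 : sform (0 : sB -> V).
Proof. by split=> // *; rewrite -![(0 : sB -> V) _]/0 scaler0 addr0. Qed.

Lemma sform_sum I (r : seq I) (P : pred I) (F : I -> sB -> V) :
  (forall i, P i -> sform (F i)) -> sform (\sum_(i <- r | P i) F i).
Proof. by move=> h; apply: big_ind => //; [exact: sform_0|exact: sform_D]. Qed.

(** For [V = section B], [cstv] and [linv] give the constant and the linear vertical vector
    fields. *)
Definition cstv (v : V) : sB -> V := fun bs => if bs is [::] then v else 0.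
Definition linv (phi : section B -> V) : sB -> V :=
  fun bs => if bs is [:: b] then phi b else 0.

Lemma iS_cstv b v : iS b (cstv v) = 0.
Proof. by []. Qed.

Lemma iS_linv b phi : iS b (linv phi) = cstv (phi b).
Proof. by apply/funext => -[]. Qed.

Lemma sform_cstv v : sform (cstv v).
Proof.
apply: sformP => -[//|n]; split.
- by move=> *; rewrite /= scaler0 addr0.
- by [].
- by move=> b; rewrite iS_cstv; apply/sform_uptoP/sform_0.
Qed.

Lemma sform_linv (phi : section B -> V) :
  (forall f b c, phi (f *: b + c) = f *: phi b + phi c) -> sform (linv phi).
Proof.
move=> h; apply: sformP => -[//|n]; split.
- by move=> f b c [|d bs] /=; rewrite ?h // scaler0 addr0.
- by [].
- by move=> b; rewrite iS_linv; exact/sform_uptoP/sform_cstv.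
Qed.

Lemma iSD b s t : iS b (s + t) = iS b s + iS b t.
Proof. by []. Qed.

Lemma iSN b s : iS b (- s) = - iS b s.
Proof. by []. Qed.

Lemma iSZ b f s : iS b (f *: s) = f *: iS b s.
Proof. by []. Qed.

Lemma iS_swap b c s : sform s -> iS b (iS c s) = iS c (iS b s).
Proof. by move=> sf; apply/funext => bs; exact: sform_swap. Qed.

Lemma iS_addl b c s : sform s -> iS (b + c) s = iS b s + iS c s.
Proof. by move=> sf; apply/funext => bs; exact: sformD. Qed.

Lemma iS_oppl b s : sform s -> iS (- b) s = - iS b s.
Proof. by move=> sf; apply/funext => bs; exact: sformN. Qed.

Lemma iS_scalel f b s : sform s -> iS (f *: b) s = f *: iS b s.
Proof. by move=> sf; apply/funext => bs; exact: sformZ. Qed.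

End values.

Hint Resolve sform_iS sform_D sform_N sform_Z sform_0 sform_cstv : core.

Section vertical.
Context {V : lmodType C}.
Implicit Types (s t : sB -> V) (Y Z : sB -> section B) (b c : section B).

(** For scalar [s] this is the derivation given by the vertical field [Y]. Values in [section B] are
    allowed too; then it is the derivative of the field [s] along [Y] for the flat connection on the
    fibres. *)
Definition vact Y s : sB -> V := fun bs => masksum bs (fun m n => s (Y m :: n)).

Lemma vact0E Y s : vact Y s [::] = s [:: Y [::]].
Proof. exact: masksum0. Qed.

Lemma iS_vact b Y s : sform s -> iS b (vact Y s) = vact (iS b Y) s + vact Y (iS b s).
Proof.
move=> sf; apply/funext => bs; rewrite addfE /vact /iS masksum_cons.
by congr (_ + _); apply: eq_masksum => m n _; rewrite sform_swap.
Qed.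

Lemma vactDl Y Z s : sform s -> vact (Y + Z) s = vact Y s + vact Z s.
Proof.
move=> sf; apply/funext => bs; rewrite addfE -masksumD.
by apply: eq_masksum => m n _; exact: (sformD sf).
Qed.

Lemma vactNl Y s : sform s -> vact (- Y) s = - vact Y s.
Proof.
move=> sf; apply/funext => bs; rewrite oppfE /vact /masksum -sumrN.
by apply: eq_bigr => m _; exact: (sformN sf).
Qed.

Lemma vactZl f Y s : sform s -> vact (f *: Y) s = f *: vact Y s.
Proof.
move=> sf; apply/funext => bs; rewrite -[RHS]/(f *: vact Y s bs) /vact /masksum.
by rewrite scaler_sumr; apply: eq_bigr => m _; exact: (sformZ sf).
Qed.

Lemma vact0l s : sform s -> vact 0 s = 0.
Proof.
by move=> sf; apply/funext => bs; apply: masksum_eq0 => m n _; exact: sform0.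
Qed.

Lemma vactDr Y s t : vact Y (s + t) = vact Y s + vact Y t.
Proof. by apply/funext => bs; exact: masksumD. Qed.

Lemma vactNr Y s : vact Y (- s) = - vact Y s.
Proof. by apply/funext => bs; rewrite oppfE /vact /masksum -sumrN. Qed.

Lemma vactZr f Y s : vact Y (f *: s) = f *: vact Y s.
Proof.
by apply/funext => bs; rewrite -[RHS]/(f *: vact Y s bs) /vact /masksum scaler_sumr.
Qed.

Lemma vact0r Y : vact Y (0 : sB -> V) = 0.
Proof. by apply/funext => bs; apply: masksum_eq0. Qed.

Lemma vact_cstv b s : sform s -> vact (cstv b) s = iS b s.
Proof.
move=> sf; apply/funext => bs; elim: bs s sf => [|c bs IH] s sf.
  by rewrite vact0E.
rewrite -[LHS]/(iS c (vact (cstv b) s) bs) iS_vact // iS_cstv vact0l // add0r.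
by rewrite IH; auto; rewrite iS_swap.
Qed.

Lemma sform_vact Y s : sform Y -> sform s -> sform (vact Y s).
Proof.
move=> Yf sf; apply: sformP => n; elim: n Y s Yf sf => [//|n IH] Y s Yf sf; split.
- move=> f b c bs; rewrite -![vact Y s (_ :: _)]/(iS _ (vact Y s) bs) !iS_vact //.
  rewrite !iS_addl // !iS_scalel // vactDl // vactZl // vactDr vactZr !addfE.
  by rewrite -![(f *: _) _]/(f *: (_ _)) scalerDr; zmod.
- move=> b c bs; rewrite -![vact Y s _]/(iS _ (iS _ (vact Y s)) bs).
  rewrite !iS_vact // !iSD !iS_vact; auto; rewrite !addfE.
  by rewrite (iS_swap b c sf) (iS_swap b c Yf); zmod.
- by move=> b; rewrite iS_vact //; apply: sform_uptoD; apply: IH; auto.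
Qed.

End vertical.
Hint Resolve sform_vact : core.

(** The second-order terms are symmetric in [Y] and [Z] and cancel. What remains is the action of
    the Lie bracket of the two fields, which is the difference of their flat derivatives. *)
Lemma vact_bracket (V : lmodType C) (Y Z : sB -> section B) (s : sB -> V) :
  sform Y -> sform Z -> sform s ->
  vact Y (vact Z s) - vact Z (vact Y s) = vact (vact Y Z - vact Z Y) s.
Proof.
move=> Yf Zf sf; apply/funext => bs; elim: bs Y Z s Yf Zf sf => [|b bs IH] Y Z s Yf Zf sf.
  have e Y' Z' : vact Y' (vact Z' s) [::] =
      s [:: Z' [:: Y' [::]]] + s [:: Z' [::]; Y' [::]].
    by rewrite vact0E /vact masksum_cons !masksum0.
  rewrite addfE oppfE !e vact0E addfE oppfE !vact0E sformD // sformN //.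
  by rewrite (sform_swap sf (Z _) (Y _)); zmod.
rewrite -[LHS]/(iS b (vact Y (vact Z s) - vact Z (vact Y s)) bs).
rewrite -[RHS]/(iS b (vact (vact Y Z - vact Z Y) s) bs).
rewrite iSD iSN !iS_vact; auto; rewrite !iSD !iSN !iS_vact; auto.
have h1 := IH (iS b Y) Z s; have h2 := IH Y (iS b Z) s; have h3 := IH Y Z (iS b s).
transitivity
  ((vact (iS b Y) (vact Z s) - vact Z (vact (iS b Y) s)) bs +
   (vact Y (vact (iS b Z) s) - vact (iS b Z) (vact Y s)) bs +
   (vact Y (vact Z (iS b s)) - vact Z (vact Y (iS b s))) bs).
  by rewrite !vactDr !(addfE, oppfE); zmod.
rewrite h1; auto; rewrite h2; auto; rewrite h3; auto.
by rewrite !vactDl; auto; rewrite !vactNl; auto; rewrite !vactDl; auto;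
   rewrite !(addfE, oppfE); zmod.
Qed.

End symmetric_forms.

Create HintDb sforms.
#[local] Hint Resolve sform_iS sform_D sform_N sform_Z sform_0 sform_cstv
  sform_vact : sforms.
#[local] Hint Extern 0 (sform _) => solve [auto 8 with sforms nocore] : core.

(** * Induced connections on symmetric forms and their curvature *)

Section substitution_sum.
Context {T : Type} {V : nmodType} (x0 : T).
Implicit Types (phi : T -> T) (s : seq T -> V).

Definition subst_sum phi s : seq T -> V := fun bs =>
  \sum_(t < size bs) s (set_nth x0 bs t (phi (nth x0 bs t))).

Lemma subst_sum0 phi s : subst_sum phi s [::] = 0.
Proof. exact: big_ord0. Qed.

Lemma subst_sum_cons phi s b bs : subst_sum phi s (b :: bs) =
  s (phi b :: bs) + subst_sum phi (fun cs => s (b :: cs)) bs.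
Proof. exact: big_ord_recl. Qed.

Lemma subst_sumD phi s t :
  subst_sum phi (s + t) = subst_sum phi s + subst_sum phi t.
Proof. by apply/funext => bs; exact: big_split. Qed.

End substitution_sum.

Lemma scalefE (A : pzRingType) (V : lmodType A) (T : Type) (a : A) (f : T -> V) x :
  (a *: f) x = a *: f x.
Proof. by []. Qed.

Section connections.
Context {R : realType} {M : smooth_manifold R} {k : ground_field}.
Local Notation C := (smoothfun M k).
Context {L : lie_algebroid M k} {B : vbundle M k} (nabla : connection L B).
Local Notation sB := (seq (section B)).
Local Notation br := (@la_bracket _ _ _ L).
Implicit Types (l m n : section L) (b c : section B) (f g : C).

Lemma rho_add l f g : rho l (f + g) = rho l f + rho l g.
Proof.
apply/val_inj/funext => x /=; have [h _] := anchor_tangent (l x).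
have := h 1 f g; rewrite mul1r (_ : smooth_cst M 1 = 1) ?mul1r //.
exact/val_inj/funext.
Qed.

Lemma rho_cst l (c : Defs.scalar R k) : rho l (smooth_cst M c) = 0.
Proof.
apply/val_inj/funext => x /=; have [h1 h2] := anchor_tangent (l x).
have a1 : anchor (l x) (1 : C) = 0.
  have := h2 1 1; rewrite mulr1 -[(1 : C) x]/1 mulr1 mul1r.
  exact: addr_idem0.
have a0 : anchor (l x) (0 : C) = 0.
  by apply: addr_idem0; have := h1 1 0 0; rewrite mulr0 add0r mul1r.
by have := h1 c 1 0; rewrite mulr1 addr0 a1 a0 mulr0 addr0.
Qed.

Lemma cn_addl l m b : nabla (l + m) b = nabla l b + nabla m b.
Proof. by have := cn_linear nabla 1 l m b; rewrite !scale1r. Qed.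

Lemma cn_0l b : nabla 0 b = 0.
Proof. by apply: addr_idem0; rewrite -cn_addl addr0. Qed.

Lemma cn_oppl l b : nabla (- l) b = - nabla l b.
Proof. by apply: (addIr (nabla l b)); rewrite -cn_addl !addNr cn_0l. Qed.

Lemma cn_scalel f l b : nabla (f *: l) b = f *: nabla l b.
Proof. by have := cn_linear nabla f l 0 b; rewrite addr0 cn_0l addr0. Qed.

Lemma br_addl l m n : br (l + m) n = br l n + br m n.
Proof.
have := la_bracket_linear 1 l m n.
by rewrite (_ : smooth_cst M 1 = 1) ?scale1r //; apply/val_inj/funext.
Qed.

Lemma br_addr l m n : br l (m + n) = br l m + br l n.
Proof. by rewrite la_bracket_antisym br_addl opprD -!la_bracket_antisym. Qed.

Lemma br_oppl l m : br (- l) m = - br l m.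
Proof.
apply: (addIr (br l m)); rewrite -br_addl !addNr.
by apply: addr_idem0; rewrite -br_addl addr0.
Qed.

Lemma br_oppr l m : br l (- m) = - br l m.
Proof. by rewrite la_bracket_antisym br_oppl -la_bracket_antisym. Qed.

Lemma br_scalel f l m : br (f *: l) m = f *: br l m - rho m f *: l.
Proof.
by rewrite la_bracket_antisym la_leibniz opprD -scalerN -la_bracket_antisym.
Qed.

Lemma scalar_natr_eq0 (n : nat) : (n%:R == 0 :> Defs.scalar R k) = (n == 0%N).
Proof.
case: (k) => /=; first exact: (@pnatr_eq0 R).
exact: (@pnatr_eq0 (R[i])%C).
Qed.

(** Characteristic zero turns antisymmetry into vanishing on the diagonal, as in [br_self] and
    [ncurv_self]. *)
Lemma section_double0 (E : vbundle M k) (s : section E) : s + s = 0 -> s = 0.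
Proof.
move=> h; have u : smooth_cst M (2^-1 : Defs.scalar R k) * (1 + 1) = 1.
  apply/val_inj/funext => x /=; change (2^-1 * (1 + 1) = 1 :> Defs.scalar R k).
  by rewrite mulVf // (scalar_natr_eq0 2).
by rewrite -[s]scale1r -u -scalerA scalerDl !scale1r h scaler0.
Qed.

Lemma br_self l : br l l = 0.
Proof.
by apply: section_double0; rewrite -[X in X + _]opprK -la_bracket_antisym addNr.
Qed.

Section covariant.
Context {V : lmodType C}.
Implicit Types (s t : sB -> V) (D : section L -> V -> V).

(** The instances are [rho] on functions and [nabla] on [section B]; a common treatment covers
    scalar forms and vertical fields at once. *)
Record vconn D : Prop := VConn {
  vc_add : forall l v w, D l (v + w) = D l v + D l w ;
  vc_leibniz : forall l f v, D l (f *: v) = f *: D l v + rho l f *: v ;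
  vc_scalel : forall f l v, D (f *: l) v = f *: D l v ;
  vc_addl : forall l m v, D (l + m) v = D l v + D m v }.

(* Locked, because rewriting would otherwise unfold it to match sums. *)
Definition ndual D l s : sB -> V :=
  locked (fun bs => D l (s bs) - subst_sum 0 (nabla l) s bs).

Lemma ndualE D l s bs : ndual D l s bs = D l (s bs) - subst_sum 0 (nabla l) s bs.
Proof. by rewrite /ndual -lock. Qed.

Context {D : section L -> V -> V} (Dc : vconn D).

Lemma vc_0 l : D l 0 = 0.
Proof. by apply: addr_idem0; rewrite -(vc_add Dc) addr0. Qed.

Lemma ndual0E l s : ndual D l s [::] = D l (s [::]).
Proof. by rewrite ndualE subst_sum0 subr0. Qed.

(** The commutator of a contraction with the covariant derivative; the inductions on the list of
    arguments below run through it. *)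
Lemma iS_ndual b l s : iS b (ndual D l s) = ndual D l (iS b s) - iS (nabla l b) s.
Proof.
apply/funext => bs; rewrite addfE oppfE /iS !ndualE subst_sum_cons.
by zmod.
Qed.

Lemma ndualD l s t : ndual D l (s + t) = ndual D l s + ndual D l t.
Proof.
by apply/funext => bs; rewrite addfE !ndualE subst_sumD !addfE (vc_add Dc); zmod.
Qed.

Lemma ndual_leibniz l f s : ndual D l (f *: s) = f *: ndual D l s + rho l f *: s.
Proof.
apply/funext => bs; rewrite addfE -[(f *: _) _]/(f *: _) -[(rho l f *: _) _]/(_ *: s bs).
rewrite !ndualE -[(f *: s) bs]/(f *: s bs) (vc_leibniz Dc) scalerBr scaler_sumr.
by rewrite addrAC.
Qed.

Lemma ndual0 l : ndual D l 0 = 0.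
Proof. by apply: addr_idem0; rewrite -ndualD addr0. Qed.

Lemma ndualN l s : ndual D l (- s) = - ndual D l s.
Proof. by apply: (addIr (ndual D l s)); rewrite -ndualD !addNr ndual0. Qed.

Lemma ndual_scalel f l s : sform s -> ndual D (f *: l) s = f *: ndual D l s.
Proof.
move=> sf; apply/funext => bs; elim: bs s sf => [|b bs IH] s sf.
  by rewrite -[RHS]/(f *: ndual D l s [::]) !ndual0E (vc_scalel Dc).
rewrite -[LHS]/(iS b (ndual D (f *: l) s) bs) -[RHS]/(f *: iS b (ndual D l s) bs).
rewrite !iS_ndual !(addfE, oppfE) IH; auto.
by rewrite cn_scalel iS_scalel // !scalefE [RHS]scalerBr.
Qed.

Lemma ndual_addl l m s : sform s -> ndual D (l + m) s = ndual D l s + ndual D m s.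
Proof.
move=> sf; apply/funext => bs; elim: bs s sf => [|b bs IH] s sf.
  by rewrite addfE !ndual0E (vc_addl Dc).
rewrite -[LHS]/(iS b (ndual D (l + m) s) bs).
rewrite -[RHS]/(iS b (ndual D l s + ndual D m s) bs).
rewrite iSD !iS_ndual !(addfE, oppfE) IH; auto.
by rewrite !(addfE, oppfE) cn_addl iS_addl // !(addfE, oppfE); zmod.
Qed.

Lemma sform_ndual l s : sform s -> sform (ndual D l s).
Proof.
move=> sf; apply: sformP => n; elim: n s sf => [//|n IH] s sf; split.
- move=> f b c bs; rewrite -![ndual D l s (_ :: _)]/(iS _ (ndual D l s) bs) !iS_ndual.
  rewrite cn_additive cn_leibniz !iS_addl // !iS_scalel // ndualD ndual_leibniz.
  by rewrite !(addfE, oppfE, scalefE) [in RHS]scalerBr; zmod.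
- move=> b c bs.
  have e b' c' : ndual D l s [:: b', c' & bs] = iS c' (iS b' (ndual D l s)) bs by [].
  rewrite !e !iS_ndual !iSD !iSN !iS_ndual !(addfE, oppfE).
  rewrite (iS_swap b c sf) (iS_swap b (nabla l c) sf) (iS_swap (nabla l b) c sf).
  by zmod.
- move=> b; rewrite iS_ndual //; apply: sform_uptoD; first by apply: IH; auto.
  by apply: sform_uptoP; auto.
Qed.

End covariant.

Lemma vconn_nabla : vconn nabla.
Proof.
by split; [exact: cn_additive|exact: cn_leibniz|exact: cn_scalel|exact: cn_addl].
Qed.

Lemma vconn_rho : vconn (V := C^o) (@rho _ _ _ L).
Proof.
split.
- exact: rho_add.
- by move=> l f v; rewrite [rho l _]rhoM addrC.
- move=> f l v; have r0 : rho (0 : section L) v = 0.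
    by apply: addr_idem0; have := rhoDl 1 (0 : section L) 0 v; rewrite scaler0 addr0 mul1r.
  by have := rhoDl f l 0 v; rewrite addr0 r0 addr0.
- by move=> l m v; have := rhoDl 1 l m v; rewrite scale1r mul1r.
Qed.

Lemma ndual_vact (V : lmodType C) (D : section L -> V -> V) l
    (Y : sB -> section B) (s : sB -> V) : vconn D -> sform Y -> sform s ->
  ndual D l (vact Y s) = vact (ndual nabla l Y) s + vact Y (ndual D l s).
Proof.
move=> Dc Yf sf; have nf Z : sform Z -> sform (ndual nabla l Z).
  by apply: sform_ndual; exact: vconn_nabla.
have df t : sform t -> sform (ndual D l t) by exact: sform_ndual.
apply/funext => bs; elim: bs Y s Yf sf => [|b bs IH] Y s Yf sf.
  rewrite addfE ndual0E !vact0E ndual0E -[ndual D l s _]/(iS _ (ndual D l s) [::]).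
  rewrite iS_ndual; rewrite !(addfE, oppfE) ndual0E /iS.
  by zmod.
rewrite -[LHS]/(iS b (ndual D l (vact Y s)) bs).
rewrite -[RHS]/(iS b (vact (ndual nabla l Y) s + vact Y (ndual D l s)) bs).
rewrite iSD iS_ndual !iS_vact; auto; rewrite !iS_ndual (ndualD Dc).
rewrite !vactDl; auto; rewrite !vactDr !vactNl; auto; rewrite !vactNr.
rewrite !(addfE, oppfE) !IH; auto; rewrite !(addfE, oppfE).
by zmod.
Qed.

Definition curvature l m b :=
  nabla l (nabla m b) - nabla m (nabla l b) - nabla (br l m) b.

Lemma curvature_lin l m f b c :
  curvature l m (f *: b + c) = f *: curvature l m b + curvature l m c.
Proof.
rewrite /curvature !cn_additive !cn_leibniz !cn_additive !cn_leibniz la_rho_bracket.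
by rewrite !scalerBr scalerBl; zmod.
Qed.

Lemma curvature_scalel f l m b : curvature (f *: l) m b = f *: curvature l m b.
Proof.
rewrite /curvature br_scalel !cn_scalel cn_leibniz cn_addl cn_oppl !cn_scalel.
by rewrite !scalerBr; zmod.
Qed.

Lemma curvature_addl l l' m b :
  curvature (l + l') m b = curvature l m b + curvature l' m b.
Proof. by rewrite /curvature br_addl !cn_addl cn_additive; zmod. Qed.

Lemma curvature_antisym l m b : curvature l m b = - curvature m l b.
Proof. by rewrite /curvature [br l m]la_bracket_antisym cn_oppl; zmod. Qed.

Lemma sform_curvature l m : sform (linv (curvature l m)).
Proof. by apply: sform_linv => *; exact: curvature_lin. Qed.

Local Notation drho := (ndual (V := C^o) (@rho _ _ _ L)).

(** In degree 0 nothing is left, because the anchor respects brackets. On the dual of [B] the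
    curvature acts by its negative transpose, which is the action of the linear field
    [- linv (curvature l m)]. *)
Lemma ndual_bracket l m (s : sB -> C^o) : sform s ->
  drho l (drho m s) - drho m (drho l s) - drho (br l m) s =
  vact (- linv (curvature l m)) s.
Proof.
move=> sf; have df n (t : sB -> C^o) : sform t -> sform (drho n t).
  by apply: sform_ndual; exact: vconn_rho.
have lf := sform_curvature l m.
apply/funext => bs; elim: bs s sf => [|b bs IH] s sf.
  rewrite !(addfE, oppfE) !ndual0E vact0E !oppfE /= oppr0 sform0 //.
  by rewrite la_rho_bracket subrr.
rewrite -[LHS]/(iS b (drho l (drho m s) - drho m (drho l s) - drho (br l m) s) bs).
rewrite -[RHS]/(iS b (vact (- linv (curvature l m)) s) bs).
have Rc := vconn_rho.
have ec : iS (curvature l m b) s = iS (nabla l (nabla m b)) s -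
    iS (nabla m (nabla l b)) s - iS (nabla (br l m) b) s.
  by rewrite /curvature !iS_addl // !iS_oppl.
rewrite iS_vact // iSN iS_linv vactNl // vact_cstv // addfE -IH; auto.
rewrite ec !iSD !iSN !iS_ndual !(ndualD Rc, ndualN Rc) ?iS_ndual.
rewrite !(addfE, oppfE).
by zmod.
Qed.

End connections.

#[local] Hint Resolve vconn_rho vconn_nabla sform_curvature sform_ndual : sforms.

Lemma masksum_all (T : Type) (V : nmodType) (s : seq T) (g : seq T -> seq T -> V) :
  (forall s1 x s2, g s1 (x :: s2) = 0) -> masksum s g = g s [::].
Proof.
elim: s g => [|x s IH] g g0; first exact: masksum0.
rewrite masksum_cons IH // [X in _ + X]masksum_eq0 ?addr0 //.
Qed.

(** * Connections perturbed by a vertical field, their curvature and the Bianchi identity *)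

Section flatness.
Context {R : realType} {M : smooth_manifold R} {k : ground_field}.
Local Notation C := (smoothfun M k).
Context {L : lie_algebroid M k} {B : vbundle M k} (nabla : connection L B).
Local Notation sB := (seq (section B)).
Local Notation br := (@la_bracket _ _ _ L).
Local Notation drho := (ndual nabla (V := C^o) (@rho _ _ _ L)).
Implicit Types (l m n : section L) (b c : section B) (f g : C).

Lemma vact_linv (Z : sB -> section B) (beta : section B -> C^o) bs :
  beta 0 = 0 -> vact Z (linv beta) bs = beta (Z bs).
Proof. by move=> b0; rewrite /vact masksum_all. Qed.

(** Linear forms [linv beta] suffice as tests: the action of [Z] on them returns [beta (Z bs)], and
    the functionals [beta] separate sections. *)
Lemma vact_faithful (Z : sB -> section B) :
  (forall s : sB -> C^o, sform s -> vact Z s = 0) -> Z = 0.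
Proof.
move=> h; apply/funext => bs; apply: section_separated => beta bl.
have b0 : beta 0 = 0.
  by apply: addr_idem0; have := bl 1 0 0; rewrite scaler0 addr0 mul1r.
rewrite -(vact_linv Z (beta := beta)) // h //.
exact: sform_linv.
Qed.

Implicit Type Y : section L -> sB -> section B.

Record vfield1 Y : Prop := VField1 {
  vf_add : forall l m, Y (l + m) = Y l + Y m ;
  vf_scale : forall f l, Y (f *: l) = f *: Y l ;
  vf_form : forall l, sform (Y l) }.
Hint Resolve vf_form : sforms.

Lemma vf_0 Y : vfield1 Y -> Y 0 = 0.
Proof. by move=> Yf; apply: addr_idem0; rewrite -(vf_add Yf) addr0. Qed.

Lemma vf_opp Y l : vfield1 Y -> Y (- l) = - Y l.
Proof.
by move=> Yf; apply: (addIr (Y l)); rewrite -(vf_add Yf) !addNr vf_0.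
Qed.

Definition ncov Y l (s : sB -> C^o) := drho l s + vact (Y l) s.

(* The vertical vector field by which the curvature of [ncov Y] acts. *)
Definition ncurv Y l m : sB -> section B :=
  - linv (curvature nabla l m) + ndual nabla nabla l (Y m) - ndual nabla nabla m (Y l)
  - Y (br l m) + vact (Y l) (Y m) - vact (Y m) (Y l).

(** The vertical field by which the commutator of [ncov Y l] with the action of [Z] acts; see
    [ncov_vact]. *)
Definition nbracket Y l (Z : sB -> section B) :=
  ndual nabla nabla l Z + vact (Y l) Z - vact Z (Y l).

Section theory.
Variable Y : section L -> sB -> section B.
Hypothesis Yf : vfield1 Y.
Hint Resolve Yf : sforms.

Lemma sform_ncov l s : sform s -> sform (ncov Y l s).
Proof. by move=> sf; apply: sform_D; auto. Qed.

Lemma sform_ncurv l m : sform (ncurv Y l m).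
Proof. by rewrite /ncurv; do ?apply: sform_D; do ?apply: sform_N; auto. Qed.
Hint Resolve sform_ncov sform_ncurv : sforms.

Lemma ncovD l s t : ncov Y l (s + t) = ncov Y l s + ncov Y l t.
Proof. by rewrite /ncov (ndualD _ vconn_rho) vactDr; zmod. Qed.

Lemma ncovN l s : ncov Y l (- s) = - ncov Y l s.
Proof. by rewrite /ncov (ndualN _ vconn_rho) vactNr; zmod. Qed.

Lemma ncov0 l : ncov Y l 0 = 0.
Proof. by rewrite /ncov (ndual0 _ vconn_rho) vact0r addr0. Qed.

Lemma ncov_leibniz l f s : ncov Y l (f *: s) = f *: ncov Y l s + rho l f *: s.
Proof. by rewrite /ncov (ndual_leibniz _ vconn_rho) vactZr scalerDr; zmod. Qed.

Lemma ncov_addl l m s : sform s -> ncov Y (l + m) s = ncov Y l s + ncov Y m s.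
Proof.
by move=> sf; rewrite /ncov (ndual_addl _ vconn_rho) // (vf_add Yf) vactDl //; zmod.
Qed.

Lemma ncov_scalel f l s : sform s -> ncov Y (f *: l) s = f *: ncov Y l s.
Proof.
move=> sf; rewrite /ncov (ndual_scalel _ vconn_rho) // (vf_scale Yf) vactZl //.
by rewrite scalerDr.
Qed.

Lemma ncov_bracket l m s : sform s ->
  ncov Y l (ncov Y m s) - ncov Y m (ncov Y l s) - ncov Y (br l m) s =
  vact (ncurv Y l m) s.
Proof.
move=> sf; have Rc := @vconn_rho _ _ _ L.
have h1 := ndual_bracket nabla l m sf.
have h2 : vact (vact (Y l) (Y m)) s - vact (vact (Y m) (Y l)) s =
    vact (Y l) (vact (Y m) s) - vact (Y m) (vact (Y l) s).
  by rewrite vact_bracket; auto; rewrite vactDl // vactNl.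
rewrite /ncurv !vactDl // !vactNl // -vactNl // -h1.
rewrite -[X in _ = X]addrA h2 /ncov !(ndualD _ Rc) !vactDr.
rewrite !(ndual_vact nabla _ Rc); auto.
by zmod.
Qed.

Lemma ncov_vact l Z s : sform Z -> sform s ->
  ncov Y l (vact Z s) - vact Z (ncov Y l s) = vact (nbracket Y l Z) s.
Proof.
move=> Zf sf; have Rc := @vconn_rho _ _ _ L.
have h2 := vact_bracket (vf_form Yf l) Zf sf.
rewrite /ncov (ndual_vact nabla _ Rc) // vactDr.
rewrite /nbracket -[in RHS]addrA vactDl // -h2; zmod.
Qed.

Lemma ncurv_addl l l' m : ncurv Y (l + l') m = ncurv Y l m + ncurv Y l' m.
Proof.
have Nc := vconn_nabla nabla.
have e : linv (curvature nabla (l + l') m) =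
    linv (curvature nabla l m) + linv (curvature nabla l' m).
  apply/funext => -[|b [|c bs]]; rewrite addfE /= ?addr0 //.
  exact: curvature_addl.
rewrite /ncurv e br_addl !(vf_add Yf) (ndual_addl _ Nc) //.
by rewrite (ndualD _ Nc) vactDl // vactDr; zmod.
Qed.

Lemma ncurv_scalel f l m : ncurv Y (f *: l) m = f *: ncurv Y l m.
Proof.
have Nc := vconn_nabla nabla.
have e : linv (curvature nabla (f *: l) m) = f *: linv (curvature nabla l m).
  apply/funext => -[|b [|c bs]]; rewrite scalefE /= ?scaler0 //.
  exact: curvature_scalel.
rewrite /ncurv e br_scalel !(vf_add Yf, vf_opp, vf_scale Yf) //.
rewrite (ndual_scalel _ Nc) // (ndual_leibniz _ Nc).
by rewrite vactZl // vactZr !(scalerDr, scalerN); zmod.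
Qed.

Lemma ncurv_antisym l m : ncurv Y l m = - ncurv Y m l.
Proof.
have e : linv (curvature nabla l m) = - linv (curvature nabla m l).
  apply/funext => -[|b [|c bs]]; rewrite oppfE /= ?oppr0 //.
  exact: curvature_antisym.
by rewrite /ncurv e [br l m]la_bracket_antisym vf_opp //; zmod.
Qed.

Lemma ncurv_self l : ncurv Y l l = 0.
Proof.
apply/funext => bs; apply: section_double0.
by rewrite {2}ncurv_antisym oppfE subrr.
Qed.

(** By faithfulness this is an identity of operators: the triple commutators cancel by the Jacobi
    identity for operators, the commutators with [ncov Y (br m n)] cancel against the last three
    curvatures, and the rest is the Jacobi identity of [L]. *)
Lemma bianchi l m n :
  nbracket Y l (ncurv Y m n) + nbracket Y m (ncurv Y n l) + nbracket Y n (ncurv Y l m)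
  + ncurv Y l (br m n) + ncurv Y m (br n l) + ncurv Y n (br l m) = 0.
Proof.
have sN p q r : sform (nbracket Y p (ncurv Y q r)).
  by rewrite /nbracket; do ?apply: sform_D; do ?apply: sform_N; auto.
apply: vact_faithful => s sf.
have vactD6 (Z1 Z2 Z3 Z4 Z5 Z6 : sB -> section B) :
    vact (Z1 + Z2 + Z3 + Z4 + Z5 + Z6) s =
    vact Z1 s + vact Z2 s + vact Z3 s + vact Z4 s + vact Z5 s + vact Z6 s.
  by rewrite !vactDl.
rewrite vactD6 -!ncov_vact // -!ncov_bracket //; do ?exact: sform_ncov.
rewrite !(ncovD, ncovN).
have J := la_jacobi l m n.
(* These terms do not cancel formally; they combine because [ncov Y] is additive in its
   direction. *)
have : ncov Y (br l (br m n)) s + ncov Y (br m (br n l)) s + ncov Y (br n (br l m)) s = 0.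
  by rewrite -!ncov_addl // J; apply: addr_idem0; rewrite -ncov_addl // addr0.
set a := ncov Y (br l _) s; set b := ncov Y (br m _) s; set c := ncov Y (br n _) s.
move=> /eqP; rewrite -addrA addr_eq0 => /eqP ->.
by zmod.
Qed.

End theory.
End flatness.

Lemma zerofE (T : Type) (V : nmodType) x : (0 : T -> V) x = 0.
Proof. by []. Qed.

(** * Alternating forms and Cartan calculus *)

Section alternating_forms.
Context {R : realType} {M : smooth_manifold R} {k : ground_field}.
Local Notation C := (smoothfun M k).
Context {L : vbundle M k} {W : lmodType C}.
Local Notation sL := (seq (section L)).
Implicit Types (F G : sL -> W) (l m : section L) (f g : C) (ls : sL).

Record aform F : Prop := AForm {
  aform_lin : forall s1 s2 f l m,
    F (s1 ++ (f *: l + m) :: s2) = f *: F (s1 ++ l :: s2) + F (s1 ++ m :: s2) ;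
  aform_alt : forall s1 s2 s3 l, F (s1 ++ l :: s2 ++ l :: s3) = 0 }.

Definition iL l F : sL -> W := fun ls => F (l :: ls).

Fixpoint aform_upto n F : Prop :=
  if n is n'.+1 then
    [/\ forall f l m ls, F (f *: l + m :: ls) = f *: F (l :: ls) + F (m :: ls),
        forall l ls, F (l :: l :: ls) = 0 &
        forall l, aform_upto n' (iL l F)]
  else True.

(** As for symmetric forms, conditions at the head suffice. Antisymmetry follows by polarising at
    [l + m], and it then brings two distant equal entries together. *)
Lemma aformP F : (forall n, aform_upto n F) -> aform F.
Proof.
have iLn G l : (forall n, aform_upto n G) -> forall n, aform_upto n (iL l G).
  by move=> h n; have [_ _] := h n.+1; exact.
have addG G l m ls : (forall n, aform_upto n G) ->
    G (l + m :: ls) = G (l :: ls) + G (m :: ls).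
  by move=> h; have [li _ _] := h 1%N; have := li 1 l m ls; rewrite !scale1r.
have swap G l m ls : (forall n, aform_upto n G) ->
    G (l :: m :: ls) = - G (m :: l :: ls).
  move=> h; have [_ alt _] := h 1%N; apply/eqP; rewrite -addr_eq0; apply/eqP.
  have := alt (l + m) ls; rewrite addG // -![G (_ :: l + m :: ls)]/(iL _ G (l + m :: ls)).
  rewrite !addG; try exact: iLn.
  by rewrite /iL !alt add0r addr0.
move=> h; split.
  move=> s1; elim: s1 F h => [|x s1 IH] F h s2 f l m /=.
    by have [li _ _] := h 1%N; apply: li.
  exact: (IH (iL x F) (iLn _ _ h)).
move=> s1; elim: s1 F h => [|x s1 IH] F h s2 s3 l /=; last first.
  exact: (IH (iL x F) (iLn _ _ h)).
elim: s2 F h => [|x s2 IH] F h /=.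
  by have [_ alt _] := h 1%N; apply: alt.
by rewrite swap // -[F _]/(iL x F (l :: s2 ++ l :: s3)) IH ?oppr0 //; exact: iLn.
Qed.

Section aform_theory.
Variable F : sL -> W.
Hypothesis Ff : aform F.

Lemma aform_iL l : aform (iL l F).
Proof.
split=> [s1 s2 f m n|s1 s2 s3 m]; first exact: (aform_lin Ff (l :: s1)).
exact: (aform_alt Ff (l :: s1)).
Qed.

Lemma aformD l m ls : F (l + m :: ls) = F (l :: ls) + F (m :: ls).
Proof. by have := aform_lin Ff [::] ls 1 l m; rewrite !scale1r. Qed.

Lemma aform0 ls : F (0 :: ls) = 0.
Proof. by apply: addr_idem0; rewrite -aformD addr0. Qed.

Lemma aformZ f l ls : F (f *: l :: ls) = f *: F (l :: ls).
Proof. by have := aform_lin Ff [::] ls f l 0; rewrite /= addr0 aform0 addr0. Qed.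

Lemma aform_self l ls : F (l :: l :: ls) = 0.
Proof. exact: (aform_alt Ff [::] [::]). Qed.

End aform_theory.

Lemma aform_swap F l m ls : aform F -> F (l :: m :: ls) = - F (m :: l :: ls).
Proof.
move=> Ff; apply/eqP; rewrite -addr_eq0; apply/eqP.
have := aform_self Ff (l + m) ls.
rewrite aformD // -![F (_ :: l + m :: ls)]/(iL _ F (l + m :: ls)).
by rewrite !aformD; try exact: aform_iL; rewrite /iL !aform_self // add0r addr0.
Qed.

Lemma aform_uptoP F n : aform F -> aform_upto n F.
Proof.
elim: n F => [//|n IH] F Ff; split.
- by move=> f l m ls; exact: (aform_lin Ff [::]).
- by move=> l ls; exact: aform_self.
- by move=> l; apply/IH/aform_iL.
Qed.

Lemma aform_uptoD n F G : aform_upto n F -> aform_upto n G -> aform_upto n (F + G).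
Proof.
elim: n F G => [//|n IH] F G [l1 w1 i1] [l2 w2 i2]; split.
- by move=> f l m ls; rewrite !addfE l1 l2 scalerDr; zmod.
- by move=> l ls; rewrite !addfE w1 w2 addr0.
- by move=> l; apply: (IH (iL l F) (iL l G)); [exact: i1|exact: i2].
Qed.

Lemma aform_uptoZ n f F : aform_upto n F -> aform_upto n (f *: F).
Proof.
elim: n F => [//|n IH] F [l1 w1 i1]; split.
- by move=> g l m ls; rewrite !scalefE l1 scalerDr !scalerA [f * g]mulrC.
- by move=> l ls; rewrite !scalefE w1 scaler0.
- by move=> l; apply: (IH (iL l F)); exact: i1.
Qed.

Lemma aform_uptoN n F : aform_upto n F -> aform_upto n (- F).
Proof. by rewrite -scaleN1r; exact: aform_uptoZ. Qed.

Lemma aform_D F G : aform F -> aform G -> aform (F + G).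
Proof. by move=> Ff Gf; apply: aformP => n; apply: aform_uptoD; exact: aform_uptoP. Qed.

Lemma aform_Z f F : aform F -> aform (f *: F).
Proof. by move=> Ff; apply: aformP => n; apply: aform_uptoZ; exact: aform_uptoP. Qed.

Lemma aform_N F : aform F -> aform (- F).
Proof. by move=> Ff; apply: aformP => n; apply: aform_uptoN; exact: aform_uptoP. Qed.

Lemma iL_addl l m F : aform F -> iL (l + m) F = iL l F + iL m F.
Proof. by move=> Ff; apply/funext => ls; exact: aformD. Qed.

Lemma iL_scalel f l F : aform F -> iL (f *: l) F = f *: iL l F.
Proof. by move=> Ff; apply/funext => ls; exact: aformZ. Qed.

Lemma iL_self l F : aform F -> iL l (iL l F) = 0.
Proof. by move=> Ff; apply/funext => ls; exact: aform_self. Qed.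

Lemma iL_swap l m F : aform F -> iL l (iL m F) = - iL m (iL l F).
Proof. by move=> Ff; apply/funext => ls; exact: aform_swap. Qed.

Lemma iLD l F G : iL l (F + G) = iL l F + iL l G. Proof. by []. Qed.
Lemma iLN l F : iL l (- F) = - iL l F. Proof. by []. Qed.
Section substitution.
Implicit Type phi : section L -> section L.

Lemma aform_subst_sumD phi psi F ls : aform F ->
  subst_sum 0 (fun m => phi m + psi m) F ls =
  subst_sum 0 phi F ls + subst_sum 0 psi F ls.
Proof.
elim: ls F => [|m ls IH] F Ff; first by rewrite !subst_sum0 addr0.
rewrite !subst_sum_cons aformD // (IH (iL m F)); last exact: aform_iL.
by rewrite /iL; zmod.
Qed.

Lemma aform_subst_sumZ f phi F ls : aform F ->
  subst_sum 0 (fun m => f *: phi m) F ls = f *: subst_sum 0 phi F ls.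
Proof.
elim: ls F => [|m ls IH] F Ff; first by rewrite !subst_sum0 scaler0.
rewrite !subst_sum_cons aformZ // (IH (iL m F)); last exact: aform_iL.
by rewrite scalerDr.
Qed.

Lemma subst_sumZ f phi F ls :
  subst_sum 0 phi (f *: F) ls = f *: subst_sum 0 phi F ls.
Proof. by rewrite /subst_sum scaler_sumr. Qed.

End substitution.

Definition altsum (T : section L -> W -> W) F : sL -> W := fun ls =>
  \sum_(i < size ls) (-1) ^+ i *: T (nth 0 ls i) (F (rem_at i ls)).

Lemma altsum0 T F : altsum T F [::] = 0.
Proof. exact: big_ord0. Qed.

Lemma altsum_cons T F l ls :
  altsum T F (l :: ls) = T l (F ls) - altsum T (iL l F) ls.
Proof.
rewrite /altsum big_ord_recl expr0 scale1r /rem_at /= drop0 -sumrN.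
by congr (_ + _); apply: eq_bigr => i _; rewrite exprS mulN1r scaleNr.
Qed.

(** Moving the substituted entry from the front back to position [i] passes [i] arguments and
    absorbs the sign [(-1) ^+ i]. *)
Lemma insert_sum phi F ls : aform F ->
  \sum_(i < size ls) (-1) ^+ i *: F (phi (nth 0 ls i) :: rem_at i ls) =
  subst_sum 0 phi F ls.
Proof.
elim: ls F => [|l ls IH] F Ff; first by rewrite big_ord0 subst_sum0.
rewrite subst_sum_cons -(IH (iL l F)); last exact: aform_iL.
rewrite big_ord_recl expr0 scale1r /rem_at /= drop0; congr (_ + _).
apply: eq_bigr => i _; rewrite exprS mulN1r scaleNr /iL.
by rewrite [in RHS]aform_swap // scalerN.
Qed.

End alternating_forms.

(** * The Chevalley-Eilenberg differential with coefficients *)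

Section chevalley_eilenberg.
Context {R : realType} {M : smooth_manifold R} {k : ground_field}.
Local Notation C := (smoothfun M k).
Context {L : lie_algebroid M k} {W : lmodType C}.
Local Notation sL := (seq (section L)).
Local Notation br := (@la_bracket _ _ _ L).
Implicit Types (F G : sL -> W) (l m n : section L) (f g : C) (ls : sL).

(* An [L]-connection [D] on [W], tensorial in its direction only on the
   submodule [P]. *)
Record dconn (P : W -> Prop) (D : section L -> W -> W) : Prop := DConn {
  dc_PD : forall v w, P v -> P w -> P (v + w) ;
  dc_PZ : forall f v, P v -> P (f *: v) ;
  dc_P0 : P 0 ;
  dc_P : forall l v, P v -> P (D l v) ;
  dc_D : forall l v w, D l (v + w) = D l v + D l w ;
  dc_leibniz : forall l f v, D l (f *: v) = f *: D l v + rho l f *: v ;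
  dc_addl : forall l m v, P v -> D (l + m) v = D l v + D m v ;
  dc_scalel : forall f l v, P v -> D (f *: l) v = f *: D l v }.

Context {P : W -> Prop} {D : section L -> W -> W} (Dc : dconn P D).

Definition brsum F : sL -> W := fun ls =>
  \sum_(j < size ls) \sum_(i < j)
    (-1) ^+ (i + j) *: F (br (nth 0 ls i) (nth 0 ls j) :: rem_at i (rem_at j ls)).

Definition ced F : sL -> W := locked (fun ls => altsum D F ls + brsum F ls).

Definition lied l F : sL -> W := locked (fun ls => D l (F ls) - subst_sum 0 (br l) F ls).

Lemma liedE l F ls : lied l F ls = D l (F ls) - subst_sum 0 (br l) F ls.
Proof. by rewrite /lied -lock. Qed.

Lemma cedE F ls : ced F ls = altsum D F ls + brsum F ls.
Proof. by rewrite /ced -lock. Qed.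

Lemma ced0E F : ced F [::] = 0.
Proof. by rewrite cedE altsum0 /brsum big_ord0 addr0. Qed.

Lemma lied0E l F : lied l F [::] = D l (F [::]).
Proof. by rewrite liedE subst_sum0 subr0. Qed.

Lemma brsum_cons F l ls : aform F ->
  brsum F (l :: ls) = - subst_sum 0 (br l) F ls - brsum (iL l F) ls.
Proof.
move=> Ff; rewrite -insert_sum // /brsum /= big_ord_recl big_ord0 add0r.
rewrite -!sumrN -big_split /=; apply: eq_bigr => j _.
(* The pair containing [l] is split off. In the other pairs both indices shift, which preserves the
   sign, and moving the bracket behind [l] reverses it. *)
rewrite big_ord_recl /= add0n exprS mulN1r scaleNr /rem_at /= drop0.
congr (_ + _); rewrite -sumrN; apply: eq_bigr => i _.
rewrite /bump /= !add1n addnS addSn !exprS !mulN1r opprK /iL.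
by rewrite [in RHS]aform_swap // scalerN opprK.
Qed.

(** Cartan's formula. Together with [ced0E] it determines [ced] recursively, so that identities for
    [ced] can be proved by induction on the arguments. *)
Lemma iL_ced l F : aform F -> iL l (ced F) = lied l F - ced (iL l F).
Proof.
move=> Ff; apply/funext => ls; rewrite addfE oppfE /iL !cedE liedE.
by rewrite altsum_cons brsum_cons //; rewrite /iL; zmod.
Qed.

Lemma iL_lied l m F : iL m (lied l F) = lied l (iL m F) - iL (br l m) F.
Proof.
by apply/funext => ls; rewrite addfE oppfE /iL !liedE subst_sum_cons; zmod.
Qed.

Lemma dc_0 l : D l 0 = 0.
Proof. by apply: addr_idem0; rewrite -(dc_D Dc) addr0. Qed.

Lemma liedD l F G : lied l (F + G) = lied l F + lied l G.
Proof.
by apply/funext => ls; rewrite addfE !liedE subst_sumD !addfE (dc_D Dc); zmod.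
Qed.

Lemma lied_leibniz l f F : lied l (f *: F) = f *: lied l F + rho l f *: F.
Proof.
apply/funext => ls; rewrite addfE !scalefE !liedE subst_sumZ scalefE.
by rewrite (dc_leibniz Dc) scalerBr; zmod.
Qed.

Lemma lied0 l : lied l 0 = 0.
Proof. by apply: addr_idem0; rewrite -liedD addr0. Qed.

Lemma liedN l F : lied l (- F) = - lied l F.
Proof. by apply: (addIr (lied l F)); rewrite -liedD !addNr lied0. Qed.

Lemma brsumD F G ls : brsum (F + G) ls = brsum F ls + brsum G ls.
Proof.
rewrite -big_split; apply: eq_bigr => j _; rewrite -big_split; apply: eq_bigr => i _.
by rewrite /= scalerDr.
Qed.

Lemma cedD F G : ced (F + G) = ced F + ced G.
Proof.
apply/funext => ls; rewrite addfE !cedE brsumD.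
have -> : altsum D (F + G) ls = altsum D F ls + altsum D G ls.
  by rewrite -big_split; apply: eq_bigr => i _; rewrite addfE (dc_D Dc) scalerDr.
by zmod.
Qed.

Lemma ced0 : ced 0 = 0.
Proof. by apply: addr_idem0; rewrite -cedD addr0. Qed.

Lemma cedN F : ced (- F) = - ced F.
Proof. by apply: (addIr (ced F)); rewrite -cedD !addNr ced0. Qed.

Lemma cedZ f F ls : ced (f *: F) ls =
  f *: ced F ls + \sum_(i < size ls) (-1) ^+ i *: (rho (nth 0 ls i) f *: F (rem_at i ls)).
Proof.
rewrite !cedE scalerDr addrAC; congr (_ + _).
  rewrite /altsum scaler_sumr -big_split; apply: eq_bigr => i _ /=.
  by rewrite scalefE (dc_leibniz Dc) scalerDr !scalerA [f * _]mulrC.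
rewrite /brsum scaler_sumr; apply: eq_bigr => j _; rewrite scaler_sumr.
by apply: eq_bigr => i _; rewrite scalefE !scalerA [f * _]mulrC.
Qed.

Definition valued F := forall ls, P (F ls).

Lemma ced_valued F : valued F -> valued (ced F).
Proof.
move=> Fv ls; rewrite cedE; apply: (dc_PD Dc).
  apply: big_ind => [||i _]; [exact: dc_P0 Dc|exact: dc_PD Dc|].
  by apply: (dc_PZ Dc); apply: (dc_P Dc).
apply: big_ind => [||j _]; [exact: dc_P0 Dc|exact: dc_PD Dc|].
apply: big_ind => [||i _]; [exact: dc_P0 Dc|exact: dc_PD Dc|].
exact: (dc_PZ Dc).
Qed.

Lemma iL_valued l F : valued F -> valued (iL l F).
Proof. by move=> Fv ls; exact: Fv. Qed.

Lemma aform_lied l F : aform F -> aform (lied l F).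
Proof.
move=> Ff; apply: aformP => n; elim: n F Ff => [//|n IH] F Ff; split.
- move=> f m m' ls; rewrite -![lied l F (_ :: _)]/(iL _ (lied l F) ls) !iL_lied.
  rewrite br_addr la_leibniz !iL_addl // !iL_scalel // liedD lied_leibniz.
  by rewrite !(addfE, oppfE, scalefE) [in RHS]scalerBr; zmod.
- move=> m ls; rewrite -[lied l F _]/(iL m (iL m (lied l F)) ls).
  rewrite iL_lied iLD iLN iL_lied iL_self // lied0 (iL_swap m _ Ff).
  by rewrite sub0r opprK addNr.
- move=> m; rewrite iL_lied; apply: aform_uptoD; first by apply/IH/aform_iL.
  by apply: aform_uptoN; apply/aform_uptoP/aform_iL.
Qed.

(** The failure of tensoriality is the wedge product of the differential of [f] with [iL l F],
    written as a substitution. *)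
Lemma lied_scalel f l F ls : aform F -> valued F -> lied (f *: l) F ls =
  f *: lied l F ls + subst_sum 0 (fun m => rho m f *: l) F ls.
Proof.
move=> Ff Fv; rewrite !liedE (dc_scalel Dc) // scalerBr.
have -> : br (f *: l) = fun m => f *: br l m + (-1 : C) *: (rho m f *: l).
  by apply/funext => m; rewrite br_scalel scaleN1r.
rewrite aform_subst_sumD // !aform_subst_sumZ // scaleN1r.
by zmod.
Qed.

Lemma lied_addl l m F : aform F -> valued F -> lied (l + m) F = lied l F + lied m F.
Proof.
move=> Ff Fv; apply/funext => ls; rewrite addfE !liedE (dc_addl Dc) //.
have -> : br (l + m) = fun n => br l n + br m n by apply/funext => n; exact: br_addl.
by rewrite aform_subst_sumD //; zmod.
Qed.

(** In Cartan's formula the derivative of [f] enters twice, through [lied_scalel] and through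
    [cedZ], and the two contributions cancel; hence linearity over functions. *)
Lemma aform_ced F : aform F -> valued F -> aform (ced F).
Proof.
move=> Ff Fv; apply: aformP => n; elim: n F Ff Fv => [//|n IH] F Ff Fv; split.
- move=> f l l' ls; rewrite -![ced F (_ :: _)]/(iL _ (ced F) ls) !iL_ced //.
  rewrite lied_addl // iL_addl // iL_scalel // cedD.
  rewrite !(addfE, oppfE) lied_scalel // cedZ [in RHS]scalerBr.
  have -> : \sum_(i < size ls)
      (-1) ^+ i *: (rho (nth 0 ls i) f *: iL l F (rem_at i ls)) =
      subst_sum 0 (fun m => rho m f *: l) F ls.
    by rewrite -insert_sum //; apply: eq_bigr => i _; rewrite aformZ.
  by zmod.
- move=> l ls; rewrite -[ced F _]/(iL l (iL l (ced F)) ls) iL_ced // iLD iLN.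
  rewrite iL_lied iL_ced; last exact: aform_iL.
  rewrite iL_self // ced0 br_self !(addfE, oppfE) /iL aform0 //.
  by rewrite !zerofE; zmod.
- move=> l; rewrite iL_ced //; apply: aform_uptoD.
    by apply: aform_uptoP; exact: aform_lied.
  by apply: aform_uptoN; apply: IH; [exact: aform_iL|exact: iL_valued].
Qed.

Section flat.
Hypothesis Dflat : forall l m w, P w -> D l (D m w) - D m (D l w) - D (br l m) w = 0.

Lemma lied_bracket l m F : aform F -> valued F ->
  lied l (lied m F) - lied m (lied l F) - lied (br l m) F = 0.
Proof.
move=> Ff Fv; apply/funext => ls; elim: ls F Ff Fv => [|n ls IH] F Ff Fv.
  by rewrite !(addfE, oppfE) !lied0E Dflat.
rewrite -[LHS]/(iL n (lied l (lied m F) - lied m (lied l F) - lied (br l m) F) ls).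
rewrite !iLD !iLN !iL_lied !liedD !liedN ?iL_lied.
have h := IH (iL n F) (aform_iL Ff n) (iL_valued n Fv).
have J : iL (br (br l m) n) F = iL (br l (br m n)) F - iL (br m (br l n)) F.
  rewrite -[- iL _ F]scaleN1r -iL_scalel // -iL_addl //; congr (iL _ F).
  rewrite scaleN1r (la_bracket_antisym (br l m)) (la_bracket_antisym l n) br_oppr opprK.
  by have := la_jacobi l m n => /eqP; rewrite addr_eq0 => /eqP ->.
rewrite J -[RHS]h !(addfE, oppfE).
by zmod.
Qed.

Lemma lied_ced l F : aform F -> valued F -> lied l (ced F) = ced (lied l F).
Proof.
move=> Ff Fv; apply/funext => ls; elim: ls F Ff Fv => [|m ls IH] F Ff Fv.
  by rewrite lied0E !ced0E dc_0.
rewrite -[LHS]/(iL m (lied l (ced F)) ls) -[RHS]/(iL m (ced (lied l F)) ls).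
rewrite iL_lied !iL_ced //; last exact: aform_lied.
rewrite liedD liedN iL_lied cedD cedN !(addfE, oppfE).
rewrite (IH (iL m F)); [|exact: aform_iL|exact: iL_valued].
have := congr1 (fun G : sL -> W => G ls) (lied_bracket l m Ff Fv).
rewrite !(addfE, oppfE) => /eqP; rewrite -addrA addr_eq0 => /eqP ->.
by zmod.
Qed.

(** By Cartan's formula, contracting the square with [m] gives the commutator of [lied m] and [ced],
    which vanishes by flatness, plus the square applied to [iL m F]. *)
Lemma ced_ced F : aform F -> valued F -> ced (ced F) = 0.
Proof.
move=> Ff Fv; apply/funext => ls; elim: ls F Ff Fv => [|m ls IH] F Ff Fv.
  by rewrite ced0E.
rewrite -[LHS]/(iL m (ced (ced F)) ls) iL_ced; last exact: aform_ced.
rewrite iL_ced // cedD cedN !(addfE, oppfE) lied_ced //.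
rewrite (IH (iL m F)); [|exact: aform_iL|exact: iL_valued].
by rewrite !zerofE; zmod.
Qed.

End flat.

(** On a form concentrated in degree 0 the square is the curvature of [D]; this yields the necessity
    of flatness in [flatP]. *)
Lemma ced_ced2 l m F : aform F -> valued F -> (forall n ls, F (n :: ls) = 0) ->
  ced (ced F) [:: l; m] =
  D l (D m (F [::])) - D m (D l (F [::])) - D (br l m) (F [::]).
Proof.
move=> Ff Fv F0; have iL0 n : iL n F = 0 by apply/funext => ls; exact: F0.
have cF := aform_ced Ff Fv.
rewrite -[LHS]/(iL m (iL l (ced (ced F))) [::]) iL_ced // iL_ced //.
rewrite iL0 ced0 subr0 iLD iLN iL_lied !iL_ced //; last exact: aform_lied.
rewrite iL_lied !iL0 lied0 !subr0 !ced0 !subr0.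
by rewrite !(addfE, oppfE) !lied0E; zmod.
Qed.

End chevalley_eilenberg.

(** * The differential as a graded derivation *)

Section graded_product.
Context {R : realType} {M : smooth_manifold R} {k : ground_field}.
Local Notation C := (smoothfun M k).
Context {L : lie_algebroid M k} {W : lmodType C}.
Local Notation sL := (seq (section L)).
Local Notation br := (@la_bracket _ _ _ L).
Implicit Types (F G : sL -> W) (l m : section L) (f : C) (ls : sL).

(** The grading involution. It expresses the Koszul sign without assuming homogeneity, so that the
    Leibniz rule can be stated for all forms and proved by contraction. *)
Definition eps F : sL -> W := fun ls => (-1) ^+ size ls *: F ls.

Lemma iL_eps l F : iL l (eps F) = - eps (iL l F).
Proof.
by apply/funext => ls; rewrite oppfE /iL /eps /= exprS mulN1r scaleNr.
Qed.

Lemma epsK F : eps (eps F) = F.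
Proof.
by apply/funext => ls; rewrite /eps scalerA -expr2 sqrr_sign scale1r.
Qed.

Lemma eps0 F : eps F [::] = F [::].
Proof. by rewrite /eps expr0 scale1r. Qed.

Lemma epsD F G : eps (F + G) = eps F + eps G.
Proof. by apply/funext => ls; rewrite addfE /eps -scalerDr. Qed.

Lemma epsN F : eps (- F) = - eps F.
Proof. by apply/funext => ls; rewrite oppfE /eps -scalerN. Qed.

Lemma aform_eps F : aform F -> aform (eps F).
Proof.
move=> Ff; split=> [s1 s2 f l m|s1 s2 s3 l]; rewrite /eps ?size_cat /=.
  by rewrite (aform_lin Ff) scalerDr !scalerA mulrC.
by rewrite (aform_alt Ff) scaler0.
Qed.

Context {P : W -> Prop} {D : section L -> W -> W} (Dc : dconn P D).
Local Notation lied := (@lied _ _ _ L W D).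
Local Notation ced := (@ced _ _ _ L W D).

Lemma lied_eps l F : lied l (eps F) = eps (lied l F).
Proof.
apply/funext => ls; elim: ls F => [|m ls IH] F; first by rewrite eps0 !lied0E eps0.
rewrite -[LHS]/(iL m (lied l (eps F)) ls) -[RHS]/(iL m (eps (lied l F)) ls).
rewrite iL_lied !iL_eps iL_lied (liedN Dc) epsD epsN !(addfE, oppfE) IH.
by zmod.
Qed.

Lemma ced_eps F : aform F -> ced (eps F) = - eps (ced F).
Proof.
move=> Ff; apply/funext => ls; elim: ls F Ff => [|m ls IH] F Ff.
  by rewrite oppfE eps0 !ced0E oppr0.
rewrite -[LHS]/(iL m (ced (eps F)) ls) -[RHS]/(- iL m (eps (ced F)) ls).
rewrite iL_ced; last exact: aform_eps.
rewrite !iL_eps iL_ced // (cedN Dc) lied_eps epsD epsN !(addfE, oppfE).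
by rewrite (IH (iL m F)) ?oppfE; [zmod|exact: aform_iL].
Qed.

Context {mul : W -> W -> W}.
Hypothesis mulDl : forall v w z, mul (v + w) z = mul v z + mul w z.
Hypothesis mulDr : forall v w z, mul z (v + w) = mul z v + mul z w.
Hypothesis mulZl : forall f v w, mul (f *: v) w = f *: mul v w.
Hypothesis mulZr : forall f v w, mul v (f *: w) = f *: mul v w.
Hypothesis mulP : forall v w, P v -> P w -> P (mul v w).
Hypothesis mul_der : forall l v w, P v -> P w ->
  D l (mul v w) = mul (D l v) w + mul v (D l w).

Definition fmul F G : sL -> W := fun ls =>
  \sum_(u : (size ls).-tuple bool)
    (-1) ^+ shuffle_odd u *: mul (F (mask u ls)) (G (mask (map negb u) ls)).

Lemma fmul0E F G : fmul F G [::] = mul (F [::]) (G [::]).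
Proof.
rewrite /fmul (big_tuple0 (fun u => (-1) ^+ shuffle_odd u *:
  mul (F (mask u [::])) (G (mask (map negb u) [::])))) /=.
by rewrite expr0 scale1r.
Qed.

Lemma iL_fmul l F G : iL l (fmul F G) = fmul (iL l F) G + fmul (eps F) (iL l G).
Proof.
apply/funext => ls; rewrite addfE /iL {1}/fmul.
have := big_tuple_cons (size ls) xpredT (fun u => (-1) ^+ shuffle_odd u *:
  mul (F (mask u (l :: ls))) (G (mask (map negb u) (l :: ls)))).
move=> /= ->; congr (_ + _); apply: eq_bigr => u _.
rewrite /eps mulZl scalerA signr_addb signr_odd size_mask ?size_tuple //.
by rewrite [X in X *: _ = _]mulrC.
Qed.

Lemma fmulDl F F' G : fmul (F + F') G = fmul F G + fmul F' G.
Proof.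
apply/funext => ls; rewrite addfE -big_split; apply: eq_bigr => u _.
by rewrite addfE mulDl scalerDr.
Qed.

Lemma fmulDr F G G' : fmul F (G + G') = fmul F G + fmul F G'.
Proof.
apply/funext => ls; rewrite addfE -big_split; apply: eq_bigr => u _.
by rewrite addfE mulDr scalerDr.
Qed.

Lemma fmulZl f F G : fmul (f *: F) G = f *: fmul F G.
Proof.
apply/funext => ls; rewrite scalefE scaler_sumr; apply: eq_bigr => u _.
by rewrite scalefE mulZl !scalerA [f * _]mulrC.
Qed.

Lemma fmulZr f F G : fmul F (f *: G) = f *: fmul F G.
Proof.
apply/funext => ls; rewrite scalefE scaler_sumr; apply: eq_bigr => u _.
by rewrite scalefE mulZr !scalerA [f * _]mulrC.
Qed.

Lemma fmulNl F G : fmul (- F) G = - fmul F G.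
Proof. by rewrite -[- F]scaleN1r fmulZl scaleN1r. Qed.

Lemma fmulNr F G : fmul F (- G) = - fmul F G.
Proof. by rewrite -[- G]scaleN1r fmulZr scaleN1r. Qed.

Lemma fmul0l G : fmul 0 G = 0.
Proof. by apply: addr_idem0; rewrite -fmulDl addr0. Qed.

Lemma fmul0r F : fmul F 0 = 0.
Proof. by apply: addr_idem0; rewrite -fmulDr addr0. Qed.

Lemma aform_fmul F G : aform F -> aform G -> aform (fmul F G).
Proof.
move=> Ff Gf; apply: aformP => n; elim: n F G Ff Gf => [//|n IH] F G Ff Gf; split.
- move=> f l m ls; rewrite -![fmul F G (_ :: _)]/(iL _ (fmul F G) ls) !iL_fmul.
  rewrite !iL_addl // !iL_scalel // fmulDl fmulDr fmulZl fmulZr.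
  by rewrite !(addfE, scalefE) scalerDr; zmod.
- move=> l ls; rewrite -[fmul F G _]/(iL l (iL l (fmul F G)) ls).
  rewrite iL_fmul iLD !iL_fmul iL_eps !iL_self // fmul0l fmul0r fmulNl.
  by rewrite !(addfE, oppfE, zerofE); zmod.
- move=> l; rewrite iL_fmul; apply: aform_uptoD; apply: IH => //.
  + exact: aform_iL.
  + exact: aform_eps.
  + exact: aform_iL.
Qed.

Lemma eps_valued F : valued (P := P) F -> valued (P := P) (eps F).
Proof. by move=> Fv ls; exact: (dc_PZ Dc). Qed.

Lemma lied_fmul l F G : aform F -> aform G -> valued (P := P) F -> valued (P := P) G ->
  lied l (fmul F G) = fmul (lied l F) G + fmul F (lied l G).
Proof.
move=> Ff Gf Fv Gv; apply/funext => ls.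
elim: ls F G Ff Gf Fv Gv => [|m ls IH] F G Ff Gf Fv Gv.
  by rewrite addfE lied0E !fmul0E !lied0E mul_der.
rewrite -[LHS]/(iL m (lied l (fmul F G)) ls).
rewrite -[RHS]/(iL m (fmul (lied l F) G + fmul F (lied l G)) ls).
rewrite iLD iL_lied !iL_fmul !iL_lied (liedD Dc) !(addfE, oppfE).
have iFf := aform_iL Ff m; have iGf := aform_iL Gf m.
have eFf := aform_eps Ff; have eFv := eps_valued Fv.
rewrite !IH //; try exact: iL_valued.
rewrite lied_eps !fmulDl !fmulDr !fmulNl !fmulNr !(addfE, oppfE).
by zmod.
Qed.

Lemma ced_fmul F G : aform F -> aform G -> valued (P := P) F -> valued (P := P) G ->
  ced (fmul F G) = fmul (ced F) G + fmul (eps F) (ced G).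
Proof.
move=> Ff Gf Fv Gv; apply/funext => ls.
elim: ls F G Ff Gf Fv Gv => [|m ls IH] F G Ff Gf Fv Gv.
  rewrite addfE ced0E !fmul0E !ced0E -(scale0r (0 : W)) mulZl mulZr.
  by rewrite !scale0r addr0.
rewrite -[LHS]/(iL m (ced (fmul F G)) ls).
rewrite -[RHS]/(iL m (fmul (ced F) G + fmul (eps F) (ced G)) ls).
rewrite iLD iL_ced; last exact: aform_fmul.
rewrite !iL_fmul !iL_ced // (cedD Dc) lied_fmul // epsK iL_eps.
have iFf := aform_iL Ff m; have iGf := aform_iL Gf m.
have eFf := aform_eps Ff; have eFv := eps_valued Fv.
rewrite !(addfE, oppfE) !IH //; try exact: iL_valued.
rewrite ced_eps // epsK !fmulDl !fmulDr !fmulNl !fmulNr !(addfE, oppfE).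
by zmod.
Qed.

End graded_product.

(** * Derivations of the product of symmetric forms *)

Section symmetric_product.
Context {R : realType} {M : smooth_manifold R} {k : ground_field}.
Local Notation C := (smoothfun M k).
Context {L : lie_algebroid M k} {B : vbundle M k} (nabla : connection L B).
Local Notation sB := (seq (section B)).
Local Notation drho := (ndual nabla (V := C^o) (@rho _ _ _ L)).
Implicit Types (s t : sB -> C^o) (l : section L) (b : section B) (f : C).

Definition smul s t : sB -> C^o := fun bs => masksum bs (fun m n => s m * t n : C^o).

Lemma iS_smul b s t : iS b (smul s t) = smul (iS b s) t + smul s (iS b t).
Proof. by apply/funext => bs; rewrite addfE /smul /iS masksum_cons. Qed.

Lemma smul0E s t : smul s t [::] = s [::] * t [::].
Proof. by rewrite /smul masksum0. Qed.

Lemma smulDl s s' t : smul (s + s') t = smul s t + smul s' t.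
Proof.
apply/funext => bs; rewrite addfE -masksumD; apply: eq_masksum => m n _.
exact: mulrDl.
Qed.

Lemma smulDr s s' t : smul t (s + s') = smul t s + smul t s'.
Proof.
apply/funext => bs; rewrite addfE -masksumD; apply: eq_masksum => m n _.
exact: mulrDr.
Qed.

Lemma smulZl f s t : smul (f *: s) t = f *: smul s t.
Proof.
apply/funext => bs; rewrite scalefE /smul /masksum scaler_sumr; apply: eq_bigr => m _.
by rewrite scalefE; exact: esym (mulrA (f : C) _ _).
Qed.

Lemma smulZr f s t : smul s (f *: t) = f *: smul s t.
Proof.
apply/funext => bs; rewrite scalefE /smul /masksum scaler_sumr; apply: eq_bigr => m _.
by rewrite scalefE; exact: (mulrCA (_ : C)).
Qed.

Lemma smulNl s t : smul (- s) t = - smul s t.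
Proof. by rewrite -[- s]scaleN1r smulZl scaleN1r. Qed.

Lemma smulNr s t : smul s (- t) = - smul s t.
Proof. by rewrite -[- t]scaleN1r smulZr scaleN1r. Qed.

Lemma sform_smul s t : sform s -> sform t -> sform (smul s t).
Proof.
move=> sf tf; apply: sformP => n; elim: n s t sf tf => [//|n IH] s t sf tf; split.
- move=> f b c bs; rewrite -![smul s t (_ :: _)]/(iS _ (smul s t) bs) !iS_smul.
  rewrite !iS_addl // !iS_scalel // smulDl smulDr smulZl smulZr.
  by rewrite !(addfE, scalefE) scalerDr; zmod.
- move=> b c bs.
  have e b' c' : smul s t [:: b', c' & bs] = iS c' (iS b' (smul s t)) bs by [].
  rewrite !e !iS_smul !iSD !iS_smul !addfE.
  by rewrite (iS_swap b c sf) (iS_swap b c tf); zmod.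
- by move=> b; rewrite iS_smul; apply: sform_uptoD; apply: IH.
Qed.
Hint Resolve sform_smul : sforms.

Lemma ndual_smul l s t : sform s -> sform t ->
  drho l (smul s t) = smul (drho l s) t + smul s (drho l t).
Proof.
move=> sf tf; have Rc := @vconn_rho _ _ _ L.
apply/funext => bs; elim: bs s t sf tf => [|b bs IH] s t sf tf.
  by rewrite addfE ndual0E !smul0E !ndual0E; exact: rhoM.
rewrite -[LHS]/(iS b (drho l (smul s t)) bs).
rewrite -[RHS]/(iS b (smul (drho l s) t + smul s (drho l t)) bs).
rewrite iSD iS_ndual !iS_smul !iS_ndual (ndualD _ Rc) !(smulDl, smulDr, smulNl, smulNr).
by rewrite !(addfE, oppfE) !IH // !(addfE, oppfE); zmod.
Qed.

Lemma vact_smul (Y : sB -> section B) s t : sform s -> sform t ->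
  vact Y (smul s t) = smul (vact Y s) t + smul s (vact Y t).
Proof.
move=> sf tf; apply/funext => bs; elim: bs Y s t sf tf => [|b bs IH] Y s t sf tf.
  rewrite addfE vact0E !smul0E !vact0E -[LHS]/(iS _ (smul s t) [::]).
  by rewrite iS_smul addfE !smul0E.
rewrite -[LHS]/(iS b (vact Y (smul s t)) bs).
rewrite -[RHS]/(iS b (smul (vact Y s) t + smul s (vact Y t)) bs).
rewrite iSD iS_vact // !iS_smul !iS_vact // vactDr !(smulDl, smulDr).
by rewrite !(addfE, oppfE) !IH // !(addfE, oppfE); zmod.
Qed.

Variable Y : section L -> sB -> section B.
Hypothesis Yf : vfield1 Y.
Hint Resolve Yf vf_form : sforms.

Lemma ncov_smul l s t : sform s -> sform t ->
  ncov nabla Y l (smul s t) = smul (ncov nabla Y l s) t + smul s (ncov nabla Y l t).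
Proof.
move=> sf tf; rewrite /ncov ndual_smul // vact_smul // smulDl smulDr.
by zmod.
Qed.

Lemma dconn_ncov : dconn (W := sB -> C^o) (@sform _ _ _ _ C^o) (ncov nabla Y).
Proof.
split.
- by move=> v w; exact: sform_D.
- by move=> f v; exact: sform_Z.
- exact: sform_0.
- by move=> l v; exact: sform_ncov.
- exact: ncovD.
- exact: ncov_leibniz.
- by move=> l m v; exact: ncov_addl.
- by move=> f l v; exact: ncov_scalel.
Qed.

End symmetric_product.

#[local] Hint Resolve vf_form sform_smul : sforms.

Section bundle_map_sections.
Context {R : realType} {M : smooth_manifold R} {k : ground_field}.
Local Notation C := (smoothfun M k).
Context {E F : vbundle M k} (phi : bundle_map E F).

Lemma bm_sec_add (s t : section E) : bm_sec phi (s + t) = bm_sec phi s + bm_sec phi t.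
Proof. by apply: section_eq => x /=; rewrite linearD. Qed.

Lemma bm_sec_scale (f : C) (s : section E) : bm_sec phi (f *: s) = f *: bm_sec phi s.
Proof. by apply: section_eq => x /=; rewrite linearZ. Qed.

Lemma bm_sec0 : bm_sec phi 0 = 0.
Proof. by apply: addr_idem0; rewrite -bm_sec_add addr0. Qed.

End bundle_map_sections.

(** * The operator [Q] as a Chevalley-Eilenberg differential *)

Section forms.
Context {R : realType} {M : smooth_manifold R} {k : ground_field}.
Local Notation C := (smoothfun M k).

(** Currying: a form in both kinds of arguments is an alternating form whose values are symmetric
    forms, so the two calculi above apply one at a time. *)
Lemma is_formP (L B : vbundle M k) (V : lmodType C) (F : cochain L B V) :
  is_form F <->
  aform (W := seq (section B) -> V) F /\ forall ls, sform (F ls).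
Proof.
split=> [[h1 h2 h3 h4]|[[h1 h3] h]].
  split=> [|ls]; split.
  - by move=> *; apply/funext => bs; exact: h1.
  - by move=> *; apply/funext => bs; exact: h3.
  - exact: h2.
  - exact: h4.
split.
- by move=> s1 s2 bs f l l'; rewrite h1.
- by move=> ls; exact: (sform_lin (h ls)).
- by move=> s1 s2 s3 bs l; rewrite h3.
- by move=> ls; exact: (sform_sym (h ls)).
Qed.

Lemma is_form_aform (L B : vbundle M k) (V : lmodType C) (F : cochain L B V) :
  is_form F -> aform (W := seq (section B) -> V) F.
Proof. by case/is_formP. Qed.

Lemma is_form_sform (L B : vbundle M k) (V : lmodType C) (F : cochain L B V) ls :
  is_form F -> sform (F ls).
Proof. by case/is_formP. Qed.

Lemma form_mulE (L : lie_algebroid M k) (B : vbundle M k) (F G : cochain L B C^o) :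
  form_mul F G = fmul (W := seq (section B) -> C^o) (mul := @smul _ _ _ B) F G.
Proof.
apply/funext => ls; apply/funext => bs; rewrite /fmul fct_sumE.
apply: eq_bigr => m _; rewrite scalefE /smul /masksum scaler_sumr.
by [].
Qed.

Context {A L : lie_algebroid M k} {B : vbundle M k} (P : lie_pair A L B).
Context (nabla : connection L B).
Local Notation sL := (seq (section L)).
Local Notation sB := (seq (section B)).
Local Notation q := (bm_sec (lp_q P)).

Section Q.
Variable X : cochain L B (section B).
Hypothesis Xf : is_form X.

(* [- delta] is the action of [- q]. *)
Definition shift_field : section L -> sB -> section B :=
  fun l => X [:: l] - cstv (q l).

Lemma vfield1_form : vfield1 (fun l => X [:: l]).
Proof.
have Xa := is_form_aform Xf; split.
- by move=> l m; exact: aformD.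
- by move=> f l; exact: aformZ.
- by move=> l; exact: is_form_sform.
Qed.

Lemma vfield1_shift : vfield1 shift_field.
Proof.
have [Xa Xs Xsf] := vfield1_form; split; rewrite /shift_field.
- move=> l m; rewrite Xa bm_sec_add.
  have -> : (cstv (q l + q m) : sB -> section B) = cstv (q l) + cstv (q m).
    by apply/funext => -[|b bs] //; rewrite addfE /= addr0.
  by zmod.
- move=> f l; rewrite Xs bm_sec_scale scalerBr.
  have -> // : (cstv (f *: q l) : sB -> section B) = f *: cstv (q l).
  by apply/funext => -[|b bs] //; rewrite scalefE /= scaler0.
- by move=> l; apply: sform_D; auto; apply: sform_N; auto.
Qed.

Local Notation dX := (@ced _ _ _ L (sB -> C^o) (ncov nabla shift_field)).

Lemma Q_nablaE F : is_form F -> Q_nabla P nabla X F = dX F.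
Proof.
move=> Ff; have Fs ls := is_form_sform ls Ff.
apply/funext => ls; apply/funext => bs; rewrite cedE addfE.
rewrite /Q_nabla /d_nabla addrAC addrA; congr (_ + _); last first.
  rewrite /brsum fct_sumE; apply: eq_bigr => j _; rewrite fct_sumE.
  by apply: eq_bigr => i _.
rewrite /altsum fct_sumE /delta /vertical_act -sumrN -!big_split /=.
apply: eq_bigr => i _; rewrite scalefE /ncov addfE.
rewrite (vactDl _ _ (Fs _)) (vactNl _ (Fs _)) (vact_cstv _ (Fs _)).
rewrite !(addfE, oppfE) !scalerDr scalerN ndualE.
by rewrite [RHS]addrC; congr (_ + _); rewrite [RHS]addrC.
Qed.

Lemma is_form_ced F : is_form F -> is_form (dX F : cochain L B C^o).
Proof.
have Dc := dconn_ncov nabla vfield1_shift.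
case/is_formP => Fa Fs; apply/is_formP; split; first exact: (aform_ced Dc).
exact: (ced_valued Dc).
Qed.

Lemma is_form_Q F : is_form F -> is_form (Q_nabla P nabla X F).
Proof. by move=> Ff; rewrite Q_nablaE //; exact: is_form_ced. Qed.

Lemma size_rem_at T (i : nat) (s : seq T) : (i < size s)%N ->
  size (rem_at i s) = (size s).-1.
Proof.
move=> si; rewrite /rem_at size_cat size_takel ?size_drop; last exact: ltnW.
by rewrite -[in RHS](subnKC si).
Qed.

Lemma L_degree_ced d F : L_degree d F -> L_degree d.+1 (dX F : cochain L B C^o).
Proof.
move=> Fd ls bs lsd.
have F0 ls' : size ls' != d -> F ls' = 0 by move=> h; apply/funext => b; exact: Fd.
(* The empty list is separate, since its truncated predecessor length [0] may equal [d]. *)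
have szd : (size ls).-1 != d \/ ls = [::].
  by case: ls lsd => [|l ls]; [right|left].
case: szd => [h|->]; last by rewrite ced0E.
rewrite cedE addfE /altsum /brsum big1; last first.
  move=> i _; rewrite F0 ?size_rem_at // ncov0.
  by rewrite scaler0.
rewrite big1 ?addr0 // => j _; rewrite big1 // => i _.
have sj := ltn_ord j; have ij := ltn_ord i.
have i1 : (i < (size ls).-1)%N by apply: leq_trans ij _; rewrite -ltnS (ltn_predK sj).
by rewrite F0 ?scaler0 //= !size_rem_at // (ltn_predK i1).
Qed.

Lemma dg_manifold_Q :
  (forall F : cochain L B C^o, is_form F -> forall ls bs,
     Q_nabla P nabla X (Q_nabla P nabla X F) ls bs = 0) ->
  dg_manifold (Q_nabla P nabla X).
Proof.
move=> sq; have Dc := dconn_ncov nabla vfield1_shift.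
split=> //.
- exact: is_form_Q.
- move=> c F G Ff Gf ls bs.
  have [[Fa Fs] [Ga Gs]] := ((is_formP _).1 Ff, (is_formP _).1 Gf).
  pose H : sL -> (sB -> C^o) := (smooth_cst M c *: (F : sL -> (sB -> C^o))) + G.
  have Hf : is_form (H : cochain L B C^o).
    apply/is_formP; split; first by apply: aform_D => //; exact: aform_Z.
    by move=> ls'; apply: sform_D => //; exact: sform_Z.
  rewrite -[LHS]/(Q_nabla P nabla X H ls bs) !Q_nablaE // (cedD Dc) addfE (cedZ Dc).
  (* The anchor kills constants, so the correction terms of [cedZ] vanish for a constant scalar. *)
  rewrite big1 ?addr0 // => i _.
  by rewrite rho_cst scale0r scaler0.
- by move=> d F Ff Fd; rewrite Q_nablaE //; exact: L_degree_ced.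
- move=> d F G Ff Gf Fd ls bs.
  have [[Fa Fs] [Ga Gs]] := ((is_formP _).1 Ff, (is_formP _).1 Gf).
  have FGf : is_form (form_mul F G).
    apply/is_formP; rewrite form_mulE; split.
      apply: aform_fmul => //.
      - exact: smulDl.
      - exact: smulDr.
      - exact: smulZl.
      - exact: smulZr.
    move=> ls'; apply: sform_sum => m _; apply: sform_Z.
    by apply: sform_smul; [exact: Fs|exact: Gs].
  rewrite !Q_nablaE // !form_mulE (ced_fmul Dc) //; last first.
  + by move=> l v w; exact: ncov_smul.
  + exact: smulZr.
  + exact: smulZl.
  + exact: smulDr.
  + exact: smulDl.
  rewrite !addfE; congr (_ + _).
  have -> : eps (W := sB -> C^o) F = ((-1) ^+ d : C) *: (F : sL -> (sB -> C^o)).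
    apply/funext => ls'; rewrite /eps scalefE; have [-> //|n] := eqVneq (size ls') d.
    have -> : F ls' = 0 by apply/funext => b; exact: Fd.
    by rewrite !scaler0.
  rewrite fmulZl //; exact: smulZl.
Qed.

End Q.

End forms.

(** * The homotopy operator *)

Section rem_at_lemmas.
Context {T : Type}.
Implicit Types (s : seq T).

Lemma rem_at0 x s : rem_at 0 (x :: s) = s.
Proof. by rewrite /rem_at /= drop0. Qed.

Lemma rem_atS i x s : rem_at i.+1 (x :: s) = x :: rem_at i s.
Proof. by []. Qed.

Lemma map_rem_at T' (f : T -> T') i s : map f (rem_at i s) = rem_at i (map f s).
Proof. by rewrite /rem_at map_cat map_take map_drop. Qed.

Lemma count_rem_at (p : pred T) x0 i s : (i < size s)%N ->
  (p (nth x0 s i) + count p (rem_at i s))%N = count p s.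
Proof.
elim: s i => [//|x s IH] [|i] si; first by rewrite rem_at0.
by rewrite rem_atS /= addnCA (IH i).
Qed.

End rem_at_lemmas.

Lemma perm_rem_at (T : eqType) x0 i (s : seq T) : (i < size s)%N ->
  perm_eq (nth x0 s i :: rem_at i s) s.
Proof.
move=> si; rewrite -[X in perm_eq _ X](cat_take_drop i) (drop_nth x0 si) /rem_at.
by rewrite -cat1s -[_ :: drop _ _]cat1s perm_catCA.
Qed.

Section smooth_constants.
Context {R : realType} {M : smooth_manifold R} {k : ground_field}.
Local Notation C := (smoothfun M k).

Lemma smooth_cstMn (c : Defs.scalar R k) n :
  smooth_cst M c *+ n = smooth_cst M (c *+ n).
Proof.
elim: n => [|n IH]; first by rewrite !mulr0n; apply/val_inj/funext.
by rewrite !mulrS IH; apply/val_inj/funext.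
Qed.

Lemma smooth_cstV_Mn (V : lmodType C) n (v : V) : (0 < n)%N ->
  smooth_cst M (n%:R^-1 : Defs.scalar R k) *: (v *+ n) = v.
Proof.
move=> n0; rewrite -scalerMnr scalerMnl smooth_cstMn.
have -> : n%:R^-1 *+ n = 1 :> Defs.scalar R k.
  by rewrite -[LHS]mulr_natr mulVf // scalar_natr_eq0 -lt0n.
have -> : smooth_cst M 1 = 1 :> C by apply/val_inj/funext.
by rewrite scale1r.
Qed.

End smooth_constants.

Section homotopy_operator.
Context {R : realType} {M : smooth_manifold R} {k : ground_field}.
Local Notation C := (smoothfun M k).
Context {A L : lie_algebroid M k} {B : vbundle M k} {P : lie_pair A L B}.
Context (S : splitting P).
Local Notation sL := (seq (section L)).
Local Notation sB := (seq (section B)).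
Local Notation q := (bm_sec (lp_q P)).
Local Notation j := (bm_sec (sp_j S)).
Local Notation pA := (proj_A S).
Local Notation pB := (proj_B S).

Lemma qj b : q (j b) = b.
Proof. by apply: section_eq => x /=; exact: sp_qj. Qed.

Lemma proj_AB l : pA l + pB l = l.
Proof. by apply: section_eq => x /=; exact: sp_ipjq. Qed.

Lemma q_projA l : q (pA l) = 0.
Proof.
apply: section_eq => x /=; apply/(lp_exact P).
by exists (sp_p S x (l x)).
Qed.

Lemma projB_j b : pB (j b) = j b.
Proof. by rewrite /proj_B qj. Qed.

Lemma projB_B l : pB (pB l) = pB l.
Proof. by rewrite {2}/proj_B projB_j. Qed.

Lemma projA_B l : pA (pB l) = 0.
Proof. by apply: (addIr (pB (pB l))); rewrite proj_AB projB_B add0r. Qed.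

Lemma projB_A l : pB (pA l) = 0.
Proof. by rewrite /proj_B q_projA bm_sec0. Qed.

Lemma projA_A l : pA (pA l) = pA l.
Proof. by have := proj_AB (pA l); rewrite projB_A addr0. Qed.

Section values.
Context {V : lmodType C}.
Local Notation W := (sB -> V).
Implicit Types (F G : sL -> W).

Definition iSF b F : sL -> W := fun ls => iS b (F ls).

(* The operator [h] without its weights, and [delta]. *)
Definition koszul_h F : sL -> W := fun ls bs =>
  \sum_(i < size bs) F (j (nth 0 bs i) :: ls) (rem_at i bs).

Definition koszul_d F : sL -> W := altsum (fun l => iS (q l)) F.

Lemma kap0E F ls : koszul_h F ls [::] = 0.
Proof. exact: big_ord0. Qed.

Lemma kap_cons F ls b bs :
  koszul_h F ls (b :: bs) = F (j b :: ls) bs + koszul_h (iSF b F) ls bs.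
Proof. by rewrite /koszul_h big_ord_recl /= rem_at0; congr (_ + _). Qed.

Lemma iSF_kap b F : iSF b (koszul_h F) = iL (j b) F + koszul_h (iSF b F).
Proof. by apply/funext => ls; apply/funext => bs; exact: kap_cons. Qed.

Lemma kapD F G : koszul_h (F + G) = koszul_h F + koszul_h G.
Proof. by apply/funext => ls; apply/funext => bs; exact: big_split. Qed.

Lemma kapN F : koszul_h (- F) = - koszul_h F.
Proof. by apply/funext => ls; apply/funext => bs; rewrite !oppfE /koszul_h -sumrN. Qed.

Lemma iL_kap l F : aform F -> iL l (koszul_h F) = - koszul_h (iL l F).
Proof.
move=> Ff; apply/funext => ls; apply/funext => bs; rewrite !oppfE /iL /koszul_h -sumrN.
by apply: eq_bigr => i _; rewrite aform_swap.
Qed.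

Lemma iL_del l F : iL l (koszul_d F) = iSF (q l) F - koszul_d (iL l F).
Proof. by apply/funext => ls; rewrite /koszul_d /iL altsum_cons. Qed.

Lemma delD F G : koszul_d (F + G) = koszul_d F + koszul_d G.
Proof.
apply/funext => ls; rewrite addfE -big_split; apply: eq_bigr => i _.
by rewrite /= -scalerDr.
Qed.

Lemma delZ f F : koszul_d (f *: F) = f *: koszul_d F.
Proof.
apply/funext => ls; rewrite scalefE scaler_sumr; apply: eq_bigr => i _.
by rewrite scalefE iSZ !scalerA mulrC.
Qed.

Lemma delN F : koszul_d (- F) = - koszul_d F.
Proof. by rewrite -[- F]scaleN1r delZ scaleN1r. Qed.

Lemma del0E F : koszul_d F [::] = 0.
Proof. exact: altsum0. Qed.

Definition svalued F := forall ls, sform (F ls).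

Lemma svalued_iSF b F : svalued F -> svalued (iSF b F).
Proof. by move=> Fs ls; exact: sform_iS. Qed.

Lemma svalued_iL l F : svalued F -> svalued (iL l F).
Proof. by move=> Fs ls; exact: Fs. Qed.

Lemma aform_iSF b F : aform F -> aform (iSF b F).
Proof.
move=> Ff; split=> [s1 s2 f l m|s1 s2 s3 l]; rewrite /iSF.
  by rewrite (aform_lin Ff).
by rewrite (aform_alt Ff).
Qed.

Lemma iSF_addl b c F : svalued F -> iSF (b + c) F = iSF b F + iSF c F.
Proof. by move=> Fs; apply/funext => ls; exact: iS_addl. Qed.

Lemma iSF_scalel f b F : svalued F -> iSF (f *: b) F = f *: iSF b F.
Proof. by move=> Fs; apply/funext => ls; exact: iS_scalel. Qed.

Lemma aform_del F : aform F -> svalued F -> aform (koszul_d F).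
Proof.
move=> Ff Fs; apply: aformP => n; elim: n F Ff Fs => [//|n IH] F Ff Fs; split.
- move=> f l m ls; rewrite -![koszul_d F (_ :: _)]/(iL _ (koszul_d F) ls) !iL_del.
  rewrite bm_sec_add bm_sec_scale iSF_addl // iSF_scalel // iL_addl // iL_scalel //.
  by rewrite delD delZ !(addfE, oppfE, scalefE) [in RHS]scalerBr; zmod.
- move=> l ls; rewrite -[koszul_d F _]/(iL l (iL l (koszul_d F)) ls) iL_del iLD iLN iL_del.
  rewrite iL_self // -(scale0r (0 : sL -> W)) delZ scale0r subr0.
  by rewrite addrC addNr.
- move=> l; rewrite iL_del; apply: aform_uptoD.
    by apply/aform_uptoP/aform_iSF.
  by apply/aform_uptoN/IH; [exact: aform_iL|exact: svalued_iL].
Qed.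

Lemma svalued_del F : svalued F -> svalued (koszul_d F).
Proof.
move=> Fs ls; apply: sform_sum => i _; apply: sform_Z; apply: sform_iS; exact: Fs.
Qed.

Lemma aform_kap F : aform F -> aform (koszul_h F).
Proof.
move=> Ff; split=> [s1 s2 f l m|s1 s2 s3 l]; apply/funext => bs.
  rewrite addfE scalefE /koszul_h scaler_sumr -big_split; apply: eq_bigr => i _.
  by have := congr1 (fun s : W => s (rem_at i bs))
    (aform_lin Ff (j (nth 0 bs i) :: s1) s2 f l m).
rewrite /koszul_h big1 // => i _.
by have := congr1 (fun s : W => s (rem_at i bs))
  (aform_alt Ff (j (nth 0 bs i) :: s1) s2 s3 l).
Qed.

Lemma svalued_kap F : aform F -> svalued F -> svalued (koszul_h F).
Proof.
move=> Ff Fs ls; apply: sformP => n; elim: n F Ff Fs => [//|n IH] F Ff Fs.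
have iSk b G : iS b (koszul_h G ls) = G (j b :: ls) + koszul_h (iSF b G) ls.
  by apply/funext => bs; exact: kap_cons.
split.
- move=> f b c bs; rewrite !kap_cons bm_sec_add bm_sec_scale (aform_lin Ff [::]).
  rewrite iSF_addl // iSF_scalel // kapD !(addfE, scalefE).
  have -> : koszul_h (f *: iSF b F) ls bs = f *: koszul_h (iSF b F) ls bs.
    by rewrite /koszul_h scaler_sumr.
  by rewrite scalerDr; zmod.
- move=> b c bs; rewrite !kap_cons.
  have -> : iSF c (iSF b F) = iSF b (iSF c F).
    by apply/funext => ls'; exact: iS_swap.
  by rewrite /iSF /iS; zmod.
- move=> b; rewrite iSk; apply: sform_uptoD; first by apply: sform_uptoP; exact: Fs.
  by apply: IH; [exact: aform_iSF|exact: svalued_iSF].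
Qed.

(** Two symmetric arguments are moved into alternating slots, so the contributions of the two orders
    cancel. *)
Lemma kap_kap F : aform F -> koszul_h (koszul_h F) = 0.
Proof.
move=> Ff; apply/funext => ls; apply/funext => bs.
elim: bs F Ff => [|b bs IH] F Ff; first by rewrite kap0E.
rewrite kap_cons iSF_kap kapD addfE addfE (IH (iSF b F)); last exact: aform_iSF.
rewrite -[koszul_h F _]/(iL (j b) (koszul_h F) ls) iL_kap // !oppfE.
by rewrite !zerofE; zmod.
Qed.

(* A list of homogeneous arguments: [true] marks those in the image of [j],
   [false] those in the image of [i]. *)
Definition pure_list (ts : seq (bool * section L)) : sL :=
  [seq (if x.1 then pB x.2 else pA x.2) | x <- ts].

Local Notation weight ts := (count (@fst bool (section L)) ts).

(** By multilinearity and [l = pA l + pB l], identities of forms may be checked on homogeneous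
    arguments, where the weights are scalars. *)
Lemma pure_vanish F bs : aform F -> (forall ts, F (pure_list ts) bs = 0) ->
  forall ls, F ls bs = 0.
Proof.
move=> Ff h ls; elim: ls F Ff h => [|l ls IH] F Ff h; first exact: (h [::]).
rewrite -{1}(proj_AB l) aformD // addfE.
rewrite -[F (pA l :: ls)]/(iL (pA l) F ls) -[F (pB l :: ls)]/(iL (pB l) F ls).
rewrite !IH ?addr0 //; try exact: aform_iL.
  by move=> ts; exact: (h ((true, l) :: ts)).
by move=> ts; exact: (h ((false, l) :: ts)).
Qed.

(** Contracting with a homogeneous [x] leaves the extra term [iL (j (q x)) F], which is [iL x F] on
    the image of [j] and [0] on the image of [i]. With no arguments in [L] left, each symmetric
    argument contributes one copy of [F]. *)
Lemma euler_pure F ts bs : aform F -> svalued F ->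
  koszul_h (koszul_d F) (pure_list ts) bs +
  koszul_d (koszul_h F) (pure_list ts) bs =
  F (pure_list ts) bs *+ (weight ts + size bs).
Proof.
elim: ts F => [|[t l] ts IH] F Ff Fs /=.
  rewrite del0E [(0 : W) bs]/0 addr0 add0n /koszul_h.
  rewrite (eq_bigr (fun=> F [::] bs)) ?sumr_const ?card_ord // => i _.
  rewrite /koszul_d altsum_cons altsum0 subr0 qj /iS.
  by apply: (sform_sym (Fs _)); exact: perm_rem_at.
set x := if t then _ else _.
rewrite -[X in X bs + _]/(iL x (koszul_h (koszul_d F)) (pure_list ts)).
rewrite -[X in _ + X bs]/(iL x (koszul_d (koszul_h F)) (pure_list ts)).
rewrite -[X in X bs *+ _]/(iL x F (pure_list ts)).
rewrite iL_kap; last exact: aform_del.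
rewrite !iL_del (iL_kap x Ff) kapD !kapN delN iSF_kap !(addfE, oppfE).
have -> : iL (j (q x)) F (pure_list ts) bs = iL x F (pure_list ts) bs *+ t.
  rewrite {}/x; case: t.
    by rewrite -[j (q _)]/(pB (pB l)) projB_B.
  by rewrite q_projA bm_sec0 /iL aform0.
rewrite -addnA mulrnDr -(IH (iL x F)); [|exact: aform_iL|exact: svalued_iL].
by zmod.
Qed.

Lemma B_weight0 w F : (forall ls, F ls = 0) -> forall ls bs, B_weight S w F ls bs = 0.
Proof. by move=> F0 ls bs; rewrite /B_weight big1 // => m _; rewrite F0. Qed.

Lemma B_weightD w F G ls bs :
  B_weight S w (F + G : cochain L B V) ls bs =
  B_weight S w F ls bs + B_weight S w G ls bs.
Proof. exact: big_split. Qed.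

Lemma B_weight_nil w F bs : B_weight S w F [::] bs = if w == 0%N then F [::] bs else 0.
Proof.
rewrite /B_weight; case: w => [|w]; last first.
  by rewrite big_pred0 // => m; rewrite [m]tuple0.
rewrite (eq_bigl xpredT); last by move=> m; rewrite [m]tuple0.
by rewrite (big_tuple0 (fun m => F [seq _ | bl <- zip m [::]] bs)).
Qed.

Lemma B_weight_cons w F l ls bs : B_weight S w F (l :: ls) bs =
  (if w is w'.+1 then B_weight S w' (iL (pB l) F) ls bs else 0) +
  B_weight S w (iL (pA l) F) ls bs.
Proof.
have := big_tuple_cons (size ls) (fun m => count id m == w) (fun m =>
  F [seq (if bl.1 then pB bl.2 else pA bl.2) | bl <- zip m (l :: ls)] bs).
rewrite {1}/B_weight /= => ->; congr (_ + _); case: w => [|w].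
by rewrite big_pred0.
by [].
Qed.

(** The two projections are idempotent and annihilate each other, so only the mask equal to the list
    of marks survives. *)
Lemma B_weight_pure w F ts bs : aform F ->
  B_weight S w F (pure_list ts) bs = if weight ts == w then F (pure_list ts) bs else 0.
Proof.
elim: ts w F => [|[t l] ts IH] w F Ff /=.
  by rewrite B_weight_nil eq_sym.
have fA m : aform (iL m F) by exact: aform_iL.
rewrite B_weight_cons; case: t => /=.
  rewrite projB_B projA_B (B_weight0 w) ?addr0; last by move=> ls; exact: aform0.
  by case: w => [//|w]; rewrite IH.
rewrite projB_A projA_A add0n IH //; case: w => [|w]; first by rewrite add0r.
by rewrite B_weight0 ?add0r // => ls; exact: aform0.
Qed.

Lemma aform_B_weight w F : aform F -> aform (B_weight S w F : sL -> W).
Proof.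
move=> Ff; apply: aformP => n; elim: n w F Ff => [//|n IH] w F Ff.
split.
- move=> f l m ls; apply/funext => bs; rewrite addfE scalefE !B_weight_cons.
  have lin v p : (forall l m, p (l + m) = p l + p m) ->
      (forall f l, p (f *: l) = f *: p l) ->
      B_weight S v (iL (p (f *: l + m)) F) ls bs =
      f *: B_weight S v (iL (p l) F) ls bs + B_weight S v (iL (p m) F) ls bs.
    move=> pD pZ; rewrite pD pZ iL_addl // iL_scalel // B_weightD; congr (_ + _).
    by rewrite /B_weight scaler_sumr.
  have pAD l' m' : pA (l' + m') = pA l' + pA m' by rewrite /proj_A !bm_sec_add.
  have pBD l' m' : pB (l' + m') = pB l' + pB m' by rewrite /proj_B !bm_sec_add.
  have pAZ g l' : pA (g *: l') = g *: pA l' by rewrite /proj_A !bm_sec_scale.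
  have pBZ g l' : pB (g *: l') = g *: pB l' by rewrite /proj_B !bm_sec_scale.
  case: w => [|w]; rewrite !(lin _ pA, lin _ pB) // ?add0r //.
  by rewrite scalerDr; zmod.
- move=> l ls; apply/funext => bs.
  have z v m : B_weight S v (iL m (iL m F)) ls bs = 0.
    by apply: B_weight0 => ls'; exact: aform_self.
  have sw v : B_weight S v (iL (pA l) (iL (pB l) F)) ls bs +
      B_weight S v (iL (pB l) (iL (pA l) F)) ls bs = 0.
    rewrite -B_weightD iL_swap // addNr.
    exact: B_weight0.
  case: w => [|[|w]]; rewrite !B_weight_cons !z ?add0r ?addr0 //; exact: sw.
- move=> l.
  have -> : iL l (B_weight S w F : sL -> W) =
      (if w is w'.+1 then B_weight S w' (iL (pB l) F) : sL -> W else 0) +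
      (B_weight S w (iL (pA l) F) : sL -> W).
    apply/funext => ls; apply/funext => bs; rewrite /iL B_weight_cons.
    by case: w.
  apply: aform_uptoD; last by apply: IH; exact: aform_iL.
  case: w => [|w]; last by apply: IH; exact: aform_iL.
  by apply: aform_uptoP; split=> // *; rewrite !zerofE scaler0 addr0.
Qed.

Lemma svalued_B_weight w F : svalued F -> svalued (B_weight S w F : sL -> W).
Proof.
move=> Fs ls.
have -> : B_weight S w F ls = \sum_(m : (size ls).-tuple bool | count id m == w)
    F [seq (if bl.1 then pB bl.2 else pA bl.2) | bl <- zip m ls].
  by apply/funext => bs; rewrite fct_sumE.
by apply: sform_sum => m _; exact: Fs.
Qed.

End values.
End homotopy_operator.

(** * The weighted homotopy *)

Section homotopy_identities.
Context {R : realType} {M : smooth_manifold R} {k : ground_field}.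
Local Notation C := (smoothfun M k).
Local Notation K := (Defs.scalar R k).
Context {A L : lie_algebroid M k} {B : vbundle M k} {P : lie_pair A L B}.
Context (S : splitting P) {V : lmodType C}.
Local Notation sL := (seq (section L)).
Local Notation sB := (seq (section B)).
Local Notation W := (sB -> V).
Local Notation q := (bm_sec (lp_q P)).
Local Notation j := (bm_sec (sp_j S)).
Local Notation weight ts := (count (@fst bool (section L)) ts).
Local Notation kap := (@koszul_h _ _ _ _ _ _ _ S V).
Local Notation del := (@koszul_d _ _ _ _ _ _ P V).
Local Notation pl := (pure_list S).
Implicit Types (F G : cochain L B V).

Lemma is_form_aforms F : aform (F : sL -> W) -> svalued (F : sL -> W) -> is_form F.
Proof. by move=> Fa Fs; apply/is_formP. Qed.

(** The coefficients depend only on the lengths of the two lists, which agree on the two sides of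
    each condition. *)
Lemma is_form_weighted (G : nat -> cochain L B V) (c : nat -> nat -> C)
    (N : nat -> nat) : (forall w, is_form (G w)) ->
  is_form (fun ls bs =>
    \sum_(1 <= w < N (size ls)) c w (size bs) *: G w ls bs).
Proof.
move=> Gf; split.
- move=> s1 s2 bs f l l'; rewrite !size_cat /= scaler_sumr -big_split /=.
  apply: eq_bigr => w _; rewrite (form_multilinear_L (Gf w)).
  by rewrite scalerDr !scalerA mulrC.
- move=> ls s1 s2 f b b'; rewrite !size_cat /= scaler_sumr -big_split /=.
  apply: eq_bigr => w _; rewrite (form_multilinear_B (Gf w)).
  by rewrite scalerDr !scalerA mulrC.
- move=> s1 s2 s3 bs l; rewrite big1 // => w _.
  by rewrite (form_alternating (Gf w)) scaler0.
- move=> ls bs bs' p; rewrite (perm_size p); apply: eq_bigr => w _.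
  by rewrite (form_symmetric (Gf w) _ p).
Qed.

Lemma is_form_kap F : is_form F -> is_form (kap F).
Proof.
case/is_formP => Fa Fs; apply: is_form_aforms; first exact: aform_kap.
exact: svalued_kap.
Qed.

Lemma is_form_del F : is_form F -> is_form (del F).
Proof.
case/is_formP => Fa Fs; apply: is_form_aforms; first exact: aform_del.
exact: svalued_del.
Qed.

Lemma is_form_B_weight w F : is_form F -> is_form (B_weight S w F).
Proof.
case/is_formP => Fa Fs; apply: is_form_aforms; first exact: aform_B_weight.
exact: svalued_B_weight.
Qed.

Lemma homotopyE F : homotopy S F = fun ls bs =>
  \sum_(1 <= v < (size ls).+2)
    smooth_cst M ((v + (size bs).-1)%:R^-1 : K) *: kap (B_weight S v F) ls bs.
Proof. by []. Qed.

Lemma is_form_homotopy F : is_form F -> is_form (homotopy S F).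
Proof.
move=> Ff; rewrite homotopyE.
apply: (@is_form_weighted (fun v => kap (B_weight S v F))
  (fun v n => smooth_cst M ((v + n.-1)%:R^-1 : K)) (fun n => n.+2)) => w.
by apply/is_form_kap/is_form_B_weight.
Qed.

Lemma homotopy0E F ls : homotopy S F ls [::] = 0.
Proof. by rewrite homotopyE big1 // => v _; rewrite kap0E scaler0. Qed.

(** Inserting [j b] selects [v = weight ts + 1] while one symmetric argument is used up. The weight
    is thus the inverse of [weight ts + size bs], the eigenvalue in [euler_pure]. *)
Lemma homotopy_pure F ts bs : is_form F ->
  homotopy S F (pl ts) bs =
  smooth_cst M ((weight ts + size bs)%:R^-1 : K) *: kap F (pl ts) bs.
Proof.
move=> Ff; have Fa := is_form_aform Ff.
case: bs => [|b bs]; first by rewrite homotopy0E kap0E scaler0.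
have kE v : kap (B_weight S v F) (pl ts) (b :: bs) =
    if (weight ts).+1 == v then kap F (pl ts) (b :: bs) else 0.
  rewrite /koszul_h; case: ifP => [e|e].
    apply: eq_bigr => i _.
    have := B_weight_pure S v ((true, j (nth 0 (b :: bs) i)) :: ts) (rem_at i (b :: bs)) Fa.
    by rewrite /= projB_j add1n e.
  rewrite big1 // => i _.
  have := B_weight_pure S v ((true, j (nth 0 (b :: bs) i)) :: ts) (rem_at i (b :: bs)) Fa.
  by rewrite /= projB_j add1n e.
rewrite homotopyE; under eq_bigr do rewrite kE.
have wr : (weight ts < (size (pl ts)).+1)%N by rewrite ltnS size_map count_size.
have wi : (weight ts).+1 \in index_iota 1 (size (pl ts)).+2.
  by rewrite mem_index_iota /= ltnS.
have ui : uniq (index_iota 1 (size (pl ts)).+2) by exact: iota_uniq.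
move: (index_iota _ _) wi ui => r wi ui; rewrite (big_rem (weight ts).+1) //=.
rewrite eqxx big_seq big1 ?addr0 ?addSnnS // => v vin.
have [e|_] := eqVneq (weight ts).+1 v; last by rewrite scaler0.
by move: vin; rewrite -e mem_rem_uniq // inE eqxx.
Qed.

(** Moving [b] into the alternating slots keeps [weight ts + size bs], so both weights are constant
    factors and [kap_kap] concludes. *)
Lemma homotopy_homotopy F ls bs : is_form F -> homotopy S (homotopy S F) ls bs = 0.
Proof.
move=> Ff; have Hf := is_form_homotopy Ff.
have HHa := is_form_aform (is_form_homotopy Hf).
apply: (pure_vanish (S := S) HHa) => ts; rewrite homotopy_pure //.
case: bs => [|b bs]; first by rewrite kap0E scaler0.
pose G : cochain L B V := kap F; have e : kap (homotopy S F) (pl ts) (b :: bs) =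
    smooth_cst M ((weight ts + (size bs).+1)%:R^-1 : K) *:
    kap G (pl ts) (b :: bs).
  rewrite [in RHS]/koszul_h scaler_sumr /koszul_h; apply: eq_bigr => i _.
  have := @homotopy_pure F ((true, j (nth 0 (b :: bs) i)) :: ts) (rem_at i (b :: bs)) Ff.
  by rewrite /= projB_j size_rem_at //= -addSnnS add1n.
by rewrite e /G kap_kap ?zerofE ?scaler0 //; exact: is_form_aform.
Qed.

(** [del] moves an argument in the image of [j] to the symmetric side and kills those in the image
    of [i]; the sum of weight and symmetric degree is preserved, and the scalar factors out. *)
Lemma del_homotopy_pure F ts bs : is_form F ->
  del (homotopy S F) (pl ts) bs =
  smooth_cst M ((weight ts + size bs)%:R^-1 : K) *: del (kap F) (pl ts) bs.
Proof.
move=> Ff; have Hf := is_form_homotopy Ff.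
have [kf Fa] := (is_form_kap Ff, is_form_aform Ff).
rewrite /koszul_d /altsum !fct_sumE scaler_sumr; apply: eq_bigr => i _.
rewrite !scalefE scalerA mulrC -scalerA; congr (_ *: _); rewrite /iS.
have si : (i < size ts)%N.
  by rewrite -(size_map (fun x => if x.1 then proj_B S x.2 else proj_A S x.2) ts).
rewrite {-1}/pure_list -map_rem_at (nth_map (false, 0)) // -/(pl (rem_at i ts)).
rewrite -(count_rem_at (@fst bool (section L)) (false, 0) si).
case: (nth _ ts i) => -[] l /=; last first.
  rewrite q_projA (sform0 (is_form_sform _ Hf)) (sform0 (is_form_sform _ kf)).
  by rewrite scaler0.
by rewrite homotopy_pure //= -addSnnS add1n.
Qed.

Lemma homotopy_id F ls b bs : is_form F ->
  homotopy S (del F) ls (b :: bs) + del (homotopy S F) ls (b :: bs) = F ls (b :: bs).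
Proof.
move=> Ff; have [Fa Fs] := (is_formP _).1 Ff.
have df := is_form_del Ff.
apply/eqP; rewrite -subr_eq0; apply/eqP.
pose G : sL -> W := (homotopy S (del F) : sL -> W) + del (homotopy S F) - F.
have Ga : aform G.
  apply: aform_D; last exact: aform_N.
  apply: aform_D; first exact: is_form_aform (is_form_homotopy df).
  exact: is_form_aform (is_form_del (is_form_homotopy Ff)).
rewrite -[LHS]/(G ls (b :: bs)); apply: (pure_vanish (S := S) Ga) => ts.
rewrite /G !(addfE, oppfE) homotopy_pure // del_homotopy_pure // -scalerDr.
(* The symmetric list is nonempty, so the eigenvalue is a positive integer and can be inverted. *)
by rewrite euler_pure // addnS smooth_cstV_Mn // subrr.
Qed.

Lemma homotopy_local F G ls bs :
  (forall ls' bs', (size bs').+1 = size bs -> F ls' bs' = G ls' bs') ->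
  homotopy S F ls bs = homotopy S G ls bs.
Proof.
move=> FG; apply: eq_bigr => v _; congr (_ *: _); apply: eq_bigr => i _.
apply: eq_bigr => m _; apply: FG; rewrite size_rem_at //.
by rewrite (ltn_predK (ltn_ord i)).
Qed.

Lemma homotopyD F G ls bs :
  homotopy S ((F : sL -> W) + G) ls bs = homotopy S F ls bs + homotopy S G ls bs.
Proof.
rewrite -big_split; apply: eq_bigr => v _; rewrite /= -scalerDr -big_split.
by congr (_ *: _); apply: eq_bigr => i _; rewrite B_weightD.
Qed.

Lemma homotopyN F ls bs : homotopy S (- (F : sL -> W)) ls bs = - homotopy S F ls bs.
Proof.
rewrite -sumrN; apply: eq_bigr => v _; rewrite -scalerN -sumrN.
by congr (_ *: _); apply: eq_bigr => i _; rewrite /B_weight -sumrN.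
Qed.

Lemma L_degree_homotopy d F : L_degree d.+1 F -> L_degree d (homotopy S F).
Proof.
move=> Fd ls bs sl; rewrite homotopyE big1 // => v _.
rewrite /koszul_h big1 ?scaler0 // => i _.
rewrite /B_weight big1 // => m _; apply: Fd.
by rewrite size_map size_zip size_tuple minnn /= eqSS.
Qed.

End homotopy_identities.

(** * The fixed point equation *)

Section fedosov.
Context {R : realType} {M : smooth_manifold R} {k : ground_field}.
Local Notation C := (smoothfun M k).
Context {A L : lie_algebroid M k} {B : vbundle M k} (P : lie_pair A L B).
Context (S : splitting P) (nabla : connection L B).
Hypothesis nabla_tf : torsion_free P nabla.
Local Notation sL := (seq (section L)).
Local Notation sB := (seq (section B)).
Local Notation W := (sB -> section B).
Local Notation cochainB := (cochain L B (section B)).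
Local Notation q := (bm_sec (lp_q P)).
Local Notation br := (@la_bracket _ _ _ L).
Local Notation del := (@koszul_d _ _ _ _ _ _ P (section B)).
Local Notation hom := (homotopy S).
Implicit Types (X F G : cochainB) (l m p : section L).

Definition two_form (Z : section L -> section L -> W) : cochainB :=
  fun ls => if ls is [:: l; m] then Z l m else 0.

Lemma two_form_degree Z : L_degree 2 (two_form Z).
Proof. by move=> [|l [|m [|n ls]]] bs. Qed.

Lemma is_form_two_form (Z : section L -> section L -> W) :
  (forall l l' m, Z (l + l') m = Z l m + Z l' m) ->
  (forall f l m, Z (f *: l) m = f *: Z l m) ->
  (forall l m, Z l m = - Z m l) -> (forall l, Z l l = 0) ->
  (forall l m, sform (Z l m)) -> is_form (two_form Z).
Proof.
move=> ZD ZZ ZN Z0 Zs; apply/is_formP; split; last first.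
  by move=> [|l [|m [|n ls]]] //=; exact: sform_0.
have ZDr l m m' : Z l (m + m') = Z l m + Z l m'.
  by rewrite ZN ZD opprD -!ZN.
have ZZr f l m : Z l (f *: m) = f *: Z l m by rewrite ZN ZZ -scalerN -ZN.
have one l : aform (fun ls => if ls is [:: m] then Z l m else 0 : W).
  apply: aformP => -[//|n]; split.
  - by move=> f m m' [|c ls]; rewrite ?ZDr ?ZZr // scaler0 addr0.
  - by [].
  - move=> m; apply: aform_uptoP; split.
      move=> [|c s1] s2 f l1 l2; first by rewrite /iL /= scaler0 addr0.
      by rewrite /iL /= scaler0 addr0.
    by move=> [|c s1] s2 s3 l1.
apply: aformP => -[//|n]; split.
- by move=> f l l' [|m [|m' ls]] /=; rewrite ?ZD ?ZZ // scaler0 addr0.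
- by move=> l [|m ls] /=.
- move=> l; apply: aform_uptoP.
  have -> // : iL l (two_form Z) = (fun ls => if ls is [:: m] then Z l m else 0 : W).
  by apply/funext => -[|m [|m' ls]].
Qed.

Definition ncurv_form (Y : section L -> W) : cochainB := two_form (ncurv nabla Y).

Lemma is_form_ncurv Y : vfield1 Y -> is_form (ncurv_form Y).
Proof.
move=> Yf; apply: is_form_two_form.
- exact: ncurv_addl.
- exact: ncurv_scalel.
- exact: ncurv_antisym.
- exact: ncurv_self.
- exact: sform_ncurv.
Qed.

Local Notation field X := (fun l => X [:: l]).
Local Notation shift X := (shift_field P X).

(** This is [c(X)]: the curvature formed with [X] alone, without the constant part [- q]. *)
Definition curv X : cochainB := ncurv_form (field X).

Lemma is_form_curv X : is_form X -> is_form (curv X).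
Proof. by move=> Xf; apply/is_form_ncurv/vfield1_form. Qed.

Lemma vact_cstv_r (Y : W) (v : section B) : vact Y (cstv v) = 0.
Proof. by apply/funext => bs; apply: masksum_eq0. Qed.

Lemma ndual_cstv l (v : section B) :
  ndual nabla nabla l (cstv v) = cstv (nabla l v).
Proof.
have Nc := vconn_nabla nabla.
apply/funext => -[|b bs]; first by rewrite ndual0E.
rewrite -[LHS]/(iS b (ndual nabla nabla l (cstv v)) bs) iS_ndual !iS_cstv.
by rewrite (ndual0 _ Nc) subr0.
Qed.

Lemma nbracket_shift X l (Z : W) : is_form X -> sform Z ->
  nbracket nabla (shift X) l Z =
  ndual nabla nabla l Z + vact (X [:: l]) Z - vact Z (X [:: l]) - iS (q l) Z.
Proof.
move=> Xf Zf; rewrite /nbracket /shift_field vactDl // vactNl // vact_cstv //.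
by rewrite vactDr vactNr vact_cstv_r; zmod.
Qed.

Lemma del2 F l m : del F [:: l; m] = iS (q l) (F [:: m]) - iS (q m) (F [:: l]).
Proof. by rewrite /koszul_d !altsum_cons altsum0 subr0. Qed.

Lemma del3 F l m p : del F [:: l; m; p] =
  iS (q l) (F [:: m; p]) - iS (q m) (F [:: l; p]) + iS (q p) (F [:: l; m]).
Proof. by rewrite /koszul_d !altsum_cons altsum0 subr0 opprB addrA addrAC. Qed.

(** Constant fields commute with each other, their brackets with [X] add up to [- del X], and their
    covariant derivatives, together with the value of [q] on the bracket, add up to the torsion, up
    to sign. *)
Lemma ncurv_shift X l m : is_form X ->
  ncurv nabla (shift X) l m = ncurv nabla (field X) l m - del X [:: l; m].
Proof.
move=> Xf; have Nc := vconn_nabla nabla.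
have Xs n : sform (X [:: n]) by exact: is_form_sform.
have tor : (cstv (nabla l (q m)) : W) - cstv (nabla m (q l)) - cstv (q (br l m)) = 0.
  apply/funext => -[|b bs]; last by rewrite !(addfE, oppfE) /= !subr0.
  by rewrite !(addfE, oppfE) /= nabla_tf.
rewrite del2 /ncurv /shift_field.
rewrite !vactDl // !vactNl // !vact_cstv // !vactDr !vactNr !vact_cstv_r.
rewrite !(ndualD _ Nc) !(ndualN _ Nc) !ndual_cstv !iSD !iSN !iS_cstv.
apply/eqP; rewrite -subr_eq0; apply/eqP.
rewrite -[RHS]oppr0 -[X in _ = - X]tor.
by zmod.
Qed.

Lemma L_degree_del d F : L_degree d F -> L_degree d.+1 (del F).
Proof.
move=> Fd ls bs lsd; rewrite /koszul_d /altsum fct_sumE big1 // => i _.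
rewrite scalefE /iS Fd ?scaler0 // size_rem_at //; apply: contra lsd => /eqP <-.
by rewrite (ltn_predK (ltn_ord i)).
Qed.

Lemma ncurv_form_shift X : is_form X -> L_degree 1 X ->
  ncurv_form (shift X) = curv X - (del X : sL -> W).
Proof.
move=> Xf X1; have dX := L_degree_del X1.
apply/funext => ls; apply/funext => bs; rewrite !(addfE, oppfE).
have [e|n] := eqVneq (size ls) 2; last first.
  have z Z : two_form Z ls bs = 0 by exact: two_form_degree.
  by rewrite dX // /curv /ncurv_form !z subr0.
case: ls e => [|l [|m [|]]] // _.
by rewrite -[LHS]/(ncurv nabla (shift X) l m bs) ncurv_shift // addfE oppfE.
Qed.

Lemma flatP X : is_form X ->
  (forall F : cochain L B C^o, is_form F -> forall ls bs,
     Q_nabla P nabla X (Q_nabla P nabla X F) ls bs = 0) <->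
  forall l m, ncurv nabla (shift X) l m = 0.
Proof.
move=> Xf; have Yf := vfield1_shift P Xf; have Dc := dconn_ncov nabla Yf.
split=> [Q0 l m|K0 F Ff ls bs].
  apply: vact_faithful => s sf.
  (* A cochain of degree 0, on which the square of [Q] is the action of the curvature on [s]. *)
  pose F : cochain L B C^o := fun ls => if ls is [::] then s else 0.
  have Ff : is_form F.
    apply: is_form_aforms; last by move=> [|n ls] //=; exact: sform_0.
    split=> [[|c s1] s2 f l1 l2|[|c s1] s2 s3 l1] //=; by rewrite scaler0 addr0.
  have [Fa Fs] := (is_formP _).1 Ff.
  rewrite -(ncov_bracket nabla Yf) // -[s]/(F [::]) -(ced_ced2 Dc) //.
  rewrite -Q_nablaE // -Q_nablaE //; last exact: is_form_Q.
  by apply/funext => bs; exact: Q0.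
have [Fa Fs] := (is_formP _).1 Ff.
rewrite Q_nablaE //; last exact: is_form_Q.
rewrite Q_nablaE // (ced_ced Dc) // => l m w wf.
by rewrite (ncov_bracket nabla Yf) // K0 vact0l.
Qed.

Definition agree n F G := forall ls bs, (size bs < n)%N -> F ls bs = G ls bs.

(** The action puts [Y s] in front of [t] but takes away the entries of [s], at least two of them
    wherever [Y] does not vanish; so [Z] is evaluated on at most [size bs] arguments. *)
Lemma vact_local n (Y Y' Z Z' : W) :
  sform Z -> sform Z' ->
  (forall bs, (size bs < 2)%N -> Y bs = 0) ->
  (forall bs, (size bs < 2)%N -> Y' bs = 0) ->
  (forall bs, (size bs < n)%N -> Y bs = Y' bs) ->
  (forall bs, (size bs < n)%N -> Z bs = Z' bs) ->
  forall bs, (size bs < n)%N -> vact Y Z bs = vact Y' Z' bs.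
Proof.
move=> Zf Zf' Y0 Y0' YY ZZ bs bn; apply: eq_masksum => s t st.
have [s2|s2] := ltnP (size s) 2.
  by rewrite Y0 // Y0' // !sform0.
rewrite YY; last by apply: leq_ltn_trans bn; rewrite -st leq_addr.
apply: ZZ => /=; apply: leq_ltn_trans bn; rewrite -st.
by apply: leq_trans (leq_add (ltnW s2) (leqnn _)).
Qed.

Lemma ndual_local n l (Z Z' : W) :
  (forall bs, (size bs < n)%N -> Z bs = Z' bs) ->
  forall bs, (size bs < n)%N -> ndual nabla nabla l Z bs = ndual nabla nabla l Z' bs.
Proof.
move=> ZZ bs bn; rewrite !ndualE ZZ //; congr (_ - _); apply: eq_bigr => t _.
by apply: ZZ; rewrite size_set_nth (maxn_idPr _).
Qed.

Lemma curv_local n F G : is_form F -> is_form G ->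
  S_degree_ge 2 F -> S_degree_ge 2 G -> agree n F G -> agree n (curv F) (curv G).
Proof.
move=> Ff Gf F2 G2 FG ls bs bn.
have [e|h] := eqVneq (size ls) 2; last first.
  have z Z : two_form Z ls bs = 0 by exact: two_form_degree.
  by rewrite /curv /ncurv_form !z.
case: ls e => [|l [|m [|]]] // _.
rewrite /curv /ncurv_form /two_form /ncurv !(addfE, oppfE).
have Fs i : sform (F [:: i]) by exact: is_form_sform.
have Gs i : sform (G [:: i]) by exact: is_form_sform.
have F20 i bs' : (size bs' < 2)%N -> F [:: i] bs' = 0 by exact: F2.
have G20 i bs' : (size bs' < 2)%N -> G [:: i] bs' = 0 by exact: G2.
have FGi i bs' : (size bs' < n)%N -> F [:: i] bs' = G [:: i] bs' by exact: FG.
have v i i' := vact_local (Fs i') (Gs i') (F20 i) (G20 i) (FGi i) (FGi i') bn.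
by rewrite !v !(ndual_local _ (FGi _) bn) FGi.
Qed.

(** This keeps the bound 2 stable under iteration: [hom] raises the symmetric degree by one, so
    [hom (curv F)] also vanishes in degree 1. *)
Lemma curv_nil F ls : is_form F -> S_degree_ge 2 F -> curv F ls [::] = 0.
Proof.
move=> Ff F2; have Nc := vconn_nabla nabla.
have [e|h] := eqVneq (size ls) 2; last exact: two_form_degree.
case: ls e => [|l [|m [|]]] // _.
rewrite /curv /ncurv_form /two_form /ncurv !(addfE, oppfE) !ndual0E !vact0E.
by rewrite !F2 // !(vc_0 Nc) /= !(subr0, addr0, oppr0).
Qed.

Lemma agree_hom n F G : agree n F G -> agree n.+1 (hom F) (hom G).
Proof.
move=> FG ls [|b bs] bn; first by rewrite !homotopy0E.
by apply: homotopy_local => ls' bs' [e]; apply: FG; rewrite e.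
Qed.

Lemma hom0 F ls bs : (forall ls bs, F ls bs = 0) -> hom F ls bs = 0.
Proof.
move=> F0; rewrite homotopyE big1 // => v _; rewrite /koszul_h big1 ?scaler0 // => i _.
by rewrite /B_weight big1 // => w _; rewrite F0.
Qed.

Record admissible X : Prop := Admissible {
  adm_form : is_form X ; adm_L : L_degree 1 X ; adm_S : S_degree_ge 2 X }.

Lemma admissible_step X : admissible X -> admissible (hom (curv X)).
Proof.
move=> [Xf X1 X2]; split.
- by apply/is_form_homotopy/is_form_curv.
- by apply: L_degree_homotopy; exact: two_form_degree.
- move=> ls [|b [|c bs]] // _; first exact: homotopy0E.
  rewrite (@homotopy_local _ _ _ _ _ _ _ S _ (curv X) 0).
    by apply: hom0.
  by move=> ls' [|//] _; rewrite curv_nil.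
Qed.

Lemma is_form_0 : is_form (0 : cochainB).
Proof. by split=> // *; rewrite !zerofE scaler0 addr0. Qed.

Definition approx n : cochainB := iter n (fun X => hom (curv X)) 0.

Lemma admissible_approx n : admissible (approx n).
Proof.
elim: n => [|n IH]; last exact: admissible_step.
by split=> //; exact: is_form_0.
Qed.

Lemma agree_step n F G : admissible F -> admissible G ->
  agree n F G -> agree n.+1 (hom (curv F)) (hom (curv G)).
Proof.
by move=> [Ff F1 F2] [Gf G1 G2] FG; apply/agree_hom/curv_local.
Qed.

Lemma agree_approx n i : agree n (approx n) (approx (n + i)).
Proof.
elim: n => [//|n IH]; rewrite addSn.
by apply: agree_step => //; exact: admissible_approx.
Qed.

(** The diagonal limit of the iteration: components with [size bs < n] no longer change from
    [approx n] on, so index [(size bs).+1] already gives the final value. *)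
Definition Xnabla : cochainB := fun ls bs => approx (size bs).+1 ls bs.

Lemma agree_Xnabla n : agree n Xnabla (approx n).
Proof.
move=> ls bs bn; rewrite /Xnabla -(subnKC bn).
exact: agree_approx.
Qed.

Lemma admissible_Xnabla : admissible Xnabla.
Proof.
have ad n := admissible_approx n; split.
(* The symmetric lists within each condition have equal length, so each condition concerns a single
   approximation. *)
- split.
  + by move=> *; exact: form_multilinear_L (adm_form (ad _)) _ _ _ _ _ _.
  + move=> ls s1 s2 f b b'; rewrite /Xnabla !size_cat.
    exact: form_multilinear_B (adm_form (ad _)) _ _ _ _ _ _.
  + by move=> *; exact: form_alternating (adm_form (ad _)) _ _ _ _ _.
  + move=> ls bs bs' pb; rewrite /Xnabla (perm_size pb).
    exact: form_symmetric (adm_form (ad _)) _ _ _ pb.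
- by move=> ls bs h; exact: (adm_L (ad _)).
- by move=> ls bs h; exact: (adm_S (ad _)).
Qed.

Lemma Xnabla_fix : hom (curv Xnabla) = Xnabla.
Proof.
apply/funext => ls; apply/funext => bs.
rewrite [RHS](agree_Xnabla (n := (size bs).+1)) //.
apply: (agree_step (n := size bs)) => //; first exact: admissible_Xnabla.
  exact: admissible_approx.
exact: agree_Xnabla.
Qed.

Lemma hom_del_closed X ls bs : admissible X ->
  (forall ls bs, hom X ls bs = 0) -> hom (del X) ls bs = X ls bs.
Proof.
move=> [Xf X1 X2] hX; case: bs => [|b bs]; first by rewrite homotopy0E X2.
rewrite -[RHS](homotopy_id S _ _ _ Xf).
have -> : hom X = 0 by apply/funext => ls'; apply/funext => bs'; exact: hX.
by rewrite -(scale0r (0 : sL -> W)) delZ scale0r addr0.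
Qed.

Lemma fix_unique X X' : admissible X -> admissible X' ->
  (forall ls bs, hom (curv X) ls bs = X ls bs) ->
  (forall ls bs, hom (curv X') ls bs = X' ls bs) -> X = X'.
Proof.
move=> aX aX' fX fX'.
have ag n : agree n X X'.
  elim: n => [//|n IH] ls bs bn; rewrite -fX -fX'.
  exact: agree_step IH _ _ bn.
by apply/funext => ls; apply/funext => bs; exact: (ag (size bs).+1).
Qed.

Section curvature_vanishes.
Variable X : cochainB.
Hypothesis aX : admissible X.
Hypothesis fX : hom (curv X) = X.
Local Notation kappa := (ncurv nabla (shift X)).
Let Xf : is_form X := adm_form aX.
Let Yf : vfield1 (shift X) := vfield1_shift P Xf.

Lemma hom_fix ls bs : hom X ls bs = 0.
Proof. by rewrite -fX; apply/homotopy_homotopy/is_form_curv. Qed.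

(** Both [curv X] and [del X] have image [X] under [hom]: the former by the fixed point equation,
    the latter by [hom_del_closed]. *)
Lemma hom_kappa ls bs : hom (ncurv_form (shift X)) ls bs = 0.
Proof.
rewrite ncurv_form_shift //; last exact: adm_L.
rewrite homotopyD homotopyN hom_del_closed ?fX ?subrr //.
exact: hom_fix.
Qed.

Lemma kappa_nil l m : kappa l m [::] = 0.
Proof.
rewrite ncurv_shift // addfE oppfE del2 -[ncurv _ _ _ _]/(curv X [:: l; m]).
rewrite curv_nil //; last exact: adm_S.
by rewrite addfE oppfE /iS !(adm_S aX) // !subr0.
Qed.

(** In the Bianchi identity all terms evaluate [kappa] on at most [size bs] arguments, except the
    contractions with [q], which use one more. These alone survive, and they make up [del] of the
    curvature. *)
Lemma kappa_step n : (forall l m bs, (size bs < n)%N -> kappa l m bs = 0) ->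
  forall l m p bs, (size bs < n)%N ->
  del (ncurv_form (shift X)) [:: l; m; p] bs = 0.
Proof.
move=> k0 l m p bs bn; rewrite del3.
have ks i i' : sform (kappa i i') by exact: sform_ncurv.
have Xs i : sform (X [:: i]) by exact: is_form_sform.
have nk i i' i'' : nbracket nabla (shift X) i (kappa i' i'') bs =
    - iS (q i) (kappa i' i'') bs.
  rewrite nbracket_shift // !(addfE, oppfE).
  have Nc := vconn_nabla nabla.
  rewrite (ndual_local (Z' := 0) _ _ bn); last by move=> cs cn; exact: k0.
  rewrite (ndual0 _ Nc) zerofE.
  have -> : vact (X [:: i]) (kappa i' i'') bs = 0.
    apply: masksum_eq0 => s t st.
    have [s2|s2] := ltnP (size s) 2; first by rewrite (adm_S aX) // sform0.
    apply: k0 => /=; apply: leq_ltn_trans bn; rewrite -st.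
    by apply: leq_trans (leq_add (ltnW s2) (leqnn _)).
  have -> : vact (kappa i' i'') (X [:: i]) bs = 0.
    apply: masksum_eq0 => s t st; rewrite k0 ?sform0 //.
    by apply: leq_ltn_trans bn; rewrite -st leq_addr.
  by rewrite !subr0 add0r sub0r.
have := congr1 (fun s : W => s bs) (bianchi nabla Yf l m p).
rewrite !addfE !nk !k0 // !addr0 zerofE => h.
(* The Bianchi identity is cyclic, whereas the middle term of [del3] is negative with [l] before
   [p]; antisymmetry reconciles the two. *)
rewrite -![ncurv_form _ _]/(kappa _ _) (ncurv_antisym nabla Yf l p) iSN.
apply/eqP; rewrite -oppr_eq0 -h; apply/eqP; rewrite !(addfE, oppfE).
by zmod.
Qed.

Lemma kappa_eq0 l m : kappa l m = 0.
Proof.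
have Kf : is_form (ncurv_form (shift X)) by exact: is_form_ncurv.
suff k0 n : forall l m bs, (size bs < n)%N -> kappa l m bs = 0.
  by apply/funext => bs; exact: (k0 (size bs).+1).
elim: n => [//|n IH] {}l {}m [|b bs] bn; first exact: kappa_nil.
rewrite -[LHS]/(ncurv_form (shift X) [:: l; m] (b :: bs)) -(homotopy_id S _ _ _ Kf).
have -> : hom (ncurv_form (shift X)) = 0.
  by apply/funext => ls; apply/funext => cs; exact: hom_kappa.
have -> : del (0 : sL -> W) = 0.
  by rewrite -(scale0r (0 : sL -> W)) delZ !scale0r.
rewrite !zerofE addr0 (@homotopy_local _ _ _ _ _ _ _ S _ _ 0); first exact: hom0.
(* Only lists [cs] as long as [bs] are involved, that is of length less than [n], where the
   induction hypothesis feeds [kappa_step]. *)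
move=> ls cs [e].
have [e3|h3] := eqVneq (size ls) 3; last first.
  by apply: (L_degree_del (two_form_degree _)).
case: ls e3 => [|l1 [|l2 [|l3 []]]] // _.
by apply: (kappa_step IH); rewrite e.
Qed.

End curvature_vanishes.

End fedosov.

Theorem proposition2p6 (R : realType) (k : ground_field)
    (M : smooth_manifold R) (A L : lie_algebroid M k) (B : vbundle M k)
    (P : lie_pair A L B) (S : splitting P) (nabla : connection L B)
    (nabla_tf : torsion_free P nabla) :
  let is_Xnabla (X : cochain L B (section B)) :=
    [/\ is_form X, L_degree 1 X, S_degree_ge 2 X,
        (forall ls bs, homotopy S X ls bs = 0) &
        (forall F : cochain L B (smoothfun M k)^o, is_form F ->
           forall ls bs,
           Q_nabla P nabla X (Q_nabla P nabla X F) ls bs = 0)] in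
  (exists! X, is_Xnabla X) /\
  (forall X, is_Xnabla X -> dg_manifold (Q_nabla P nabla X)).
Proof.
move=> is_Xnabla; split; last by move=> X [Xf _ _ _ Q0]; exact: dg_manifold_Q.
have aX := admissible_Xnabla S nabla; have fX := Xnabla_fix S nabla.
exists (Xnabla S nabla); split.
  have [Xf X1 X2] := aX; split=> //; first exact: hom_fix aX fX.
  by apply/(flatP P nabla Xf) => l m; exact: (kappa_eq0 nabla_tf aX fX).
move=> X [Xf X1 X2 hX /(flatP P nabla Xf) K0].
apply: (@fix_unique _ _ _ _ _ _ _ S nabla) => //; first by rewrite fX.
(* Flatness gives [curv X = del X], and [h X = 0] gives [X = h (del X)]; hence [X] solves the fixed
   point equation. *)
move=> ls bs; rewrite -[RHS](@hom_del_closed _ _ _ _ _ _ P S) //.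
congr (homotopy S _ ls bs).
have := ncurv_form_shift nabla_tf Xf X1.
have -> : ncurv_form nabla (shift_field P X) = 0.
  apply/funext => -[|l [|m [|n ls']]] //; exact: K0.
by move/esym/eqP; rewrite subr_eq0 => /eqP.
Qed.
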